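(* (i) For all $g\in\mathcal H^2$ and all $\beta\in[0,1/2]$, $$\dim_{\mathcal H}\big(\mathcal E^-_{\rm DS}(\beta,g)\big)\le1-2\beta\quad\text{and}\quad\dim_{\mathcal P}\big(\mathcal E^+_{\rm DS}(\beta,g)\big)\le1-2\beta .$$ (ii) For quasi-all functions $g\in\mathcal H^2$, for all $\beta\in[0,1/2]$, $$\dim_{\mathcal H}\big(E^-_{\rm DS}(\beta,g)\big)=1-2\beta .$$ (iii) There exists a function $g\in\mathcal H^2$ such that, for all $\beta\in[0,1/2]$, $$\dim_{\mathcal H}\big(E_{\rm DS}(\beta,g)\big)=\dim_{\mathcal P}\big(E_{\rm DS}(\beta,g)\big)=1-2\beta .$$
   Context: $\mathcal H^2$ is the Hardy space of Dirichlet series $g(s)=\sum_{k\ge1}a_kk^{-s}$ (with complex coefficients) such that $\|g\|_{\mathcal H^2}^2=\sum_{k\ge1}|a_k|^2<+\infty$. For $g(s)=\sum_{k\ge 1}a_kk^{-s}\in\mathcal H^2$ and $t\in\mathbb R$ define (with $\log0=-\infty$) $$\beta^-_{\rm DS}(t)=\limsup_{n\to+\infty}\frac{\log\big|\sum_{k=1}^na_kk^{-\frac12+it}\big|}{\log\log n},\qquad \beta^+_{\rm DS}(t)=\liminf_{n\to+\infty}\frac{\log\big|\sum_{k=1}^na_kk^{-\frac12+it}\big|}{\log\log n},$$ and, for $\beta\in[0,1/2]$, $$\mathcal E^{\pm}_{\rm DS}(\beta,g)=\{t\in\mathbb R:\ \beta^{\pm}_{\rm DS}(t)\ge\beta\},\qquad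 E^{\pm}_{\rm DS}(\beta,g)=\{t\in\mathbb R:\ \beta^{\pm}_{\rm DS}(t)=\beta\},$$ $$E_{\rm DS}(\beta,g)=\{t\in\mathbb R:\ \beta^-_{\rm DS}(t)=\beta^+_{\rm DS}(t)=\beta\}.$$ $\dim_{\mathcal H}$, $\dim_{\mathcal P}$ are Hausdorff and packing dimension (the empty set has dimension $0$). ''Quasi-all'' means: for all $g$ in a residual subset (one containing a countable intersection of dense open sets). *)

(* Defs.v *)
From HB Require Import structures.
From mathcomp Require Import all_boot all_order all_algebra.
From mathcomp Require Export complex.
From mathcomp Require Import all_classical all_reals all_analysis.
From mathcomp Require Import borel_hierarchy ring lra.

Set Implicit Arguments.
Unset Strict Implicit.
Unset Printing Implicit Defensive.

Import Order.TTheory GRing.Theory Num.Theory.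
Import numFieldNormedType.Exports.
Import ComplexField.Normc.

Local Open Scope classical_set_scope.
Local Open Scope ring_scope.
Local Open Scope complex_scope.

(** * The Hardy space of Dirichlet series *)

Definition h2_sqnorm (R : realType) (a : nat -> R[i]) : \bar R :=
  (\sum_(1 <= k <oo) (normc (a k) ^+ 2)%:E)%E.

(* A Dirichlet series is identified with its coefficients [a 1, a 2, ...]. There
   is no coefficient of index 0; setting it to 0 makes the representation
   unique. *)
Definition hardy2_pred (R : realType) : {pred nat -> R[i]} :=
  [pred a | (a 0%N == 0) && (h2_sqnorm a < +oo)%E].

Record hardy2 (R : realType) := Hardy2 {
  h2coef :> nat -> R[i] ;
  _ : h2coef \in @hardy2_pred R }.

HB.instance Definition _ (R : realType) := [isSub for @h2coef R].
HB.instance Definition _ (R : realType) := [Choice of hardy2 R by <:].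

Section Hardy2Norm.
Context {R : realType}.
Implicit Types (a b : nat -> R[i]) (g h : hardy2 R).

Let psum a n : R := \sum_(1 <= k < n) normc (a k) ^+ 2.

Let normc_ge0 (z : R[i]) : 0 <= normc z.
Proof. by case: z => x y; rewrite sqrtr_ge0. Qed.

Let sqnorm_ge0 a : (0 <= h2_sqnorm a)%E.
Proof. by apply: nneseries_ge0 => k _ _; rewrite lee_fin sqr_ge0. Qed.

Let psum_le a n : ((psum a n)%:E <= h2_sqnorm a)%E.
Proof.
rewrite /psum -sumEFin.
by apply: nneseries_lim_ge => k _ _; rewrite lee_fin sqr_ge0.
Qed.

Let sqnorm_le a (M : \bar R) :
  (forall n, ((psum a n)%:E <= M)%E) -> (h2_sqnorm a <= M)%E.
Proof.
move=> aM; apply: lime_le.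
  by apply: is_cvg_nneseries => k _ _; rewrite lee_fin sqr_ge0.
by apply: nearW => n; rewrite sumEFin; exact: aM.
Qed.

Let sqnorm0 : h2_sqnorm (0 : nat -> R[i]) = 0%E.
Proof.
by apply: eseries0 => k _ _; rewrite [normc _]normc0 expr0n.
Qed.

Let sqnormZ_le (z : R[i]) a :
  (h2_sqnorm (z *: a) <= (normc z ^+ 2)%:E * h2_sqnorm a)%E.
Proof.
apply: sqnorm_le => n.
rewrite (_ : psum _ _ = normc z ^+ 2 * psum a n); last first.
  rewrite /psum mulr_sumr; apply: eq_bigr => k _.
  by rewrite [normc _]normcM exprMn.
by rewrite EFinM lee_wpmul2l ?lee_fin ?sqr_ge0// psum_le.
Qed.

(* (x + y)^2 <= (A + B)(x^2 / A + y^2 / B), summed *)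
Let sqnormD_le a b (A B : R) : 0 < A -> 0 < B ->
  (h2_sqnorm a <= (A ^+ 2)%:E)%E -> (h2_sqnorm b <= (B ^+ 2)%:E)%E ->
  (h2_sqnorm (a + b)%R <= ((A + B) ^+ 2)%:E)%E.
Proof.
move=> A0 B0 aA bB; apply: sqnorm_le => n; rewrite lee_fin.
have pa : psum a n <= A ^+ 2 by rewrite -lee_fin (le_trans (psum_le _ _)).
have pb : psum b n <= B ^+ 2 by rewrite -lee_fin (le_trans (psum_le _ _)).
apply: (@le_trans _ _ ((A + B) * (A^-1 * psum a n + B^-1 * psum b n))).
  rewrite /psum !mulr_sumr -big_split mulr_sumr /=; apply: ler_sum => k _.
  set x := normc (a k); set y := normc (b k).
  have xy : normc ((a + b) k) <= x + y by exact: le_normcD.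
  apply: (@le_trans _ _ ((x + y) ^+ 2)).
    by rewrite lerXn2r// nnegrE ?addr_ge0 ?normc_ge0.
  rewrite -subr_ge0 (_ : _ - _ = (x * B - y * A) ^+ 2 / (A * B)); last first.
    by field; rewrite !gt_eqF.
  by rewrite divr_ge0 ?sqr_ge0// ltW// mulr_gt0.
rewrite expr2 ler_pM2l ?addr_gt0//; apply: lerD.
  by rewrite ler_pdivrMl// -expr2.
by rewrite ler_pdivrMl// -expr2.
Qed.

Let sqnorm_lt g : (h2_sqnorm g < +oo)%E.
Proof. by case: g => a /= /andP[]. Qed.

Definition h2_norm g : R := Num.sqrt (fine (h2_sqnorm g)).

Let sqnormE a : (h2_sqnorm a < +oo)%E ->
  h2_sqnorm a = (Num.sqrt (fine (h2_sqnorm a)) ^+ 2)%:E.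
Proof.
move=> aoo; rewrite sqr_sqrtr ?fine_ge0// fineK//.
by rewrite ge0_fin_numE.
Qed.

Let sqnormD_lty a b : (h2_sqnorm a < +oo)%E -> (h2_sqnorm b < +oo)%E ->
  forall e : R, 0 < e -> (h2_sqnorm (a + b)%R <=
    ((Num.sqrt (fine (h2_sqnorm a)) + e +
      (Num.sqrt (fine (h2_sqnorm b)) + e)) ^+ 2)%:E)%E.
Proof.
move=> aoo boo e e0.
have le_sq (x : R) : 0 <= x -> x ^+ 2 <= (x + e) ^+ 2.
  by move=> x0; rewrite lerXn2r ?nnegrE ?lerDl ?addr_ge0// ltW.
apply: sqnormD_le; rewrite ?ltr_wpDl ?sqrtr_ge0//.
- by rewrite {1}(sqnormE aoo) lee_fin le_sq ?sqrtr_ge0.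
- by rewrite {1}(sqnormE boo) lee_fin le_sq ?sqrtr_ge0.
Qed.

Lemma hardy2_submod_closed : submod_closed (@hardy2_pred R).
Proof.
split=> [|z a b /andP[/eqP a0 aoo] /andP[/eqP b0 boo]].
  by rewrite inE /= eqxx sqnorm0 ltry.
apply/andP; split.
  by apply/eqP; rewrite [LHS](_ : _ = z *: a 0%N + b 0%N)// a0 b0 scaler0 addr0.
have zaoo : (h2_sqnorm (z *: a) < +oo)%E.
  rewrite (le_lt_trans (sqnormZ_le z a))// (sqnormE aoo).
  by rewrite -EFinM ltry.
by rewrite (le_lt_trans (sqnormD_lty zaoo boo ltr01))// ltry.
Qed.

HB.instance Definition _ :=
  GRing.isSubmodClosed.Build _ _ (@hardy2_pred R) hardy2_submod_closed.
HB.instance Definition _ := [SubChoice_isSubLmodule of hardy2 R by <:].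

Let h2_normE g : h2_sqnorm g = (h2_norm g ^+ 2)%:E.
Proof. exact: sqnormE. Qed.

Let h2_normD g h : h2_norm (g + h) <= h2_norm g + h2_norm h.
Proof.
apply/ler_addgt0Pr => e e0.
have e2 : 0 < e / 2 by rewrite divr_gt0.
have := sqnormD_lty (sqnorm_lt g) (sqnorm_lt h) e2.
rewrite -[in X in (X <= _)%E](_ : h2coef (g + h) = h2coef g + h2coef h)//.
rewrite h2_normE lee_fin ler_sqr ?nnegrE.
- by move=> /le_trans; apply; rewrite -/(h2_norm g) -/(h2_norm h); lra.
- exact: sqrtr_ge0.
- by rewrite !addr_ge0 ?sqrtr_ge0// ltW.
Qed.

Let h2_normZ_le (z : R[i]) g : h2_norm (z *: g) <= normc z * h2_norm g.
Proof.
rewrite -ler_sqr ?nnegrE ?mulr_ge0 ?sqrtr_ge0 ?normc_ge0// exprMn.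
by rewrite -lee_fin (EFinM (normc z ^+ 2)) -!h2_normE; exact: sqnormZ_le.
Qed.

Let h2_normZ (z : R[i]) g : h2_norm (z *: g) = normc z * h2_norm g.
Proof.
apply/eqP; rewrite eq_le h2_normZ_le/=.
have [->|z0] := eqVneq z 0; first by rewrite normc0 mul0r sqrtr_ge0.
have nz0 : 0 < normc z.
  by rewrite lt_neqAle normc_ge0 andbT eq_sym; apply: contra z0 => /eqP/eq0_normc ->.
have := h2_normZ_le z^-1 (z *: g).
by rewrite scalerA mulVf// scale1r normcV ler_pdivlMl.
Qed.

Let h2_norm_eq0 g : h2_norm g = 0 -> g = 0.
Proof.
move=> g0; apply: val_inj; apply/funext => k.
rewrite [RHS](_ : _ = 0)//.
case: k => [|k]; first by case: g {g0} => a /= /andP[/eqP].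
have := psum_le g k.+2; rewrite h2_normE g0 expr0n lee_fin /psum => pk.
have : normc (g k.+1) ^+ 2 <= 0.
  apply: le_trans pk; rewrite big_nat_recr//= lerDr.
  by apply: sumr_ge0 => i _; exact: sqr_ge0.
rewrite le_eqVlt ltNge sqr_ge0 orbF sqrf_eq0 => /eqP.
exact: eq0_normc.
Qed.

Let h2_normC (g : hardy2 R) : R[i] := (h2_norm g)%:C.

Let h2_normC_D g h : h2_normC (g + h) <= h2_normC g + h2_normC h.
Proof. by rewrite /h2_normC -rmorphD lecR h2_normD. Qed.

Let h2_normC_Z (z : R[i]) g : h2_normC (z *: g) = `|z| * h2_normC g.
Proof. by rewrite /h2_normC h2_normZ rmorphM. Qed.

Let h2_normC_eq0 g : h2_normC g = 0 -> g = 0.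
Proof. by case=> /h2_norm_eq0. Qed.

HB.instance Definition _ := Lmodule_isNormed.Build R[i] (hardy2 R)
  h2_normC_D h2_normC_Z h2_normC_eq0.

End Hardy2Norm.

Lemma hardy2_normE (R : realType) (g : hardy2 R) : `|g| = (h2_norm g)%:C.
Proof. by []. Qed.

Definition residual (T : topologicalType) (S : set T) : Prop :=
  exists2 G : set T, Gdelta_dense G & G `<=` S.

(** * Hausdorff and packing dimensions of subsets of the real line *)

Section Dimensions.
Context {R : realType}.
Implicit Types (s delta : R) (E A : set R).
Local Open Scope ereal_scope.

Definition diameter A : \bar R :=
  ereal_sup [set `|x - y|%:E | x in A & y in A].

(* |A|^s, with |set0|^s = 0 also when s = 0 *)
Definition diam_pow s A : \bar R :=
  if A == set0 then 0 else diameter A `^ s.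

Definition hausdorff_premeasure s delta E : \bar R :=
  ereal_inf [set \sum_(0 <= i <oo) diam_pow s (U i) | U in
    [set U : (set R)^nat |
      (forall i, diameter (U i) <= delta%:E) /\ E `<=` \bigcup_i U i]].

Definition hausdorff_measure s E : \bar R :=
  ereal_sup [set hausdorff_premeasure s delta E |
    delta in [set delta | (0 < delta)%R]].

Definition hausdorff_dim E : \bar R :=
  ereal_inf [set s%:E | s in [set s | (0 <= s)%R /\ hausdorff_measure s E = 0]].

(* [D] indexes an at most countable family of balls, possibly finite or empty *)
Definition is_packing delta E (D : set nat) (c r : nat -> R) : Prop :=
  [/\ forall i, D i -> E (c i),
      forall i, D i -> (0 < r i <= delta)%R &
      trivIset D (fun i => closed_ball (c i) (r i))].

Definition packing_premeasure_at s delta E : \bar R :=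
  ereal_sup [set x | exists D c r, is_packing delta E D c r /\
    x = \esum_(i in D) diam_pow s (closed_ball (c i) (r i))].

Definition packing_premeasure s E : \bar R :=
  ereal_inf [set packing_premeasure_at s delta E |
    delta in [set delta | (0 < delta)%R]].

(* [packing_premeasure s] is not countably subadditive *)
Definition packing_measure s E : \bar R :=
  ereal_inf [set \sum_(0 <= i <oo) packing_premeasure s (F i) | F in
    [set F : (set R)^nat | E `<=` \bigcup_i F i]].

Definition packing_dim E : \bar R :=
  ereal_inf [set s%:E | s in [set s | (0 <= s)%R /\ packing_measure s E = 0]].

End Dimensions.

(** * Growth of the partial sums on the critical line *)

Section Divergence.
Context {R : realType}.
Implicit Types (g : hardy2 R) (t beta : R).

(* k^(-1/2 + it) for k >= 1 *)
Definition dirichlet_monomial t (k : nat) : R[i] :=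
  (k%:R `^ (- 2^-1))%:C * (cos (t * ln k%:R) +i* sin (t * ln k%:R)).

Definition dirichlet_sum g t (n : nat) : R[i] :=
  \sum_(1 <= k < n.+1) g k * dirichlet_monomial t k.

(* [lne 0 = -oo]; the quotient is meaningful for n >= 3, where log log n > 0 *)
Definition growth_exponent g t (n : nat) : \bar R :=
  (lne (normc (dirichlet_sum g t n))%:E / (ln (ln n%:R))%:E)%E.

Definition beta_DS_minus g t : \bar R := limn_esup (growth_exponent g t).

Definition beta_DS_plus g t : \bar R := limn_einf (growth_exponent g t).

Definition calE_DS_minus beta g : set R :=
  [set t | (beta%:E <= beta_DS_minus g t)%E].

Definition calE_DS_plus beta g : set R :=
  [set t | (beta%:E <= beta_DS_plus g t)%E].

Definition E_DS_minus beta g : set R := [set t | beta_DS_minus g t = beta%:E].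

Definition E_DS_plus beta g : set R := [set t | beta_DS_plus g t = beta%:E].

Definition E_DS beta g : set R :=
  [set t | beta_DS_minus g t = beta%:E /\ beta_DS_plus g t = beta%:E].

End Divergence.

(* Main.v *)
(** Write [S_n(t)] for the partial sums. The kernel [sum_(k <= N) k^(-1 + iu)]
    is [O(min (1 + log N, 1 / |u| + 1 + |u|))] uniformly in [N], so the
    Kolmogorov-Seliverstov duality argument, with a truncation depending on the
    point, shows that at [2^-m]-separated points of [[-m, m]] the maximal function
    of the [S_N] with [log N <= 2^(m + 1)] has [l2] norm [O(m 2^(m/2))]. Hence
    [|S_N| >= (log N)^b] can happen at such scales in only [O(m^2 2^(m (1 - 2 b)))]
    cells of length [2^-m], which gives both upper bounds.

    For the lower bounds, coefficients [k^(-1/2) c_u] with [u] the integer part of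
    [log_2 k] turn [S_N(t)] into a partial sum, up to [log_2 N], of a power series
    in [w = 2^(it)]. This series is the lacunary product of the factors
    [1 + kappa_i sum_(0 < v < V_i) w^(v 2^(a_i))], where [kappa_i^2 V_i] is summable.
    If the binary digits of [t log 2 / (2 pi)] vanish on the [i]-th block, then the
    [i]-th factor has size [kappa_i V_i] (almost the square root of [2] to the
    length of the block) and no cancellation occurs in its partial sums; if the
    digits keep [w^(2^(a_i))] away from [1], the factor and its partial sums are
    close to [1]. Choosing zero blocks of density [2 beta] and free digits elsewhere
    gives a Cantor set of dimension [1 - 2 beta] on which [|S_N| >= (log N)^(beta - o(1))]
    for all [N]; a larger exponent only occurs on a null set by the upper bound.
    For a generic function the coefficients up to [n] are, for infinitely many [n],
    within [log log n / 2] in [l1] norm of those of this single series, so it inherits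
    the lower bound for the limsup. *)

Require Import Defs.
From mathcomp Require Import all_boot all_order all_algebra.
From mathcomp Require Import all_classical all_reals all_analysis.
From mathcomp Require Import ring lra zify.

Set Implicit Arguments.
Unset Strict Implicit.
Unset Printing Implicit Defensive.

Import Order.TTheory GRing.Theory Num.Theory.
Import numFieldNormedType.Exports.
Import ComplexField.Normc.

Local Open Scope classical_set_scope.
Local Open Scope ring_scope.
Local Open Scope complex_scope.

(** * Hausdorff and packing measures *)

Section HausdorffPacking.
Context {R : realType}.
Implicit Types (s delta : R) (E A U : set R).
Local Open Scope ereal_scope.

(** Only exponents are at stake, and [m] is about [log log N]: factors polynomial in [m] are
    harmless, which is why an elementary duality bound suffices for the maximal function. The
    saturating series must not depend on [beta]. Its blocks are fixed once and for all, and [beta]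
    only decides which blocks of digits of the point vanish; so one series, and one residual set,
    serve every [beta]. Block lengths grow quadratically: the [i]-th factor wastes about [i] digits,
    negligible against [i ^ 2], and one block is negligible against the cubic total length, so a
    partial sum that stops inside a block does not affect the exponent. No measure is constructed on
    the Cantor set. It is parametrized by [[0, 1]] through a map whose inverse is Hölder, so
    Hausdorff-null subsets pull back to Lebesgue-null ones. The lower bound for the packing
    dimension is reduced to the Hausdorff case, as packing-null sets are Hausdorff-null. *)

Lemma diam_pow_ge0 s A : 0 <= diam_pow s A.
Proof. by rewrite /diam_pow; case: ifP => // _; exact: poweR_ge0. Qed.

Lemma diameter_le A (d : R) :
  (forall x y, A x -> A y -> (`|x - y| <= d)%R) -> diameter A <= d%:E.
Proof.
by move=> Ad; apply: ge_ereal_sup => _ [x Ax [y Ay] <-]; rewrite lee_fin Ad.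
Qed.

Lemma dist_le_diameter A x y : A x -> A y -> `|x - y|%:E <= diameter A.
Proof. by move=> Ax Ay; apply: ereal_sup_ubound; exists x => //; exists y. Qed.

Lemma diameter_ge0 A x : A x -> 0 <= diameter A.
Proof. by move=> Ax; have := dist_le_diameter Ax Ax; rewrite subrr normr0. Qed.

Lemma le_diam_pow s A B : (0 <= s)%R -> A !=set0 -> B !=set0 ->
  diameter A <= diameter B -> diam_pow s A <= diam_pow s B.
Proof.
move=> s0 /[dup] A0 [a Aa] /[dup] B0 [b Bb] AB.
move/set0P : A0 => /negbTE A0; move/set0P : B0 => /negbTE B0.
rewrite /diam_pow A0 B0; apply: gt0_ler_poweR => //.
- by rewrite in_itv/= leey (diameter_ge0 Aa).
- by rewrite in_itv/= leey (diameter_ge0 Bb).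
Qed.

Lemma diam_pow_le s A (d : R) : (0 <= s)%R -> (0 <= d)%R ->
  diameter A <= d%:E -> diam_pow s A <= (d `^ s)%:E.
Proof.
move=> s0 d0 Ad; rewrite /diam_pow; case: ifP => [_|/negbT/set0P[x Ax]].
  by rewrite lee_fin powR_ge0.
rewrite -poweR_EFin; apply: gt0_ler_poweR => //.
- by rewrite in_itv/= leey (diameter_ge0 Ax).
- by rewrite in_itv/= leey lee_fin d0.
Qed.

Lemma hausdorff_premeasure_ge0 s delta E : 0 <= hausdorff_premeasure s delta E.
Proof.
apply: le_ereal_inf_tmp => _ [U _ <-].
by apply: nneseries_ge0 => i _ _; exact: diam_pow_ge0.
Qed.

(** Outside [D] the family is padded with [set0], which costs nothing even for [s = 0] because
    [diam_pow] vanishes on the empty set. *)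
Lemma hausdorff_premeasure_le_esum s delta E (D : set nat) (U : nat -> set R) :
  (forall i, D i -> diameter (U i) <= delta%:E) -> E `<=` \bigcup_(i in D) U i ->
  hausdorff_premeasure s delta E <= \esum_(i in D) diam_pow s (U i).
Proof.
move=> Ud EU; apply: ereal_inf_lbound.
exists (fun i => if i \in D then U i else set0); last first.
  rewrite nneseries_esumT; last by move=> i; exact: diam_pow_ge0.
  rewrite [RHS]esum_mkcond; apply: eq_esum => i _.
  by case: ifPn => // _; rewrite /diam_pow eqxx.
split=> [i|x /EU[i Di Uix]]; last by exists i => //; rewrite mem_set.
case: ifPn => [/set_mem|_]; first exact: Ud.
by apply: ge_ereal_sup => _ [x []].
Qed.

Lemma hausdorff_premeasure_bigcup s delta (E : nat -> set R) :
  hausdorff_premeasure s delta (\bigcup_i E i) <=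
  \sum_(0 <= i <oo) hausdorff_premeasure s delta (E i).
Proof.
have [[i ioo]|Eoo] := pselect (exists i, hausdorff_premeasure s delta (E i) = +oo).
  rewrite (eseries_pinfty _ _ ioo) ?leey// => n _.
  by rewrite -ltNye (lt_le_trans _ (hausdorff_premeasure_ge0 _ _ _)).
apply/lee_addgt0Pr => e e0.
apply: (le_trans _ (epsilon_trick _ _ (ltW e0))); last first.
  by move=> n; exact: hausdorff_premeasure_ge0.
have U_ n : {U : (set R)^nat | [/\ forall i, diameter (U i) <= delta%:E,
    E n `<=` \bigcup_i U i & \sum_(0 <= i <oo) diam_pow s (U i) <=
      hausdorff_premeasure s delta (E n) + (e / (2 ^ n.+1)%:R)%:E]}.
  apply: cid.
  have en : (0 < e / (2 ^ n.+1)%:R)%R by rewrite divr_gt0// ltr0n expn_gt0.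
  have fn : hausdorff_premeasure s delta (E n) \is a fin_num.
    rewrite ge0_fin_numE ?hausdorff_premeasure_ge0//.
    by rewrite ltey; apply/eqP => h; apply: Eoo; exists n.
  have [_ [U [Ud EU] <-] Us] := lb_ereal_inf_adherent en fn.
  by exists U; split => //; exact: ltW.
pose U n := sval (U_ n).
have UP n : [/\ forall i, diameter (U n i) <= delta%:E,
    E n `<=` \bigcup_i U n i & \sum_(0 <= i <oo) diam_pow s (U n i) <=
      hausdorff_premeasure s delta (E n) + (e / (2 ^ n.+1)%:R)%:E].
  exact: svalP (U_ n).
have /card_esym/ppcard_eqP[f] := card_nat2.
apply: (@le_trans _ _ (\esum_(i in setT) diam_pow s (U (f i).1 (f i).2))).
  apply: hausdorff_premeasure_le_esum => [i _|x [n _ Enx]].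
    by have [Ud _ _] := UP (f i).1; exact: Ud.
  have [_ /(_ _ Enx)[k _ Uk] _] := UP n.
  by exists (f^-1%FUN (n, k)) => //=; rewrite invK ?inE.
rewrite -(@reindex_esum _ _ _ setT setT f
  (fun k => diam_pow s (U k.1 k.2))); last exact: bij.
rewrite (_ : setT = setT `*`` (fun=> setT)); last by apply/seteqP; split.
rewrite -(@esum_esum _ _ _ setT (fun=> setT) (fun i j => diam_pow s (U i j))); last first.
  by move=> *; exact: diam_pow_ge0.
rewrite -nneseries_esumT; last first.
  by move=> i; apply: esum_ge0 => j _; exact: diam_pow_ge0.
apply: lee_nneseries => [i _ _|n _]; first by apply: esum_ge0 => j _; exact: diam_pow_ge0.
rewrite -nneseries_esumT; last by move=> i; exact: diam_pow_ge0.
by have [] := UP n.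
Qed.

Lemma hausdorff_premeasureS s delta E A : E `<=` A ->
  hausdorff_premeasure s delta E <= hausdorff_premeasure s delta A.
Proof.
move=> EA; apply: ereal_inf_le_tmp => _ [U [Ud AU] <-].
by exists U => //; split => //; exact: subset_trans AU.
Qed.

Lemma hausdorff_measure_eq0 s E :
  (forall delta e : R, (0 < delta)%R -> (0 < e)%R ->
    hausdorff_premeasure s delta E <= e%:E) ->
  hausdorff_measure s E = 0.
Proof.
move=> H; apply/eqP; rewrite eq_le; apply/andP; split.
  apply: ge_ereal_sup => _ [d /= d0 <-]; apply/lee_addgt0Pr => e e0.
  by rewrite add0e; exact: H.
apply: (le_trans (hausdorff_premeasure_ge0 s 1 E)).
by apply: ereal_sup_ubound; exists 1%R => //=; exact: ltr01.
Qed.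

Lemma hausdorff_premeasure_eq0 s delta E : (0 < delta)%R ->
  hausdorff_measure s E = 0 -> hausdorff_premeasure s delta E = 0.
Proof.
move=> d0 E0; apply/eqP; rewrite eq_le hausdorff_premeasure_ge0 andbT -E0.
by apply: ereal_sup_ubound; exists delta.
Qed.

Lemma hausdorff_measure0_cover s E (delta e : R) : (0 < delta)%R -> (0 < e)%R ->
  hausdorff_measure s E = 0 -> exists U : nat -> set R,
  [/\ forall i, diameter (U i) <= delta%:E, E `<=` \bigcup_i U i &
      \sum_(0 <= i <oo) diam_pow s (U i) < e%:E].
Proof.
move=> d0 e0 /(hausdorff_premeasure_eq0 d0) E0.
have : hausdorff_premeasure s delta E < e%:E by rewrite E0 lte_fin.
by move=> /ereal_inf_lt[_ [U [Ud EU] <-] Ue]; exists U.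
Qed.

Lemma hausdorff_measure0S s E A : E `<=` A ->
  hausdorff_measure s A = 0 -> hausdorff_measure s E = 0.
Proof.
move=> EA A0; apply: hausdorff_measure_eq0 => d e d0 e0.
rewrite (le_trans (hausdorff_premeasureS _ _ EA))//.
by rewrite (hausdorff_premeasure_eq0 d0 A0) lee_fin ltW.
Qed.

Lemma hausdorff_measure0_bigcup s (E : nat -> set R) :
  (forall i, hausdorff_measure s (E i) = 0) ->
  hausdorff_measure s (\bigcup_i E i) = 0.
Proof.
move=> E0; apply: hausdorff_measure_eq0 => d e d0 e0.
rewrite (le_trans (hausdorff_premeasure_bigcup _ _ _))// eseries0 ?lee_fin ?ltW//.
by move=> i _ _; exact: hausdorff_premeasure_eq0.
Qed.

Lemma hausdorff_measure0U s E A : hausdorff_measure s E = 0 ->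
  hausdorff_measure s A = 0 -> hausdorff_measure s (E `|` A) = 0.
Proof.
move=> E0 A0; rewrite (_ : _ `|` _ = \bigcup_i (if i == 0%N then E else A)).
  by apply: hausdorff_measure0_bigcup; case.
apply/seteqP; split => [x [Ex|Ax]|x [[|i] _ /=]]; [by exists 0%N|by exists 1%N|by left|by right].
Qed.

Lemma hausdorff_dim_le E (s : R) : (0 <= s)%R ->
  (forall s', (s < s')%R -> hausdorff_measure s' E = 0) -> hausdorff_dim E <= s%:E.
Proof.
move=> s0 H; apply/lee_addgt0Pr => e e0; apply: ereal_inf_lbound.
exists (s + e)%R => //; split; first by rewrite addr_ge0// ltW.
by apply: H; rewrite ltrDl.
Qed.

Lemma hausdorff_dim_ge E (s : R) :
  (forall s', (0 <= s' < s)%R -> hausdorff_measure s' E <> 0) ->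
  s%:E <= hausdorff_dim E.
Proof.
move=> H; apply: le_ereal_inf_tmp => _ [s' [s'0 Es'] <-].
by rewrite lee_fin leNgt; apply/negP => s's; apply: (H s') => //; rewrite s'0.
Qed.

Lemma hausdorff_dim_ge0 E : 0 <= hausdorff_dim E.
Proof. by apply: le_ereal_inf_tmp => _ [s' [s'0 Es'] <-]; rewrite lee_fin. Qed.

Lemma packing_dim_le E (s : R) : (0 <= s)%R ->
  (forall s', (s < s')%R -> packing_measure s' E = 0) -> packing_dim E <= s%:E.
Proof.
move=> s0 H; apply/lee_addgt0Pr => e e0; apply: ereal_inf_lbound.
exists (s + e)%R => //; split; first by rewrite addr_ge0// ltW.
by apply: H; rewrite ltrDl.
Qed.

Lemma packing_premeasure_at_ge0 s delta E : 0 <= packing_premeasure_at s delta E.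
Proof.
apply: ereal_sup_ubound; exists set0, (fun=> 0%R), (fun=> 0%R); split.
  by split => // i j [].
by rewrite esum_set0.
Qed.

Lemma packing_premeasure_ge0 s E : 0 <= packing_premeasure s E.
Proof.
by apply: le_ereal_inf_tmp => _ [d _ <-]; exact: packing_premeasure_at_ge0.
Qed.

Lemma packing_premeasure_at_mono s delta delta' E : (delta <= delta')%R ->
  packing_premeasure_at s delta E <= packing_premeasure_at s delta' E.
Proof.
move=> dd; apply: ereal_sup_le => _ [D [c [r [[Ec rd tr] ->]]]].
exists D, c, r; split => //; split => // i /rd /andP[-> /=] /le_trans; exact.
Qed.

End HausdorffPacking.

(** * Comparison of packing, Hausdorff and Lebesgue null sets *)

Section PackingVsHausdorff.
Context {R : realType}.
Implicit Types (s delta d : R) (E A U : set R).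

Lemma floor_eq_dist (d x y : R) : 0 < d ->
  Num.floor (x / d) = Num.floor (y / d) -> `|x - y| <= d.
Proof.
move=> d0 xy; have /andP[x1 x2] := floor_itv (x / d).
have /andP[y1 y2] := floor_itv (y / d); move: x1 x2 y1 y2.
rewrite xy rmorphD/= !ler_pdivlMr// !ltr_pdivrMr// => x1 x2 y1 y2.
by rewrite ler_norml; apply/andP; split; lra.
Qed.

Lemma floor_neq_dist (d x y : R) (k : nat) : 0 < d ->
  (k%:Z <= `|Num.floor (x / d) - Num.floor (y / d)|)%R ->
  (k%:R - 1) * d < `|x - y|.
Proof.
move=> d0; wlog xy : x y / Num.floor (y / d) <= Num.floor (x / d).
  move=> H; have [yx|/ltW xy] := leP (Num.floor (y / d)) (Num.floor (x / d)).
    exact: H.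
  by rewrite distrC (distrC x); exact: H.
have /andP[x1 x2] := floor_itv (x / d).
have /andP[y1 y2] := floor_itv (y / d).
rewrite ger0_norm ?subr_ge0// => kxy.
have {kxy} : (k%:Z%:~R : R) <= (Num.floor (x / d) - Num.floor (y / d))%:~R.
  by rewrite ler_int.
move: x1 x2 y1 y2.
rewrite !rmorphD/= rmorphN/= !ler_pdivlMr// !ltr_pdivrMr// => x1 x2 y1 y2 kxy.
apply: (@lt_le_trans _ _ (x - y)); last exact: ler_norm.
rewrite -pmulrn in kxy.
set a := (Num.floor (x / d))%:~R in x1 x2 kxy *.
set b := (Num.floor (y / d))%:~R in y1 y2 kxy *.
nra.
Qed.

Local Open Scope ereal_scope.

Lemma nneseries_ge_term (u : nat -> \bar R) i : (forall n, 0 <= u n) ->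
  u i <= \sum_(0 <= n <oo) u n.
Proof.
move=> u0; apply: (@le_trans _ _ (\sum_(0 <= n < i.+1) u n)); last first.
  by apply: nneseries_lim_ge => *; exact: u0.
by rewrite big_nat_recr//= leeDr// sume_ge0.
Qed.

(** Choose one point of [E] in each occupied cell of the residue class. Two chosen points are more
    than [3 * d] apart, so the balls of radius [d] about them form a packing. Each ball has at least
    the diameter of the piece of [E] in its cell, so this packing dominates the cover by cells. *)
Let packing_class s d E (r : int) : (0 <= s)%R -> (0 < d)%R ->
  hausdorff_premeasure s d [set x | E x /\ (Num.floor (x / d) %% 4)%Z = r]
    <= packing_premeasure_at s d E.
Proof.
(* Cells are numbered by integers while packings are indexed by [nat]; [pickle] is the encoding. *)
move=> s0 d0; pose kap (x : R) : nat := pickle (Num.floor (x / d)).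
have kapI x y : kap x = kap y -> Num.floor (x / d) = Num.floor (y / d).
  exact: (pcan_inj pickleK).
pose A := [set x | E x /\ (Num.floor (x / d) %% 4)%Z = r].
pose D : set nat := kap @` A.
pose c i := xget 0%R [set x | A x /\ kap x = i].
have cP i : D i -> A (c i) /\ kap (c i) = i.
  move=> [x Ax <-].
  by apply: (@xgetPex _ 0%R [set y | A y /\ kap y = kap x]); exists x.
apply: (@le_trans _ _ (\esum_(i in D) diam_pow s (closed_ball (c i) d))); last first.
  apply: ereal_sup_ubound; exists D, c, (fun=> d); split => //; split.
  - by move=> i /cP[[]].
  - by move=> i _; rewrite d0 lexx.
  - move=> i j Di Dj [x []]; rewrite !closed_ballE//= => xi xj.
    have [[_ ri] ki] := cP _ Di; have [[_ rj] kj] := cP _ Dj.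
    have [ij|ij] := eqVneq (Num.floor (c i / d)) (Num.floor (c j / d)).
      by rewrite -ki -kj /kap ij.
    have := @floor_neq_dist d (c i) (c j) 4%N d0.
    have -> : (Posz 4%N <= `|Num.floor (c i / d) - Num.floor (c j / d)|)%R by lia.
    move=> /(_ isT); have := ler_distD (x : R) (c i) (c j).
    rewrite /closed_ball_/= in xi xj; rewrite (distrC (x : R)).
    by move=> ? ?; exfalso; lra.
apply: (@le_trans _ _ (\esum_(i in D) diam_pow s [set x | A x /\ kap x = i])).
  apply: hausdorff_premeasure_le_esum => [i Di|x Ax]; last first.
    by exists (kap x) => //; exists x.
  apply: diameter_le => x y [Ax kx] [Ay ky]; apply: floor_eq_dist => //.
  by apply: kapI; rewrite kx ky.
apply: le_esum => i Di; have [Aci ki] := cP _ Di; apply: le_diam_pow => //.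
- by exists (c i).
- by exists (c i); rewrite closed_ballE// /closed_ball_/= subrr normr0 ltW.
- apply: (@le_trans _ _ d%:E).
    apply: diameter_le => x y [Ax kx] [Ay ky]; apply: floor_eq_dist => //.
    by apply: kapI; rewrite kx ky.
  have dE : d%:E = `|c i - (c i + d)|%:E.
    by rewrite opprD addrA subrr sub0r normrN gtr0_norm.
  rewrite [X in X <= _]dE.
  apply: dist_le_diameter; rewrite closed_ballE// /closed_ball_/=.
    by rewrite subrr normr0 ltW.
  by rewrite opprD addrA subrr sub0r normrN gtr0_norm.
Qed.

Lemma hausdorff_premeasure_le_packing s d E : (0 <= s)%R -> (0 < d)%R ->
  hausdorff_premeasure s d E <= 4%:E * packing_premeasure_at s d E.
Proof.
move=> s0 d0.
pose F (i : nat) := [set x : R | (i < 4)%N /\ (E x /\ (Num.floor (x / d) %% 4)%Z = i)].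
apply: (@le_trans _ _ (hausdorff_premeasure s d (\bigcup_i F i))).
  apply: hausdorff_premeasureS => x Ex; exists `|(Num.floor (x / d) %% 4)%Z|%N => //.
  by split; [lia|split => //; lia].
apply: (le_trans (hausdorff_premeasure_bigcup _ _ _)).
have F0 i : (4 <= i)%N -> hausdorff_premeasure s d (F i) = 0.
  move=> i4; apply/eqP; rewrite eq_le hausdorff_premeasure_ge0 andbT.
  rewrite (_ : F i = set0); last by apply/seteqP; split => x // [/=]; lia.
  apply: (le_trans (@hausdorff_premeasure_le_esum _ s d _ set0 (fun=> set0) _ _)) => //.
  by rewrite esum_set0.
rewrite (nneseries_split 0%N 4%N); last by move=> *; exact: hausdorff_premeasure_ge0.
rewrite add0n [X in _ + X]eseries0 ?adde0; last by move=> i i4 _; exact: F0.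
apply: (@le_trans _ _ (\sum_(0 <= k < 4) packing_premeasure_at s d E)).
  apply: lee_sum => i _; apply: (le_trans _ (packing_class E (Posz i) s0 d0)).
  by apply: hausdorff_premeasureS => x [].
rewrite !big_nat_recr//= big_geq// add0e.
move: (packing_premeasure_at_ge0 s d E).
case: (packing_premeasure_at s d E) => [r| |] // _.
  by rewrite -!EFinD -EFinM lee_fin; lra.
by rewrite mulry gtr0_sg// mul1e leey.
Qed.

Lemma packing_measure_hausdorff s E : (0 <= s)%R ->
  packing_measure s E = 0 -> hausdorff_measure s E = 0.
Proof.
move=> s0 E0; apply: hausdorff_measure_eq0 => d e d0 e0.
(* One [e / 8] goes to the pieces [F i], another to the choice of their scales; the comparison
   constant 4 brings the total to [e]. *)
have e8 : (0 < e / 8)%R by rewrite divr_gt0.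
have : packing_measure s E < (e / 8)%:E by rewrite E0 lte_fin.
move=> /ereal_inf_lt[_ [F EF <-] Fe].
apply: (le_trans (hausdorff_premeasureS _ _ EF)).
apply: (le_trans (hausdorff_premeasure_bigcup _ _ _)).
apply: (@le_trans _ _ (\sum_(0 <= i <oo)
    4%:E * (packing_premeasure s (F i) + (e / 8 / (2 ^ i.+1)%:R)%:E))); last first.
  rewrite nneseriesZl//; last first.
    move=> i _; apply: adde_ge0; first exact: packing_premeasure_ge0.
    by rewrite lee_fin !divr_ge0// ltW.
  apply: (@le_trans _ _ (4%:E * (\sum_(0 <= i <oo) packing_premeasure s (F i) + (e / 8)%:E))).
    apply: lee_wpmul2l => //; apply: epsilon_trick; last exact: ltW.
    by move=> i; exact: packing_premeasure_ge0.
  apply: (@le_trans _ _ (4%:E * ((e / 8)%:E + (e / 8)%:E))).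
    by apply: lee_wpmul2l => //; rewrite leeD2r// ltW.
  by rewrite -EFinD -EFinM lee_fin; lra.
apply: lee_nneseries => [i _ _|i _]; first exact: hausdorff_premeasure_ge0.
have ei : (0 < e / 8 / (2 ^ i.+1)%:R)%R by rewrite divr_gt0// ltr0n expn_gt0.
have [->|Foo] := eqVneq (packing_premeasure s (F i)) +oo.
  by rewrite addye// mulry gtr0_sg// mul1e leey.
have fn : packing_premeasure s (F i) \is a fin_num.
  by rewrite ge0_fin_numE ?packing_premeasure_ge0// ltey.
have [_ [d' /= d'0 <-] Ud] := lb_ereal_inf_adherent ei fn.
(* The scale has to be at most [d] for the cover and at most [d'] for the packing; shrinking it
   raises the Hausdorff premeasure and lowers the packing one, as wanted. *)
have dd0 : (0 < Num.min d d')%R by rewrite lt_min d0.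
apply: (@le_trans _ _ (hausdorff_premeasure s (Num.min d d') (F i))).
  apply: ereal_inf_le_tmp => _ [U [Ud' FU] <-]; exists U => //; split => // j.
  by rewrite (le_trans (Ud' j))// lee_fin ge_min lexx.
apply: (le_trans (hausdorff_premeasure_le_packing _ s0 dd0)).
apply: lee_wpmul2l => //; apply: le_trans (ltW Ud).
by apply: packing_premeasure_at_mono; rewrite ge_min lexx orbT.
Qed.

Lemma packing_dim_ge E s : 
  (forall s', (0 <= s' < s)%R -> hausdorff_measure s' E <> 0) ->
  s%:E <= packing_dim E.
Proof.
move=> H; apply: le_ereal_inf_tmp => _ [s' [s'0 Es'] <-].
rewrite lee_fin leNgt; apply/negP => s's; apply: (H s'); first by rewrite s'0.
exact: packing_measure_hausdorff.
Qed.

(** Plays the part of a mass distribution principle: the preimage of a covering set [U] has diameter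
    at most [C] times the power [s] of that of [U], so the [s]-sum of a cover of [E] controls the
    1-sum of the pulled-back cover. *)
Lemma hausdorff_measure_holder s (C : R) (f : R -> R) D E :
  (0 <= s)%R -> (0 <= C)%R ->
  (forall x y, D x -> D y -> (`|x - y| <= C * `|f x - f y| `^ s)%R) ->
  hausdorff_measure s E = 0 ->
  hausdorff_measure 1 (D `&` f @^-1` E) = 0.
Proof.
move=> s0 C0 fH E0; apply: hausdorff_measure_eq0 => d e d0 e0.
pose e' := (Num.min d e / (C + 1))%R.
have C1 : (0 < C + 1)%R by rewrite ltr_wpDl.
have e'0 : (0 < e')%R by rewrite divr_gt0// lt_min d0 e0.
(* The pulled-back sets are small because every term of the sum is below [e'], not because of the
   scale 1 of this cover. *)
have [U [_ EU Ue]] := hausdorff_measure0_cover ltr01 e'0 E0.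
pose V i := D `&` f @^-1` U i.
have Ufin i : diam_pow s (U i) < e'%:E.
  by apply: le_lt_trans Ue; apply: nneseries_ge_term => *; exact: diam_pow_ge0.
have dV i : diameter (V i) <= C%:E * diam_pow s (U i).
  apply: ge_ereal_sup => _ [x [Dx Ux] [y [Dy Uy] <-]].
  apply: (@le_trans _ _ (C * `|f x - f y| `^ s)%:E).
    by rewrite lee_fin fH.
  rewrite EFinM; apply: lee_wpmul2l; first by rewrite lee_fin.
  have U0 : (U i == set0) = false by apply/negbTE/set0P; exists (f x).
  rewrite /diam_pow U0 -poweR_EFin; apply: gt0_ler_poweR => //.
  - by rewrite in_itv/= leey lee_fin normr_ge0.
  - by rewrite in_itv/= leey (@diameter_ge0 _ (U i) (f x)).
  - exact: dist_le_diameter.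
have dV1 i : diam_pow 1 (V i) <= C%:E * diam_pow s (U i).
  rewrite /diam_pow; case: ifPn => [_|/set0P[x Vx]].
    by apply: mule_ge0; rewrite ?lee_fin//; exact: diam_pow_ge0.
  by rewrite poweRe1 ?dV// (diameter_ge0 Vx).
have CUe : (C * e' <= Num.min d e)%R.
  rewrite /e' mulrC -mulrA mulrC -[leRHS]mul1r ler_wpM2r//.
    by rewrite le_min !ltW.
  by rewrite mulrC ler_pdivrMr// mul1r lerDl.
apply: (@le_trans _ _ (\esum_(i in setT) diam_pow 1 (V i))).
  apply: hausdorff_premeasure_le_esum => [i _|x [Dx /EU[i _ Ui]]]; last by exists i.
  apply: (le_trans (dV i)); apply: (@le_trans _ _ (C%:E * e'%:E)).
    by apply: lee_wpmul2l; rewrite ?lee_fin// ltW.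
  by rewrite -EFinM lee_fin (le_trans CUe)// ge_min lexx.
rewrite -nneseries_esumT; last by move=> *; exact: diam_pow_ge0.
apply: (@le_trans _ _ (C%:E * \sum_(0 <= i <oo) diam_pow s (U i))).
  rewrite -nneseriesZl; last by move=> *; exact: diam_pow_ge0.
  by apply: lee_nneseries => [i _ _|i _ //]; exact: diam_pow_ge0.
apply: (@le_trans _ _ (C%:E * e'%:E)).
  by apply: lee_wpmul2l; rewrite ?lee_fin// ltW.
by rewrite -EFinM lee_fin (le_trans CUe)// ge_min lexx orbT.
Qed.

(** A set of diameter [d] lies in an interval of length [2 * d] about any of its points, so a cover
    of 1-sum below 1/4 would give the unit interval Lebesgue measure at most 1/2. *)
Lemma hausdorff_measure_itv01 : hausdorff_measure 1 `[0%R, 1%R]%classic <> (0 : \bar R).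
Proof.
move=> E0.
have e4 : (0 < 4^-1 :> R)%R by rewrite invr_gt0.
have [U [_ EU Ue]] := hausdorff_measure0_cover ltr01 e4 E0.
have Ufin i : diam_pow 1 (U i) < 4^-1%:E.
  by apply: le_lt_trans Ue; apply: nneseries_ge_term => *; exact: diam_pow_ge0.
have VP i : exists V : set R, [/\ measurable V, U i `<=` V &
    lebesgue_measure V <= 2%:E * diam_pow 1 (U i)].
  have [->|/set0P[x Ux]] := eqVneq (U i) set0.
    by exists set0; split => //; rewrite measure0 /diam_pow eqxx mule0.
  have U0 : (U i == set0) = false by apply/negbTE/set0P; exists x.
  have [d dE] : exists d : R, diameter (U i) = d%:E.
    have := Ufin i; rewrite /diam_pow U0 poweRe1 ?(diameter_ge0 Ux)// => Ui.
    exists (fine (diameter (U i))); rewrite fineK// ge0_fin_numE ?(diameter_ge0 Ux)//.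
    by rewrite (lt_trans Ui)// ltry.
  have d0 : (0 <= d)%R by rewrite -lee_fin -dE (diameter_ge0 Ux).
  exists `[(x - d)%R, (x + d)%R]%classic; split => //.
    move=> y Uy; have := dist_le_diameter Ux Uy; rewrite dE lee_fin ler_norml.
    by rewrite /= in_itv/= => /andP[? ?]; apply/andP; split; lra.
  rewrite lebesgue_measure_itv/= /diam_pow U0 dE -EFinD.
  rewrite poweRe1 ?lee_fin// -EFinM; case: ifP => _; rewrite lee_fin; lra.
pose V i := sval (cid (VP i)).
have VP' i : [/\ measurable (V i), U i `<=` V i &
    lebesgue_measure (V i) <= 2%:E * diam_pow 1 (U i)] := svalP (cid (VP i)).
have : (lebesgue_measure `[0%R, 1%R]%classic <=
    \sum_(0 <= i <oo) lebesgue_measure (V i) :> \bar R).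
  apply: measure_sigma_subadditive => //.
    by move=> i; have [] := VP' i.
  move=> x /EU[i _ Ui]; exists i => //.
  by have [_ + _] := VP' i; exact.
rewrite lebesgue_measure_itv/= lte01 sube0; apply/negP; rewrite -ltNge.
apply: (@le_lt_trans _ _ (2%:E * \sum_(0 <= i <oo) diam_pow 1 (U i))).
  rewrite -nneseriesZl; last by move=> *; exact: diam_pow_ge0.
  by apply: lee_nneseries => [i _ _|i _] //; have [] := VP' i.
apply: (@le_lt_trans _ _ (2%:E * 4^-1%:E)).
  by apply: lee_wpmul2l; rewrite ?lee_fin// ltW.
by rewrite -EFinM lte_fin; lra.
Qed.

End PackingVsHausdorff.

(** * Exponential sums *)

Section ComplexExponential.
Context {R : realType}.
Implicit Types (x y t u : R) (z w : R[i]).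

Definition cis x : R[i] := cos x +i* sin x.

Lemma normc_ge0 z : 0 <= normc z.
Proof. by case: z => a b; rewrite sqrtr_ge0. Qed.

Lemma normcR x : normc x%:C = `|x|.
Proof. by rewrite /normc/= expr0n/= addr0 sqrtr_sqr. Qed.

Lemma normc_conj z : normc z^*%C = normc z.
Proof. by case: z => a b /=; rewrite sqrrN. Qed.

Lemma conjc_mul z w : (z * w)^*%C = z^*%C * w^*%C.
Proof. exact: (rmorphM (@conjc R)). Qed.

Lemma conjc_sum (I : Type) (r : seq I) (P : pred I) (F : I -> R[i]) :
  (\sum_(i <- r | P i) F i)^*%C = \sum_(i <- r | P i) (F i)^*%C.
Proof. exact: (rmorph_sum (@conjc R)). Qed.

Lemma sqr_normc_conj z : (normc z ^+ 2)%:C = z * z^*%C.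
Proof.
case: z => a b; rewrite /normc sqr_sqrtr ?addr_ge0 ?sqr_ge0//.
by apply/eqP; rewrite eq_complex/=; apply/andP; split; apply/eqP; ring.
Qed.

Lemma normcB z w : normc (z - w) = normc (w - z).
Proof. by rewrite -normcN opprB. Qed.

Lemma normc_distD z w v : normc (z - v) <= normc (z - w) + normc (w - v).
Proof. by apply: le_trans (le_normcD _ _); rewrite addrA subrK. Qed.

Lemma lerB_normcD z w : normc z - normc w <= normc (z + w).
Proof. by rewrite lerBlDr -(normcN w); apply: le_trans (le_normcD _ _); rewrite addrK. Qed.

Lemma normc_sum (I : Type) (r : seq I) (P : pred I) (F : I -> R[i]) :
  normc (\sum_(i <- r | P i) F i) <= \sum_(i <- r | P i) normc (F i).
Proof.
elim/big_rec2: _ => [|i y z _ yz]; first by rewrite normc0.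
by apply: (le_trans (le_normcD _ _)); rewrite lerD2l.
Qed.

Lemma normc_le_ReIm z : normc z <= `|complex.Re z| + `|complex.Im z|.
Proof.
case: z => a b /=; rewrite -[leRHS]ger0_norm ?addr_ge0// -sqrtr_sqr ler_sqrt ?sqr_ge0//.
rewrite sqrrD !real_normK ?num_real// addrAC lerDl.
by rewrite mulrn_wge0// mulr_ge0.
Qed.

Lemma ler_Re_normc z : complex.Re z <= normc z.
Proof.
case: z => a b /=; apply: (le_trans (ler_norm _)); rewrite -sqrtr_sqr ler_sqrt ?lerDl ?sqr_ge0//.
by rewrite addr_ge0 ?sqr_ge0.
Qed.

Lemma cisD x y : cis (x + y) = cis x * cis y.
Proof. by rewrite /cis sinD cosD; simpc; rewrite [sin x * _ + _]addrC. Qed.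

Lemma cis0 : cis 0 = 1.
Proof. by rewrite /cis cos0 sin0. Qed.

Lemma cisN x : cis (- x) = (cis x)^*%C.
Proof. by rewrite /cis cosN sinN. Qed.

Lemma normc_cis x : normc (cis x) = 1.
Proof. by rewrite /cis /= cos2Dsin2 sqrtr1. Qed.

Lemma cisMn x n : cis (n%:R * x) = cis x ^+ n.
Proof.
elim: n => [|n IHn]; first by rewrite mul0r cis0.
by rewrite -natr1 mulrDl mul1r cisD IHn exprSr.
Qed.

Lemma cis2pi n : cis (n%:R * (pi *+ 2)) = 1.
Proof. by rewrite cisMn /cis cos2pi sin2pi (_ : _ +i* _ = 1)// expr1n. Qed.

Lemma normr_sin_le x : `|sin x| <= `|x|.
Proof.
wlog x0 : x / 0 <= x.
  move=> H; have [/H//|/ltW x0] := leP 0 x.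
  by rewrite -normrN -sinN -(normrN x); apply: H; rewrite oppr_ge0.
have [->|xn0] := eqVneq x 0; first by rewrite sin0.
have {x0 xn0}x0 : 0 < x by rewrite lt_neqAle eq_sym xn0.
have sin_cont : {within `[0, x], continuous (@sin R)}.
  by apply: continuous_subspaceT => y; exact: continuous_sin.
have [c _] := MVT x0 (fun y _ => is_derive_sin y) sin_cont.
rewrite sin0 !subr0 => ->; rewrite normrM.
by apply: ler_piMl => //; exact: cos_max.
Qed.

Lemma cos_ge x : 1 - x ^+ 2 / 2 <= cos x.
Proof.
have -> : cos x = 1 - (sin (x / 2)) ^+ 2 *+ 2.
  have {1}-> : x = (x / 2) *+ 2 by rewrite mulr2n -splitr.
  by rewrite cos_mulr2n cos2sin2; ring.
have : `|sin (x / 2)| ^+ 2 <= `|x / 2| ^+ 2.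
  by rewrite lerXn2r ?nnegrE ?normr_ge0// normr_sin_le.
by rewrite !real_normK ?num_real// expr_div_n; lra.
Qed.

Lemma normr_sinB_le x : `|sin x - x| <= x ^+ 2.
Proof.
wlog x0 : x / 0 <= x.
  move=> H; have [/H//|/ltW x0] := leP 0 x.
  by rewrite -normrN opprB addrC -sinN -[in leRHS]sqrrN -[X in _ + X]opprK; apply: H; rewrite oppr_ge0.
have [->|xn0] := eqVneq x 0; first by rewrite sin0 subr0 normr0 expr0n.
have {x0 xn0}x0 : 0 < x by rewrite lt_neqAle eq_sym xn0.
have dsin y : y \in `]0, x[%R -> is_derive y 1 (@sin R \- id) ((cos \- cst 1) y).
  by move=> _; exact: is_deriveB.
have sin_cont : {within `[0, x], continuous (@sin R \- id)}.
  apply: continuous_subspaceT => y; apply: continuousB; first exact: continuous_sin.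
  exact: cvg_id.
have [c] := MVT x0 dsin sin_cont.
rewrite in_itv/= => /andP[c0 cx].
rewrite /= sin0 !subr0 => ->; rewrite normrM (ger0_norm (ltW x0)) expr2.
apply: ler_wpM2r; first exact: ltW.
rewrite ler_norml; have := cos_le1 c; have := cos_ge c; have := cos_geN1 c.
move=> h1 h2 h3; apply/andP; split; last by lra.
have [c2|c2] := leP c 2; last by lra.
have : 0 <= c * (2 - c) by rewrite mulr_ge0 ?subr_ge0// ltW.
by lra.
Qed.

Lemma normc_cisB1i x : normc (cis x - 1 - 'i * x%:C) <= 2 * x ^+ 2.
Proof.
rewrite (_ : _ - _ = (cos x - 1) +i* (sin x - x)); last first.
  by apply/eqP; rewrite /cis eq_complex/=; apply/andP; split; apply/eqP; ring.
apply: (le_trans (normc_le_ReIm _)) => /=.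
have h1 := normr_sinB_le x; rewrite ler0_norm ?subr_le0 ?cos_le1//.
by have := cos_ge x; have := sqr_ge0 x; lra.
Qed.

End ComplexExponential.

(** * The kernel: sums of [k ^ (-1 + iu)] *)

Section PartialSums.
Context {R : realType}.
Implicit Types (x y t u : R).

Lemma ln_nat_ge0 n : 0 <= ln n%:R :> R.
Proof. by case: n => [|n]; [rewrite ln0|rewrite ln_ge0// ler1n]. Qed.

Lemma succr_div (k : nat) : (0 < k)%N ->
  (k%:R + 1) / k%:R = (1 - k.+1%:R^-1)^-1 :> R.
Proof.
move=> k0; have k0' : (0 : R) < k%:R by rewrite ltr0n.
rewrite -natr1 -[LHS]invf_div; congr (_^-1).
by field; rewrite gt_eqF// ltr_wpDr.
Qed.

Lemma lnS_bounds (k : nat) : (0 < k)%N ->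
  0 <= (k%:R : R)^-1 - (ln k.+1%:R - ln k%:R) <= (k%:R ^+ 2)^-1.
Proof.
move=> k0; have k0' : (0 : R) < k%:R by rewrite ltr0n.
have -> : ln k.+1%:R - ln k%:R = ln (1 + k%:R^-1) :> R.
  rewrite -ln_div ?posrE ?ltr0n//; congr ln.
  by rewrite -natr1 mulrDl divff ?gt_eqF// mul1r.
have le1 : ln (1 + k%:R^-1) <= k%:R^-1 :> R.
  by apply: le_ln1Dx; rewrite (@lt_trans _ _ 0)// ?invr_gt0// oppr_lt0.
have le2 : k.+1%:R^-1 <= ln (1 + k%:R^-1) :> R.
  have -> : 1 + k%:R^-1 = (1 + (- k.+1%:R^-1))^-1 :> R.
    by rewrite -succr_div// mulrDl divff ?gt_eqF// mul1r.
  have k1 : k.+1%:R^-1 < 1 :> R by rewrite invf_lt1 ?ltr0n// ltr1n ltnS.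
  rewrite lnV ?posrE ?subr_gt0//.
  by rewrite lerNr; apply: le_ln1Dx; rewrite ltrN2.
rewrite subr_ge0 le1/= lerBlDr -lerBlDl; apply: le_trans le2.
rewrite -subr_ge0 -natr1; set c := k%:R : R.
rewrite (_ : _ - _ = (c ^+ 2 * (c + 1))^-1); first by rewrite invr_ge0 mulr_ge0 ?sqr_ge0// addr_ge0// ltW.
by field; rewrite !gt_eqF// ltr_pwDr.
Qed.

Lemma sum_inv_sqr (m n : nat) : (0 < m)%N ->
  \sum_(m <= k < n) (k%:R ^+ 2)^-1 <= 2 / m%:R :> R.
Proof.
move=> m0; have [nm|mn] := leqP n m.
  by rewrite big_geq// divr_ge0.
apply: (@le_trans _ _ (2 / m%:R - 2 / n%:R)); last by rewrite lerBlDr lerDl divr_ge0.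
elim: n mn => // n IHn; rewrite ltnS leq_eqVlt => /orP[/eqP<-|mn].
  rewrite big_nat1 -subr_ge0; set c := m%:R : R.
  have c1 : 1 <= c by rewrite /c ler1n.
  rewrite -natr1 -/c (_ : _ - _ = (c - 1) / (c ^+ 2 * (c + 1))).
    by rewrite divr_ge0 ?subr_ge0// mulr_ge0 ?sqr_ge0//; lra.
  by field; rewrite !gt_eqF//; lra.
rewrite big_nat_recr/= ?(ltnW mn)//.
have step : (n%:R ^+ 2)^-1 <= 2 / n%:R - 2 / n.+1%:R :> R.
  rewrite -subr_ge0; set c := n%:R : R.
  have c1 : 1 <= c by rewrite /c ler1n (leq_trans _ mn).
  rewrite -natr1 -/c (_ : _ - _ = (c - 1) / (c ^+ 2 * (c + 1))).
    by rewrite divr_ge0 ?subr_ge0// mulr_ge0 ?sqr_ge0//; lra.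
  by field; rewrite !gt_eqF//; lra.
by apply: (le_trans (lerD (IHn mn) step)); rewrite addrA subrK.
Qed.

Lemma sum_inv_le_ln (m n : nat) : (0 < m)%N -> (m <= n)%N ->
  \sum_(m <= k < n) k.+1%:R^-1 <= ln n%:R - ln m%:R :> R.
Proof.
move=> m0; elim: n => [|n IHn]; first by rewrite leqn0 => /eqP m00; rewrite m00 in m0.
rewrite leq_eqVlt ltnS => /orP[/eqP<-|mn]; first by rewrite big_geq// subrr.
rewrite big_nat_recr//=; have n0 : (0 < n)%N by exact: leq_trans mn.
have -> : ln n.+1%:R - ln m%:R = ln n%:R - ln m%:R + (ln n.+1%:R - ln n%:R) :> R by ring.
apply: lerD; first exact: IHn.
rewrite -ln_div ?posrE ?ltr0n//.
have -> : n.+1%:R / n%:R = (1 + (- n.+1%:R^-1))^-1 :> R.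
  by rewrite -succr_div// -natr1.
have k1 : n.+1%:R^-1 < 1 :> R by rewrite invf_lt1 ?ltr0n// ltr1n ltnS.
rewrite lnV ?posrE ?subr_gt0//.
by rewrite lerNr; apply: le_ln1Dx; rewrite ltrN2.
Qed.

Lemma harmonic_le (n : nat) : \sum_(1 <= k < n.+1) k%:R^-1 <= 1 + ln n%:R :> R.
Proof.
case: n => [|n]; first by rewrite big_geq// ln0// addr0.
rewrite big_ltn// invr1 lerD2l -(subr0 (ln _)) -[X in _ - X]ln1.
by rewrite big_add1/=; exact: (@sum_inv_le_ln 1 n.+1).
Qed.

Definition inv_sum u (m n : nat) : R[i] :=
  \sum_(m <= k < n) (k%:R^-1)%:C * cis (u * ln k%:R).

(** The increment of [k ^ (iu)] from [k] to [k.+1] is [k ^ (iu) * iu / k] up to errors of order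
    [|u| / k ^ 2], from [ln (1 + 1 / k)], and [u ^ 2 / k ^ 2], from the exponential. The increments
    telescope and the errors are summable. *)
Lemma inv_sum_approx u (m n : nat) : (0 < m)%N -> (m <= n)%N ->
  normc ('i * u%:C * inv_sum u m n - (cis (u * ln n%:R) - cis (u * ln m%:R)))
    <= (`|u| + 2 * u ^+ 2) * (2 / m%:R).
Proof.
move=> m0 mn; rewrite -(telescope_sumr (fun k => cis (u * ln k%:R)) mn).
rewrite /inv_sum mulr_sumr -sumrB; apply: (le_trans (normc_sum _ _ _)).
apply: (@le_trans _ _ (\sum_(m <= k < n) (`|u| + 2 * u ^+ 2) * (k%:R ^+ 2)^-1)); last first.
  rewrite -mulr_sumr; apply: ler_wpM2l; last exact: sum_inv_sqr.
  by rewrite addr_ge0// mulr_ge0// sqr_ge0.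
rewrite [leLHS]big_seq_cond [leRHS]big_seq_cond; apply: ler_sum => k.
rewrite mem_index_iota andbT => /andP[mk _].
have k0 : (0 < k)%N by exact: leq_trans mk.
have /andP[th1 th2] := lnS_bounds k0.
set th := ln k.+1%:R - ln k%:R in th1 th2.
have th0 : 0 <= th.
  by rewrite subr_ge0 ler_ln ?posrE ?ltr0n// ler_nat.
have -> : u * ln k.+1%:R = u * ln k%:R + u * th by rewrite /th; ring.
rewrite cisD.
rewrite (_ : _ - _ = cis (u * ln k%:R) *
  (('i * (u * (k%:R^-1 - th))%:C) - (cis (u * th) - 1 - 'i * (u * th)%:C))); last first.
  by rewrite !rmorphM/= !rmorphB/=; ring.
rewrite normcM normc_cis mul1r; apply: (le_trans (le_normcD _ _)); rewrite mulrDl.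
apply: lerD.
  rewrite normcM normcR /= expr0n expr1n add0r sqrtr1 mul1r normrM.
  by apply: ler_wpM2l => //; rewrite ger0_norm.
rewrite normcN; apply: (le_trans (normc_cisB1i _)); rewrite -mulrA.
apply: ler_wpM2l => //; rewrite exprMn; apply: ler_wpM2l; first exact: sqr_ge0.
rewrite -exprVn lerXn2r ?nnegrE ?invr_ge0//.
by move: th1; rewrite subr_ge0.
Qed.

Lemma inv_sum_le_ln u (N : nat) : normc (inv_sum u 1 N.+1) <= 1 + ln N%:R.
Proof.
apply: le_trans (harmonic_le N); apply: (le_trans (normc_sum _ _ _)).
by apply: ler_sum => k _; rewrite normcM normc_cis mulr1 normcR ger0_norm.
Qed.

(** The telescoped difference costs 2 and the error [2 * (|u| + 2 * u ^ 2)]; division by [|u|] gives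
    the three terms. *)
Lemma inv_sum_le_inv u (N : nat) : u != 0 ->
  normc (inv_sum u 1 N.+1) <= 2 / `|u| + 2 + 4 * `|u|.
Proof.
move=> u0; have un0 : 0 < `|u| by rewrite normr_gt0.
rewrite -(ler_pM2l un0) -[X in X * _ <= _]normcR.
have -> : normc u%:C = normc ('i * u%:C) :> R.
  by rewrite normcM /= expr0n expr1n add0r sqrtr1 mul1r.
rewrite -normcM; set w := _ * inv_sum _ _ _.
have := @inv_sum_approx u 1 N.+1 isT isT; rewrite -/w divr1.
set c1 := cis _; set c2 := cis _ => h.
have h2 : normc (c1 - c2) <= 2.
  by apply: (le_trans (le_normcD _ _)); rewrite normcN !normc_cis; lra.
rewrite -(subrK (c1 - c2) w); apply: (le_trans (le_normcD _ _)).
apply: (le_trans (lerD h h2)).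
rewrite -(real_normK (num_real u)) (_ : `|u| * _ = 2 + (`|u| + 2 * `|u| ^+ 2) * 2); last first.
  by field; rewrite gt_eqF.
by rewrite addrC.
Qed.

End PartialSums.

(** * The maximal inequality *)

Section Duality.
Context {R : realType}.

(* By duality, a bound on the Gram matrix of the rows [b r] bounds the
   operator norm of [b]. *)
Lemma gram_bound (I : finType) (n : nat) (b : I -> nat -> R[i]) (a : nat -> R[i])
    (L : R) : 0 < L ->
  (forall r, \sum_s normc (\sum_(1 <= k < n) b r k * (b s k)^*%C) <= L) ->
  \sum_r normc (\sum_(1 <= k < n) a k * b r k) ^+ 2 <=
    L * \sum_(1 <= k < n) normc (a k) ^+ 2.
Proof.
move=> L0 HL; pose v r := \sum_(1 <= k < n) a k * b r k.
pose w k := \sum_r (v r)^*%C * b r k.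
pose G r s := \sum_(1 <= k < n) b r k * (b s k)^*%C.
set V := \sum_r _; set A := \sum_(1 <= k < n) _.
have GC r s : normc (G r s) = normc (G s r).
  rewrite -normc_conj /G conjc_sum; congr normc; apply: eq_bigr => k _.
  by rewrite conjc_mul conjcK mulrC.
(* [V] is the pairing of [a] with the image [w] of [v] under the transposed map, so it is enough to
   bound [w]. *)
have VE : V%:C = \sum_(1 <= k < n) a k * w k.
  rewrite /V rmorph_sum/=; under eq_bigr do rewrite sqr_normc_conj mulr_suml.
  rewrite exchange_big/=; apply: eq_bigr => k _; rewrite /w mulr_sumr.
  by apply: eq_bigr => r _; rewrite -/(v r) -mulrA; congr (_ * _); rewrite mulrC.
have V0 : 0 <= V by apply: sumr_ge0 => r _; exact: sqr_ge0.
have WE : (\sum_(1 <= k < n) normc (w k) ^+ 2)%:C =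
    \sum_r \sum_s ((v r)^*%C * v s) * G r s.
  rewrite rmorph_sum/=; under eq_bigr do rewrite sqr_normc_conj.
  transitivity (\sum_(1 <= k < n) \sum_r \sum_s
      (((v r)^*%C * v s) * (b r k * (b s k)^*%C))).
    apply: eq_bigr => k _; rewrite /w conjc_sum mulr_suml; apply: eq_bigr => r _.
    rewrite mulr_sumr; apply: eq_bigr => s _.
    by rewrite conjc_mul conjcK; ring.
  rewrite exchange_big/=; apply: eq_bigr => r _.
  rewrite exchange_big/=; apply: eq_bigr => s _.
  by rewrite /G mulr_sumr.
have WL : \sum_(1 <= k < n) normc (w k) ^+ 2 <= L * V.
  have W0 : 0 <= \sum_(1 <= k < n) normc (w k) ^+ 2.
    by apply: sumr_ge0 => k _; exact: sqr_ge0.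
  rewrite -[leLHS]ger0_norm// -normcR WE.
  (* Schur test: the product of [|v r|] and [|v s|] is at most half the sum of their squares, and
     the symmetry of [|G|] reduces both halves to row sums. *)
  apply: (@le_trans _ _ (\sum_r \sum_s
      (normc (v r) ^+ 2 * normc (G r s) + normc (v s) ^+ 2 * normc (G s r)) / 2)).
    apply: (le_trans (normc_sum _ _ _)); apply: ler_sum => r _.
    apply: (le_trans (normc_sum _ _ _)); apply: ler_sum => s _.
    rewrite !normcM normc_conj (GC s r) -mulrDl -mulrA.
    set x := normc (v r); set y := normc (v s); set g := normc _.
    have : 0 <= (x - y) ^+ 2 * g by rewrite mulr_ge0 ?sqr_ge0 ?normc_ge0.
    by rewrite sqrrB; lra.
  under eq_bigr do rewrite -mulr_suml big_split/=.
  rewrite -mulr_suml big_split/= [X in _ + X]exchange_big/= -mulr2n.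
  rewrite -[_ *+ 2]mulr_natr -mulrA divff ?pnatr_eq0// mulr1 /V mulr_sumr.
  apply: ler_sum => r _; rewrite -mulr_sumr mulrC.
  by apply: ler_wpM2r; [exact: sqr_ge0|exact: HL].
(* The weights [L] and [L^-1] are balanced so that the part with [w] is at most [V / 2] and is
   absorbed on the left. *)
have : V <= \sum_(1 <= k < n) (L * normc (a k) ^+ 2 + L^-1 * normc (w k) ^+ 2) / 2.
  rewrite -[leLHS]ger0_norm// -normcR VE; apply: (le_trans (normc_sum _ _ _)).
  apply: ler_sum => k _; rewrite normcM.
  set x := normc (a k); set y := normc (w k); rewrite -subr_ge0.
  rewrite (_ : _ - _ = L^-1 * (L * x - y) ^+ 2 / 2); last by field; rewrite gt_eqF.
  by rewrite divr_ge0// mulr_ge0 ?sqr_ge0// invr_ge0 ltW.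
rewrite -mulr_suml big_split/= -!mulr_sumr -/A.
have : L^-1 * \sum_(1 <= k < n) normc (w k) ^+ 2 <= V by rewrite ler_pdivrMl.
by set X := L^-1 * _; lra.
Qed.

End Duality.

Section MaximalInequality.
Context {R : realType}.
Implicit Types (g : hardy2 R) (t u : R).

Lemma sum_sqr_le_h2_norm g n :
  \sum_(1 <= k < n) normc (g k) ^+ 2 <= h2_norm g ^+ 2.
Proof.
have g_lt : (h2_sqnorm g < +oo)%E by case: g => a /= /andP[].
rewrite /h2_norm sqr_sqrtr; last first.
  by rewrite fine_ge0//; apply: nneseries_ge0 => k _ _; rewrite lee_fin sqr_ge0.
rewrite -lee_fin fineK; last first.
  by rewrite ge0_fin_numE//; apply: nneseries_ge0 => k _ _; rewrite lee_fin sqr_ge0.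
rewrite -sumEFin.
by apply: nneseries_lim_ge => k _ _; rewrite lee_fin sqr_ge0.
Qed.

Lemma dirichlet_monomial_conj t u k : (0 < k)%N ->
  dirichlet_monomial t k * (dirichlet_monomial u k)^*%C =
    (k%:R^-1)%:C * cis ((t - u) * ln k%:R).
Proof.
move=> k0; have k0' : 0 < k%:R :> R by rewrite ltr0n.
rewrite /dirichlet_monomial -!/(cis _) conjc_mul conjc_real -cisN.
rewrite mulrACA -rmorphM/= -cisD -powRD; last by rewrite (gt_eqF k0') implybT.
congr ((_)%:C * cis _); last by ring.
by rewrite (_ : - 2^-1 + - 2^-1 = -1) ?powR_inv1 ?ltW//; lra.
Qed.

(* The truncation [N r] may depend on the point [t r]: this is what bounds the
   maximal function (Kolmogorov-Seliverstov). *)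
Lemma dirichlet_sum_maximal (I : finType) (t : I -> R) (N : I -> nat) (L : R) g :
  0 < L ->
  (forall r, \sum_s normc (inv_sum (t r - t s) 1 (minn (N r) (N s)).+1) <= L) ->
  \sum_r normc (dirichlet_sum g (t r) (N r)) ^+ 2 <= L * h2_norm g ^+ 2.
Proof.
(* All rows are padded with zeros to a common length; in a product of two rows only the indices up
   to the smaller truncation survive, whence the [minn] in the Gram matrix. *)
move=> L0 HL; pose n := (\max_r N r).+1.
pose b r k : R[i] := if (k <= N r)%N then dirichlet_monomial (t r) k else 0.
have Nn r : ((N r).+1 <= n)%N by rewrite /n ltnS; exact: leq_bigmax.
have bE (F : nat -> R[i]) M : (M.+1 <= n)%N ->
    \sum_(1 <= k < n) (if (k <= M)%N then F k else 0) = \sum_(1 <= k < M.+1) F k.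
  move=> Mn; rewrite (big_nat_widen _ _ _ _ _ Mn) [RHS]big_mkcond/=.
  by apply: eq_bigr => k _; rewrite ltnS.
rewrite (eq_bigr (fun r => normc (\sum_(1 <= k < n) g k * b r k) ^+ 2)); last first.
  move=> r _; rewrite /dirichlet_sum -(bE _ _ (Nn r)); congr (normc _ ^+ 2).
  by apply: eq_bigr => k _; rewrite /b; case: ifP => // _; rewrite mulr0.
apply: (@le_trans _ _ (L * \sum_(1 <= k < n) normc (g k) ^+ 2)); last first.
  by apply: ler_wpM2l; [exact: ltW|exact: sum_sqr_le_h2_norm].
apply: gram_bound => // r; apply: le_trans (HL r); apply: ler_sum => s _.
rewrite le_eqVlt; apply/orP; left; apply/eqP; congr normc.
rewrite /inv_sum -(bE _ (minn (N r) (N s))); last by rewrite (leq_trans _ (Nn r))// ltnS geq_minl.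
apply: eq_big_nat => k /andP[k0 _]; rewrite /b leq_min.
have [|] := leqP k (N r) => _ /=; last by rewrite mul0r.
have [|] := leqP k (N s) => _ /=; last first.
  by rewrite [X in _ * X](_ : _ = 0) ?mulr0//; apply/eqP; rewrite eq_complex/= oppr0 eqxx.
exact: dirichlet_monomial_conj.
Qed.

End MaximalInequality.

(** * Counting separated points with large partial sums *)

Section Counting.
Context {R : realType}.
Implicit Types (g : hardy2 R).

Lemma sum_fiber_le (I : finType) (P : pred I) (k : I -> nat) (c : nat -> R) (D : nat)
    (h : nat -> R) :
  (forall i, P i -> k i <= D)%N ->
  (forall j, #|[pred i | P i && (k i == j)]|%:R <= c j) -> (forall j, 0 <= h j) ->
  \sum_(i | P i) h (k i) <= \sum_(0 <= j < D.+1) c j * h j.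
Proof.
move=> kD kc h0; rewrite big_mkord.
rewrite (partition_big (fun i => inord (k i) : 'I_D.+1) predT)//=.
apply: ler_sum => j _.
rewrite (eq_bigr (fun=> h j)); last first.
  by move=> i /andP[Pi /eqP <-]; rewrite inordK// ltnS kD.
rewrite sumr_const -[leLHS]mulr_natl; apply: ler_wpM2r => //.
apply: le_trans (kc j); rewrite ler_nat.
apply/subset_leq_card/fintype.subsetP => i; rewrite !inE => /andP[Pi /eqP <-].
by rewrite Pi /= inordK// ltnS kD.
Qed.

Lemma card_dist_fiber (I : finType) (z : I -> int) (a : int) (j : nat) :
  injective z -> (#|[pred i | `|z i - a|%N == j]| <= 2)%N.
Proof.
move=> zI; rewrite cardE -(size_map z).
rewrite (_ : 2%N = size [:: a + j%:Z; a - j%:Z])//.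
apply: uniq_leq_size; first by rewrite map_inj_uniq// enum_uniq.
move=> _ /mapP[i + ->]; rewrite mem_enum !inE => /eqP; lia.
Qed.

(** At most two points lie [j] cells away from a given one. The trivial bound [Q] is spent on
    [j <= 1]. For [j >= 2] the distance exceeds [(j - 1) * d >= j * d / 2], so the [1 / |u|] part of
    the kernel adds up to a harmonic sum. *)
Lemma sum_inv_sum_le (I : finType) (t : I -> R) (N : I -> nat) (d Q W : R) (D : nat) r :
  0 < d -> 0 <= Q -> 0 <= W -> 2 * W / d + 1 <= D%:R ->
  (forall r, `|t r| <= W) -> (forall r, 1 + ln (N r)%:R <= Q) ->
  injective (fun r => Num.floor (t r / d)) ->
  \sum_s normc (inv_sum (t r - t s) 1 (minn (N r) (N s)).+1) <=
    2 * (2 * Q + 4 / d * (1 + ln D%:R)) + 2 * (D.+1)%:R * (2 + 8 * W).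
Proof.
move=> d0 Q0 W0 WD tW NQ zI.
pose z s := Num.floor (t s / d); pose k s := `|z s - z r|%N.
pose h (j : nat) : R := if (j <= 1)%N then Q else 4 / (j%:R * d).
have tsr s : `|t r - t s| <= 2 * W.
  by apply: (le_trans (ler_normB _ _)); have := tW r; have := tW s; lra.
have h0 j : 0 <= h j.
  by rewrite /h; case: ifP => // _; rewrite divr_ge0// mulr_ge0// ltW.
have kD s : (k s <= D)%N.
  have /andP[r1 r2] := floor_itv (t r / d); have /andP[s1 s2] := floor_itv (t s / d).
  rewrite -(@ler_nat R); apply: le_trans WD; rewrite /k natr_absz /z intr_norm rmorphB/=.
  have hh : t s / d - t r / d = (t s - t r) / d by rewrite mulrBl.
  have : `|(t s - t r) / d| <= 2 * W / d.
    rewrite normrM (gtr0_norm (x := d^-1)) ?invr_gt0// ler_pM2r ?invr_gt0//.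
    by rewrite distrC.
  rewrite -hh !rmorphD/= in r2 s2 *.
  by rewrite !ler_norml => /andP[? ?]; apply/andP; split; lra.
have hk s : normc (inv_sum (t r - t s) 1 (minn (N r) (N s)).+1) <=
    h (k s) + (2 + 8 * W).
  rewrite /h; case: ifPn => [k1|].
    apply: (le_trans (inv_sum_le_ln _ _)).
    apply: (@le_trans _ _ Q); last by rewrite lerDl; lra.
    apply: le_trans (NQ r); rewrite lerD2l.
    have [->|N0] := posnP (minn (N r) (N s)); first by rewrite ln0// ln_nat_ge0.
    have Nr0 : (0 < N r)%N by rewrite (leq_trans N0)// geq_minl.
    by rewrite ler_ln ?posrE ?ltr0n// ler_nat geq_minl.
  rewrite -ltnNge => k2.
  have : (k s)%:R - 1 < `|t s - t r| / d.
    rewrite ltr_pdivlMr//; apply: floor_neq_dist => //.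
  rewrite distrC ltr_pdivlMr// => tk.
  have k2' : 2 <= (k s)%:R :> R by rewrite ler_nat.
  have u0 : 0 < (k s)%:R * d / 2 by rewrite divr_gt0// mulr_gt0//; lra.
  have tk2 : (k s)%:R * d / 2 <= `|t r - t s|.
    apply: le_trans (ltW tk); rewrite mulrAC ler_pM2r//; lra.
  have tn0 : 0 < `|t r - t s| by exact: lt_le_trans tk2.
  apply: (le_trans (inv_sum_le_inv _ _)); first by rewrite -normr_gt0.
  rewrite -addrA; apply: lerD; last by have := tsr s; lra.
  rewrite (_ : 4 / _ = 2 / ((k s)%:R * d / 2)); last first.
    by field; rewrite !gt_eqF//; lra.
  by rewrite ler_pM2l// lef_pV2 ?posrE.
apply: (le_trans (ler_sum _ (fun s _ => hk s))); rewrite big_split/=.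
have kc j : #|[pred s | k s == j]|%:R <= 2 :> R by rewrite ler_nat card_dist_fiber.
apply: lerD.
  apply: (le_trans (@sum_fiber_le _ predT _ _ _ _ (fun i _ => kD i) kc h0)).
  rewrite -mulr_sumr; apply: ler_wpM2l => //.
  have D1 : (1 <= D)%N.
    rewrite -(@ler_nat R); apply: le_trans WD; rewrite lerDr.
    by rewrite divr_ge0 ?(ltW d0)// mulr_ge0.
  rewrite big_ltn// big_ltn// {1 2}/h/= addrA (_ : Q + Q = 2 * Q); last by ring.
  rewrite lerD2l.
  apply: (@le_trans _ _ (4 / d * \sum_(1 <= j < D.+1) j%:R^-1)); last first.
    apply: ler_wpM2l; last exact: harmonic_le.
    by rewrite divr_ge0// ltW.
  rewrite mulr_sumr [X in _ <= X]big_ltn//; apply: ler_wpDl.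
    by rewrite mulr_ge0// divr_ge0// ltW.
  apply: ler_sum_nat => j /andP[j2 _]; rewrite /h leqNgt j2/=.
  by rewrite invfM mulrA mulrAC.
rewrite (_ : \sum_s _ = (2 + 8 * W) * \sum_(s : I) (fun=> 1) (k s)); last first.
  by rewrite mulr_sumr; apply: eq_bigr => s _; rewrite mulr1.
rewrite mulrC; apply: ler_wpM2r; first by lra.
by apply: (le_trans (@sum_fiber_le _ predT _ _ _ (fun=> 1) (fun i _ => kD i) kc _)) => //; rewrite -mulr_sumr sumr_const_nat subn0.
Qed.

Lemma ln4_le2 : ln 4 <= 2 :> R.
Proof.
have -> : 4 = 2 ^+ 2 :> R by rewrite expr2; lra.
rewrite lnXn// mulr2n; have := @le_ln1Dx R 1 ltac:(lra).
by have -> : 1 + 1 = 2 :> R by []; lra.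
Qed.

(** A row sum receives [O(2 ^ m)] from neighbouring points, [O(m * 2 ^ m)] from the [1 / |u|] part
    of the kernel, and [O(m ^ 2 * 2 ^ m)] from its [1 + |u|] part, since there are [O(m * 2 ^ m)]
    cells and [|u| <= 2 * m]. *)
Lemma maximal_dyadic (I : finType) (t : I -> R) (N : I -> nat) (m : nat) g :
  (forall r, `|t r| <= m%:R) -> (forall r, ln (N r)%:R <= 2 ^+ m.+1 :> R) ->
  injective (fun r => Num.floor (t r / (2 ^- m : R))) ->
  \sum_r normc (dirichlet_sum g (t r) (N r)) ^+ 2 <=
    68 * (m.+1)%:R ^+ 2 * 2 ^+ m * h2_norm g ^+ 2.
Proof.
move=> tm Nm zI; set p : R := 2 ^+ m; set M : R := m%:R.
have p1 : 1 <= p by rewrite exprn_ege1//; lra.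
have M0 : 0 <= M by rewrite ler0n.
apply: dirichlet_sum_maximal.
  by rewrite !mulr_gt0 ?exprn_gt0// ltr0n.
move=> r; pose D := (2 * m * 2 ^ m + 1)%N.
have DE : D%:R = 2 * M * p + 1 :> R.
  by rewrite /D natrD !natrM natrX.
have d0 : 0 < 2 ^- m :> R by rewrite invr_gt0 exprn_gt0.
apply: (@le_trans _ _ (2 * (2 * (3 * p) + 4 / 2 ^- m * (1 + ln (D%:R : R))) +
    2 * (D.+1)%:R * (2 + 8 * M))).
  apply: sum_inv_sum_le => //.
  - by lra.
  - by rewrite DE invrK.
  - by move=> s; have := Nm s; rewrite exprS -/p; lra.
have lnD : ln (D%:R : R) <= 2 * (M + 1).
  have -> : 2 * (M + 1) = (m.+1)%:R * 2 by rewrite -natr1; ring.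
  apply: (@le_trans _ _ (m.+1%:R * ln 4)); last by apply: ler_wpM2l => //; exact: ln4_le2.
  rewrite mulr_natl -lnXn// ler_ln ?posrE ?ltr0n ?exprn_gt0//; last by rewrite /D addn1.
  have -> : 4 = (2 * 2)%:R :> R by rewrite -[RHS]/4%:R.
  rewrite -natrX ler_nat /D expnMn !expnS.
  have : (m < 2 ^ m)%N by exact: ltn_expl.
  have : (0 < 2 ^ m)%N by rewrite expn_gt0.
  by move: (2 ^ m)%N => q q0 mq; nia.
have h1 : 4 * p * (1 + ln (D%:R : R)) <= 4 * p * (1 + 2 * (M + 1)).
  by rewrite ler_pM2l; lra.
rewrite invrK -/p; move: h1; set X := 4 * p * (1 + _) => h1.
rewrite -[D.+1%:R]natr1 DE -[m.+1%:R]natr1 -/M.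
have pM : 0 <= (p - 1) * M by rewrite mulr_ge0//; lra.
have pM2 : 0 <= p * M ^+ 2 by rewrite mulr_ge0 ?sqr_ge0//; lra.
have := mulr_ge0 M0 M0; nra.
Qed.

(** Chebyshev's inequality for the maximal bound. *)
Lemma card_large_sums (I : finType) (t : I -> R) (N : I -> nat) (m : nat) (tau : R) g :
  0 < tau ->
  (forall r, `|t r| <= m%:R) -> (forall r, ln (N r)%:R <= 2 ^+ m.+1 :> R) ->
  injective (fun r => Num.floor (t r / (2 ^- m : R))) ->
  (forall r, tau <= normc (dirichlet_sum g (t r) (N r))) ->
  #|I|%:R <= 68 * (m.+1)%:R ^+ 2 * 2 ^+ m * h2_norm g ^+ 2 / tau ^+ 2.
Proof.
move=> tau0 tm Nm zI tS; rewrite ler_pdivlMr ?exprn_gt0//.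
apply: le_trans (maximal_dyadic _ tm Nm zI).
rewrite mulr_natl -sumr_const; apply: ler_sum => r _.
by rewrite lerXn2r ?nnegrE ?(ltW tau0) ?normc_ge0.
Qed.

End Counting.

(** * Growth exponents *)

Section LimSupInf.
Context {R : realType}.
Implicit Types (u : nat -> \bar R) (c : \bar R).
Local Open Scope ereal_scope.

Lemma limn_esupE u : limn_esup u = ereal_inf (range (esups u)).
Proof. by rewrite limn_esup_lim; apply/cvg_lim => //; exact: cvg_esups_inf. Qed.

Lemma lt_limn_esup u c : c < limn_esup u -> forall n, exists2 m, (n <= m)%N & c < u m.
Proof.
move=> cu n; have : c < esups u n.
  by apply: (lt_le_trans cu); rewrite limn_esupE; apply: ereal_inf_lbound; exists n.
by move=> /ereal_sup_gt[_ [m /= nm <-] cm]; exists m.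
Qed.

Lemma le_limn_esup u c : (forall n, exists2 m, (n <= m)%N & c <= u m) ->
  c <= limn_esup u.
Proof.
move=> H; rewrite limn_esupE; apply: le_ereal_inf_tmp => _ [n _ <-].
have [m nm cm] := H n; apply: (le_trans cm).
by apply: ereal_sup_ubound; exists m.
Qed.

Lemma lt_limn_einf u c : c < limn_einf u -> exists n, forall m, (n <= m)%N -> c < u m.
Proof.
rewrite /limn_einf lteNr limn_esupE => /ereal_inf_lt[_ [n _ <-] nc].
exists n => m nm; rewrite -lteN2; apply: le_lt_trans nc.
by apply: ereal_sup_ubound; exists m.
Qed.

Lemma le_limn_einf u c n : (forall m, (n <= m)%N -> c <= u m) -> c <= limn_einf u.
Proof.
move=> H; rewrite /limn_einf leeNr limn_esupE.
apply: (@le_trans _ _ (esups (\- u) n)); first by apply: ereal_inf_lbound; exists n.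
by apply: ge_ereal_sup => _ [m /= nm <-]; rewrite leeN2; exact: H.
Qed.

End LimSupInf.

Section Growth.
Context {R : realType}.
Implicit Types (g : hardy2 R) (t c : R).

(** A vanishing partial sum has exponent [-oo], which the strict inequality excludes; [1 < ln n]
    makes the denominator positive. *)
Lemma lt_growth_exponent g t n c : 1 < ln (n%:R : R) ->
  (c%:E < growth_exponent g t n)%E -> ln n%:R `^ c <= normc (dirichlet_sum g t n).
Proof.
move=> n1; rewrite /growth_exponent; have L0 := ln_gt0 n1.
set x := normc _; have : 0 <= x by exact: normc_ge0.
rewrite inver gt_eqF// le_eqVlt => /orP[/eqP <-|x0].
  by rewrite le0_lneNy// mulNyr gtr0_sg ?invr_gt0// mul1e ltNge leNye.
rewrite lne_EFin// -EFinM lte_fin ltr_pdivlMr// => cx.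
rewrite /powR gt_eqF ?(lt_trans _ n1)//.
by rewrite -[leRHS]lnK ?posrE// ler_expR ltW.
Qed.

Lemma le_growth_exponent g t n c : 1 < ln (n%:R : R) ->
  ln n%:R `^ c <= normc (dirichlet_sum g t n) -> (c%:E <= growth_exponent g t n)%E.
Proof.
move=> n1; rewrite /growth_exponent; have L0 := ln_gt0 n1.
set x := normc _ => cx.
have x0 : 0 < x by apply: lt_le_trans cx; rewrite powR_gt0// (lt_trans _ n1).
rewrite inver gt_eqF// lne_EFin// -EFinM lee_fin ler_pdivlMr//.
by rewrite -ln_powR ler_ln ?posrE// powR_gt0// (lt_trans _ n1).
Qed.

Lemma ln_nat_large (x : R) : exists n0 : nat, forall n, (n0 <= n)%N -> x < ln n%:R.
Proof.
exists (Num.bound (expR x)) => n nb.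
have xb : expR x < n%:R.
  by rewrite (lt_le_trans (archi_boundP (expR_ge0 _)))// ler_nat.
have n0 : (0 : R) < n%:R by rewrite (lt_trans (expR_gt0 x)).
by rewrite -ltr_expR lnK ?posrE.
Qed.

Lemma beta_DS_minus_often g t c : (c%:E < beta_DS_minus g t)%E ->
  forall n, exists2 m, (n <= m)%N & ln m%:R `^ c <= normc (dirichlet_sum g t m).
Proof.
move=> /lt_limn_esup H n; have [n0 n0P] := ln_nat_large 1.
have [m nm cm] := H (maxn n n0); move: nm; rewrite geq_max => /andP[nm n0m].
by exists m => //; apply: lt_growth_exponent => //; exact: n0P.
Qed.

Lemma beta_DS_plus_eventually g t c : (c%:E < beta_DS_plus g t)%E ->
  exists n, forall m, (n <= m)%N -> ln m%:R `^ c <= normc (dirichlet_sum g t m).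
Proof.
move=> /lt_limn_einf[n H]; have [n0 n0P] := ln_nat_large 1.
exists (maxn n n0) => m; rewrite geq_max => /andP[nm n0m].
by apply: lt_growth_exponent; [exact: n0P|exact: H].
Qed.

Lemma dyadic_scale (x : R) : 1 <= x -> exists m : nat, 2 ^+ m <= x < 2 ^+ m.+1.
Proof.
move=> x1; have x0 : 0 <= x by apply: le_trans x1.
have /andP[t1 t2] := truncn_itv x0.
have tr0 : (0 < Num.truncn x)%N by rewrite truncn_gt0.
have /andP[] := trunc_log_bounds (isT : (1 < 2)%N) tr0.
exists (trunc_log 2 (Num.truncn x)); apply/andP; split.
  by apply: le_trans t1; rewrite -natrX ler_nat.
by apply: (lt_le_trans t2); rewrite -natrX ler_nat.
Qed.

(** By Bernoulli's inequality [m.+1 * x <= (1 + x) ^ m], so the square is paid by the constant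
    [x ^- 2] and the ratio [(1 + x) ^ 2 * q]. With [4 * x = 1 - q] this ratio is at most
    [q + 3 * x < 1]. *)
Lemma sqr_geometric (q : R) : 0 < q < 1 ->
  exists C r : R, [/\ 0 < C, 0 < r < 1 & forall m : nat, m.+1%:R ^+ 2 * q ^+ m <= C * r ^+ m].
Proof.
move=> /andP[q0 q1]; pose x := (1 - q) / 4.
have x4 : 4 * x = 1 - q by rewrite /x; lra.
clearbody x.
have x0 : 0 < x by lra.
have x1 : x <= 1 by lra.
have x10 : 0 < (1 + x) ^+ 2 by rewrite exprn_gt0//; lra.
exists (x ^- 2), ((1 + x) ^+ 2 * q); split.
- by rewrite invr_gt0 exprn_gt0.
- rewrite mulr_gt0//=; apply: (@le_lt_trans _ _ (q + 3 * x)); last by lra.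
  have -> : (1 + x) ^+ 2 = 1 + 2 * x + x * x by ring.
  have : x * x <= x by rewrite ler_piMr// ltW.
  have : x * q <= x by rewrite ler_piMr// ltW.
  have : x * x * q <= x * x by apply: ler_piMr; [rewrite mulr_ge0 ?ltW|exact: ltW].
  nra.
- move=> m; rewrite [in leRHS]exprMn [leRHS]mulrA; apply: ler_wpM2r; first by rewrite exprn_ge0// ltW.
  rewrite ler_pdivlMl ?exprn_gt0// -exprMn -exprM mulnC exprM lerXn2r ?nnegrE//.
  + by rewrite mulr_ge0// ltW.
  + by rewrite exprn_ge0//; lra.
  apply: (@le_trans _ _ (1 + m%:R * x)).
    by rewrite -natr1 mulrDr mulr1 addrC mulrC lerD2r.
  elim: m => [|m IHm]; first by rewrite mul0r addr0.
  have m0 : 0 <= m%:R :> R by [].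
  rewrite exprS; apply: (@le_trans _ _ ((1 + x) * (1 + m%:R * x))); last first.
    by apply: ler_wpM2l => //; lra.
  by rewrite -natr1; have := mulr_ge0 m0 (sqr_ge0 x); nra.
Qed.

Lemma sum_geometric_le (r : R) (a b : nat) : 0 < r < 1 ->
  \sum_(a <= i < b) r ^+ i <= r ^+ a / (1 - r).
Proof.
move=> /andP[r0 r1]; rewrite ler_pdivlMr ?subr_gt0//.
have [ba|ab] := leqP b a; first by rewrite big_geq// mul0r exprn_ge0// ltW.
rewrite mulr_suml (eq_bigr (fun i => - (r ^+ i.+1 - r ^+ i))); last first.
  by move=> i _; rewrite exprSr mulrBr mulr1 opprB.
rewrite sumrN telescope_sumr ?(ltnW ab)// opprB gerBl.
by rewrite exprn_ge0// ltW.
Qed.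

Lemma geometric_small (r e : R) : 0 < r < 1 -> 0 < e ->
  exists M0 : nat, forall M, (M0 <= M)%N -> r ^+ M <= e.
Proof.
move=> /andP[r0 r1] e0.
have : (r ^+ n @[n --> \oo] --> (0:R))%classic.
  by apply: cvg_expr; rewrite gtr0_norm.
move=> /cvgr_dist_lt/(_ _ e0)[M0 _ H]; exists M0 => M M0M.
have := H _ M0M; rewrite /= sub0r normrN gtr0_norm ?exprn_gt0//; exact: ltW.
Qed.

End Growth.

(** * Upper bounds for the dimensions *)

Section UpperBounds.
Context {R : realType}.
Implicit Types (g : hardy2 R) (t c s : R) (E : set R).

Lemma powRXn (a c : R) (m : nat) : 0 <= a -> (a `^ c) ^+ m = (a ^+ m) `^ c.
Proof. by move=> a0; rewrite -powR_mulrn ?powR_ge0// powRAC powR_mulrn. Qed.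

(** The first factor makes one bound valid for both signs of [c]: for [c < 0] the minimum over the
    dyadic interval is at its right end. *)
Lemma powR_dyadic_ge c (m : nat) (x : R) : 2 ^+ m <= x -> x <= 2 ^+ m.+1 ->
  2 `^ (- `|c|) * (2 `^ c) ^+ m <= x `^ c.
Proof.
move=> mx xm; have m0 : 0 < 2 ^+ m :> R by rewrite exprn_gt0.
have x0 : 0 < x by exact: lt_le_trans mx.
rewrite powRXn//.
have [c0|c0] := leP 0 c.
  rewrite ger0_norm//; apply: (@le_trans _ _ (1 * (2 ^+ m) `^ c)).
    apply: ler_wpM2r; first exact: powR_ge0.
    rewrite -[leRHS](powRr0 (2 : R)); apply: ler_powR; first by lra.
    by rewrite oppr_le0.
  by rewrite mul1r ge0_ler_powR// nnegrE ltW.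
rewrite ltr0_norm// opprK -powRM// -exprS.
have -> : c = - - c by rewrite opprK.
rewrite (powRN _ (- c)) (powRN x) lef_pV2 ?posrE ?powR_gt0 ?exprn_gt0//.
by apply: ge0_ler_powR => //; rewrite ?nnegrE ?oppr_ge0 ltW.
Qed.

(** Number of cells times their length to the power [s]. The ratio on the right is below 1 exactly
    when [s > 1 - 2 * c]: this is the origin of the dimension [1 - 2 * beta]. *)
Lemma large_sums_scale s c (m : nat) (G : R) :
  68 * m.+1%:R ^+ 2 * 2 ^+ m * G / (2 `^ (- `|c|) * (2 `^ c) ^+ m) ^+ 2 *
    (2 ^- m) `^ s =
  68 * G / (2 `^ (- `|c|)) ^+ 2 * (m.+1%:R ^+ 2 * (2 `^ (1 - 2 * c - s)) ^+ m).
Proof.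
have two_neq0 : (2 == 0 :> R) = false by rewrite gt_eqF.
have -> : 2 `^ (1 - 2 * c - s) = 2 / (2 `^ c) ^+ 2 / 2 `^ s :> R.
  rewrite !powRB ?two_neq0 ?implybT// powRr1//.
  by rewrite (_ : 2 * c = c * 2%:R) ?powRrM ?powR_mulrn ?powR_ge0//; ring.
have -> : (2 ^- m) `^ s = ((2 `^ s) ^+ m)^-1.
  rewrite -powR_inv1 ?exprn_ge0// -powRrM mulN1r powRN; congr (_^-1).
  by rewrite powRXn.
rewrite !exprMn !exprVn -!exprM [(2 * m)%N]mulnC [(m * 2)%N]mulnC.
have a0 : (2 `^ (- `|c|) : R) != 0 by rewrite gt_eqF// powR_gt0.
have b0 : (2 `^ c : R) != 0 by rewrite gt_eqF// powR_gt0.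
have e0 : (2 `^ s : R) != 0 by rewrite gt_eqF// powR_gt0.
by field; rewrite !expf_neq0.
Qed.

Lemma hausdorff_premeasure_large_sums s delta c (m : nat) g E :
  0 <= s -> 2 ^- m <= delta ->
  (forall t, E t -> `|t| <= m%:R) ->
  (forall t, E t -> exists N : nat, [/\ 2 ^+ m <= ln N%:R :> R, ln N%:R <= 2 ^+ m.+1 :> R &
    ln N%:R `^ c <= normc (dirichlet_sum g t N)]) ->
  (hausdorff_premeasure s delta E <=
    (68 * h2_norm g ^+ 2 / (2 `^ (- `|c|)) ^+ 2 *
     (m.+1%:R ^+ 2 * (2 `^ (1 - 2 * c - s)) ^+ m))%:E)%E.
Proof.
move=> s0 md Em EN; set d : R := 2 ^- m.
have d0 : 0 < d by rewrite invr_gt0 exprn_gt0.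
pose K := (2 * (m * 2 ^ m)).+1.
(* The shift by [m * 2 ^ m] turns the number of a cell meeting [[-m, m]] into a natural number. *)
pose kap (t : R) : nat := `|(Num.floor (t / d) + (m * 2 ^ m)%N%:Z)%R|%N.
have kapz t : E t -> (kap t)%:Z = Num.floor (t / d) + (m * 2 ^ m)%N%:Z.
  move=> /Em; rewrite ler_norml => /andP[t1 _].
  rewrite /kap gez0_abs// -lerBlDr sub0r floor_ge_int rmorphN/= -pmulrn natrM natrX.
  by rewrite /d invrK -mulNr; apply: ler_wpM2r.
have kapK t : E t -> (kap t < K)%N.
  move=> Et; rewrite -ltz_nat kapz// /K.
  suff : Num.floor (t / d) <= (m * 2 ^ m)%N by lia.
  rewrite -(ler_int R); apply: (le_trans (floor_le _)).
  have := Em _ Et; rewrite ler_norml => /andP[_ t1].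
  rewrite -pmulrn natrM natrX /d invrK; exact: ler_wpM2r.
pose D := kap @` E.
pose P (i : 'I_K) := `[< D i >].
have tP (i : {i : 'I_K | P i}) : exists t, E t /\ kap t = sval i.
  by case: i => i /= /asboolP[t Et ti]; exists t.
pose t i := sval (cid (tP i)).
have tE i : E (t i) /\ kap (t i) = sval i := svalP (cid (tP i)).
have NP i : exists N : nat, [/\ 2 ^+ m <= ln N%:R :> R, ln N%:R <= 2 ^+ m.+1 :> R &
    ln N%:R `^ c <= normc (dirichlet_sum g (t i) N)] by apply: EN; exact: (tE i).1.
pose N i := sval (cid (NP i)).
have NE i : [/\ 2 ^+ m <= ln (N i)%:R :> R, ln (N i)%:R <= 2 ^+ m.+1 :> R &
    ln (N i)%:R `^ c <= normc (dirichlet_sum g (t i) (N i))] := svalP (cid (NP i)).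
pose tau := 2 `^ (- `|c|) * (2 `^ c) ^+ m : R.
have tau0 : 0 < tau by rewrite mulr_gt0// ?exprn_gt0// powR_gt0.
have cardP : #|{: {i : 'I_K | P i}}|%:R <=
    68 * (m.+1)%:R ^+ 2 * 2 ^+ m * h2_norm g ^+ 2 / tau ^+ 2.
  apply: (@card_large_sums _ _ t N) => //.
  - by move=> i; apply: Em; exact: (tE i).1.
  - by move=> i; have [] := NE i.
  - move=> i j ij; apply: val_inj; apply: val_inj => /=.
    by rewrite -(tE i).2 -(tE j).2 /kap; rewrite -/d in ij; rewrite ij.
  - by move=> i; have [h1 h2 h3] := NE i; apply: le_trans h3; exact: powR_dyadic_ge.
apply: (@le_trans _ _ (\esum_(i in `I_K `&` D) diam_pow s [set t | E t /\ kap t = i])%E).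
  apply: hausdorff_premeasure_le_esum => [i _|u Eu]; last first.
    by exists (kap u) => //; split; [exact: kapK|exists u].
  apply: (@le_trans _ _ d%:E); last by rewrite lee_fin.
  apply: diameter_le => x y [Ex kx] [Ey ky]; apply: floor_eq_dist => //.
  by apply: (@addIr _ (m * 2 ^ m)%N%:Z); rewrite -!kapz// kx ky.
rewrite esum_mkcondr esum_fset; last 2 first.
  - exact: finite_II.
  - by move=> i _; case: ifP => // _; exact: diam_pow_ge0.
rewrite -fsbig_ord/=.
apply: (@le_trans _ _ (\sum_(i < K) (if P i then d `^ s else 0)%:E)%E).
  apply: lee_sum => i _; rewrite /P; case: ifPn => [/set_mem Di|]; last first.
    by move=> _; case: ifP => _; rewrite lee_fin// powR_ge0.
  rewrite asboolT//; apply: diam_pow_le => //; first exact: ltW.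
  apply: diameter_le => x y [Ex kx] [Ey ky]; apply: floor_eq_dist => //.
  by apply: (@addIr _ (m * 2 ^ m)%N%:Z); rewrite -!kapz// kx ky.
rewrite sumEFin lee_fin -big_mkcond/= sumr_const -[leLHS]mulr_natl -card_sig.
apply: (le_trans (ler_wpM2r (powR_ge0 _ _) cardP)).
by rewrite large_sums_scale.
Qed.

Lemma powR2_lt1 c : c < 0 -> 0 < 2 `^ c < 1 :> bool.
Proof.
move=> c0; rewrite powR_gt0//= /powR gt_eqF// expR_lt1 nmulr_rlt0//.
by rewrite ln_gt0//; lra.
Qed.

(** Borel-Cantelli: every point of the set has large sums at some scale beyond any given [M], and
    the costs of these scales form the tail of a convergent geometric series. *)
Lemma hausdorff_calE_minus0 s c g : 0 <= s -> 1 - 2 * c < s ->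
  hausdorff_measure s [set t | (c%:E < beta_DS_minus g t)%E] = 0%E.
Proof.
move=> s0 cs; set q : R := 2 `^ (1 - 2 * c - s).
have q01 : 0 < q < 1 by apply: powR2_lt1; lra.
have [C [r [C0 r01 qr]]] := sqr_geometric q01.
have /andP[r0 r1] := r01.
set A : R := 68 * h2_norm g ^+ 2 / (2 `^ (- `|c|)) ^+ 2.
have A0 : 0 <= A by rewrite divr_ge0 ?exprn_ge0 ?powR_ge0// mulr_ge0 ?sqr_ge0.
apply: hausdorff_measure_eq0 => delta e delta0 e0.
have [M1 M1P] := @geometric_small R 2^-1 delta ltac:(lra) delta0.
have ACe : 0 < e * (1 - r) / (A * C + 1).
  by rewrite divr_gt0 ?mulr_gt0 ?subr_gt0// ltr_wpDl// mulr_ge0// ltW.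
have [M2 M2P] := geometric_small r01 ACe.
pose M := maxn M1 M2.
pose E (i : nat) := [set t : R | `|t| <= (M + i)%:R /\ exists N : nat,
  [/\ 2 ^+ (M + i) <= ln N%:R :> R, ln N%:R <= 2 ^+ (M + i).+1 :> R &
    ln N%:R `^ c <= normc (dirichlet_sum g t N)]].
apply: (@le_trans _ _ (hausdorff_premeasure s delta (\bigcup_i E i))).
  apply: hausdorff_premeasureS => t /= /beta_DS_minus_often H.
  (* The scale must also exceed [|t|], since the count at scale [m] only concerns [[-m, m]]. *)
  pose M3 := maxn M (Num.bound `|t|).
  have [n0 n0P] := ln_nat_large (2 ^+ M3 : R).
  have [N n0N NP] := H n0; have MN := n0P _ n0N.
  have [|m /andP[mN Nm]] := @dyadic_scale R (ln N%:R).
    by apply: (le_trans _ (ltW MN)); rewrite exprn_ege1//; lra.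
  have M3m : (M3 <= m)%N.
    have : 2 ^+ M3 < 2 ^+ m.+1 :> R by exact: lt_trans Nm.
    by rewrite ltr_eXn2l ?ltnS//; lra.
  have Mm : (M <= m)%N by exact: leq_trans (leq_maxl _ _) M3m.
  exists (m - M)%N => //; rewrite /E/= subnKC//; split; last first.
    by exists N; split => //; exact: ltW.
  apply: (@le_trans _ _ (Num.bound `|t|)%:R); first exact/ltW/archi_boundP.
  by rewrite ler_nat (leq_trans _ M3m)// leq_maxr.
apply: (le_trans (hausdorff_premeasure_bigcup _ _ _)).
apply: lime_le.
  by apply: is_cvg_nneseries => i _ _; exact: hausdorff_premeasure_ge0.
apply: nearW => n.
apply: (@le_trans _ _ (\sum_(0 <= i < n) (A * (C * r ^+ (M + i)))%:E)%E).
  apply: lee_sum => i _.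
  apply: (le_trans (@hausdorff_premeasure_large_sums s delta c (M + i) g _ s0 _ _ _)).
  - rewrite -exprVn; apply: M1P; rewrite (leq_trans (leq_maxl M1 M2))//.
    exact: leq_addr.
  - by move=> t [].
  - by move=> t [].
  - by rewrite lee_fin ler_wpM2l.
rewrite sumEFin lee_fin -!mulr_sumr.
rewrite (eq_bigr (fun i => r ^+ M * r ^+ i)); last by move=> i _; rewrite exprD.
rewrite -mulr_sumr; have := @sum_geometric_le R r 0 n r01; rewrite expr0 => hs.
apply: (@le_trans _ _ (A * (C * (e * (1 - r) / (A * C + 1) * (1 / (1 - r)))))).
  apply: ler_wpM2l => //; apply: ler_wpM2l; first exact: ltW.
  apply: ler_pM => //.
  - by rewrite exprn_ge0// ltW.
  - by apply: sumr_ge0 => i _; rewrite exprn_ge0// ltW.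
  - by apply: M2P; exact: leq_maxr.
have AC0 : 0 <= A * C by rewrite mulr_ge0// ltW.
rewrite (_ : A * _ = e * (A * C / (A * C + 1))); last first.
  by field; rewrite !gt_eqF//; lra.
by rewrite ger_pMr// ler_pdivrMr ?mul1r ?lerDl//; lra.
Qed.

Lemma hausdorff_calE_minus s beta g : 0 <= s -> 1 - 2 * beta < s ->
  hausdorff_measure s (calE_DS_minus beta g) = 0%E.
Proof.
(* The midpoint of [(1 - s) / 2] and [beta]: then [c < beta] and still [1 - 2 * c < s]. *)
move=> s0 bs; pose c := (beta + (1 - s) / 2) / 2.
apply: (hausdorff_measure0S _ (@hausdorff_calE_minus0 s c g s0 _)).
  move=> t /=; rewrite /calE_DS_minus/=; apply: lt_le_trans.
  by rewrite lte_fin /c; lra.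
by rewrite /c; lra.
Qed.

Lemma nat_with_ln (m : nat) : exists N : nat,
  [/\ (m <= N)%N, 2 ^+ m <= ln N%:R :> R & ln N%:R <= 2 ^+ m.+1 :> R].
Proof.
pose x : R := expR (2 ^+ m).
have p1 : 1 <= 2 ^+ m :> R by rewrite exprn_ege1//; lra.
have x1 : 1 <= x by rewrite -(expR0 R) ler_expR; lra.
have x0 : 0 <= x by lra.
have /andP[t1 t2] := truncn_itv x0.
exists (Num.truncn x).+1; split.
- rewrite -(@ler_nat R); apply: (@le_trans _ _ x); last exact: ltW.
  apply: (@le_trans _ _ (1 + 2 ^+ m)); last exact: expR_ge1Dx.
  apply: ler_wpDl => //; rewrite -natrX ler_nat; exact/ltnW/ltn_expl.
- by rewrite -ler_expR lnK ?posrE ?ltr0n//; exact: ltW.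
- rewrite -ler_expR lnK ?posrE ?ltr0n// -natr1.
  apply: (@le_trans _ _ (x + x)); first by apply: lerD.
  rewrite exprS mulr_natl mulr2n expRD -/x.
  have : 2 <= x by have := @expR_ge1Dx R (2 ^+ m); rewrite -/x; lra.
  nra.
Qed.

(** A packing may mix all radii, so large sums are needed at every scale. The balls are grouped by
    the dyadic size [2 ^- k] of their radii. Disjointness puts the centres of a group into distinct
    cells of length [2 ^- k], and one index [N >= j] with [ln N] about [2 ^ k] serves all of them,
    so the maximal bound counts the group. *)
Lemma packing_premeasure_large_sums0 s c g (j : nat) : 0 <= s -> 1 - 2 * c < s ->
  packing_premeasure s [set t : R | `|t| <= j%:R /\ forall N, (j <= N)%N ->
    ln N%:R `^ c <= normc (dirichlet_sum g t N)] = 0%E.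
Proof.
move=> s0 cs; set E := [set t | _]; set q : R := 2 `^ (1 - 2 * c - s).
have q01 : 0 < q < 1 by apply: powR2_lt1; lra.
have [C [r [C0 r01 qr]]] := sqr_geometric q01.
have /andP[r0 r1] := r01.
set A : R := 68 * h2_norm g ^+ 2 / (2 `^ (- `|c|)) ^+ 2.
have A0 : 0 <= A by rewrite divr_ge0 ?exprn_ge0 ?powR_ge0// mulr_ge0 ?sqr_ge0.
have B0 : 0 <= 2 `^ s * (A * C) by rewrite mulr_ge0 ?powR_ge0// mulr_ge0// ltW.
apply/eqP; rewrite eq_le packing_premeasure_ge0 andbT.
apply/lee_addgt0Pr => e e0; rewrite add0e.
have ACe : 0 < e * (1 - r) / (2 `^ s * (A * C) + 1).
  by rewrite divr_gt0 ?mulr_gt0 ?subr_gt0// ltr_wpDl.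
have [M2 M2P] := geometric_small r01 ACe.
pose M := maxn j M2.
apply: (@le_trans _ _ (packing_premeasure_at s (2 ^- M) E)).
  by apply: ereal_inf_lbound; exists (2 ^- M) => //=; rewrite invr_gt0 exprn_gt0.
apply: ge_ereal_sup => _ [D [x [rho [[xE rhoP tr] ->]]]].
have rho0 i : D i -> 0 < rho i by move=> /rhoP/andP[].
pose k i := xget 0%N [set k : nat | 2 ^+ k <= (rho i)^-1 < 2 ^+ k.+1].
have kP i : D i -> 2 ^+ (k i) <= (rho i)^-1 < 2 ^+ (k i).+1.
  move=> Di.
  suff /(xgetPex 0%N) : exists m : nat, 2 ^+ m <= (rho i)^-1 < 2 ^+ m.+1 by [].
  apply: dyadic_scale; rewrite invf_ge1 ?rho0//; have /andP[_ /le_trans] := rhoP _ Di; apply.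
  by rewrite invf_le1 ?exprn_gt0// exprn_ege1//; lra.
have rho_le i : D i -> rho i <= 2 ^- k i.
  move=> Di; have /andP[ki _] := kP _ Di.
  by rewrite -[leLHS]invrK lef_pV2 ?posrE ?invr_gt0 ?rho0 ?exprn_gt0.
have rho_gt i : D i -> 2 ^- (k i).+1 < rho i.
  move=> Di; have /andP[_ ki] := kP _ Di.
  by rewrite -[ltRHS]invrK ltf_pV2 ?posrE ?invr_gt0 ?rho0 ?exprn_gt0.
have Mk i : D i -> (M <= k i)%N.
  move=> Di; rewrite -ltnS -(@ltr_eXn2l R 2); last by lra.
  rewrite -ltf_pV2 ?posrE ?exprn_gt0//; apply: (lt_le_trans (rho_gt _ Di)).
  by have /andP[] := rhoP _ Di.
pose tau m := 2 `^ (- `|c|) * (2 `^ c) ^+ m : R.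
have tau0 m : 0 < tau m by rewrite mulr_gt0// ?exprn_gt0// powR_gt0.
pose cnt m := 68 * (m.+1)%:R ^+ 2 * 2 ^+ m * h2_norm g ^+ 2 / tau m ^+ 2.
rewrite esum_mkcond -nneseries_esumT; last first.
  by move=> i; case: ifP => // _; exact: diam_pow_ge0.
apply: lime_le.
  by apply: is_cvg_nneseries => i _ _; case: ifP => // _; exact: diam_pow_ge0.
apply: nearW => n; rewrite big_mkord.
pose P (i : 'I_n) := `[< D i >].
(* The factor [2 ^ s] accounts for the diameter being twice the radius. *)
apply: (@le_trans _ _ (\sum_(i < n) (if P i then 2 `^ s * (2 ^- k i) `^ s else 0)%:E)%E).
  apply: lee_sum => i _; rewrite /P; case: ifPn => [/set_mem Di|]; last first.
    by move=> _; case: ifP => _; rewrite lee_fin ?mulr_ge0 ?powR_ge0.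
  rewrite asboolT// -powRM ?invr_ge0 ?exprn_ge0//.
  apply: diam_pow_le => //.
  apply: diameter_le => y z; rewrite closed_ballE ?rho0// /closed_ball_/= => yx zx.
  apply: (le_trans (ler_distD (x i) _ _)); rewrite distrC.
  by have := rho_le _ Di; lra.
rewrite sumEFin lee_fin -big_mkcond/= -mulr_sumr.
have DE : forall m, #|[pred i | P i && (k i == m)]|%:R <=
    (if (M <= m)%N then cnt m else 0).
  move=> m; pose I : finType := {i : 'I_n | P i && (k i == m)}.
  have DI (i : I) : D (sval i) by case: i => i /= /andP[/asboolP].
  have kI (i : I) : k (sval i) = m by case: i => i /= /andP[_ /eqP].
  rewrite -card_sig; case: ifPn => Mm; last first.
    rewrite (_ : #|_| = 0%N)//; apply: eq_card0 => i.
    by have := Mk _ (DI i); rewrite kI (negbTE Mm).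
  have jm : (j <= m)%N by rewrite (leq_trans _ Mm)// leq_maxl.
  have [N [mN N1 N2]] := nat_with_ln m.
  apply: (@card_large_sums _ I (fun i => x (sval i)) (fun=> N)) => //.
  - move=> i; have [xj _] := xE _ (DI i); apply: (le_trans xj).
    by rewrite ler_nat.
  - move=> i i' /floor_eq_dist ii'; apply: val_inj; apply: val_inj.
    apply: tr (DI i) (DI i') _ => /=.
    have ri := rho_gt _ (DI i); have ri' := rho_gt _ (DI i').
    have xx : `|x (sval i) - x (sval i')| <= rho (sval i) + rho (sval i').
      have half : 2 ^- m.+1 = 2 ^- m / 2 :> R.
        by rewrite exprS invfM mulrC.
      rewrite kI half in ri; rewrite kI half in ri'.
      apply: (le_trans (ii' _)); last by lra.
      by rewrite invr_gt0 exprn_gt0.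
    move: xx; set a := x (sval i); set b := x (sval i') => xx.
    have ra := rho0 _ (DI i); have rb := rho0 _ (DI i').
    set u := rho _ in xx ra *; set v := rho _ in xx rb *.
    have uv : 0 < u + v by rewrite addr_gt0.
    (* Each radius exceeds half a cell, so centres in one cell are closer than the sum of the radii;
       the point dividing their segment in the ratio of the radii then lies in both balls. *)
    exists (a + (b - a) * (u / (u + v))); split; rewrite closed_ballE// /closed_ball_/=.
      rewrite opprD addrA subrr sub0r normrN normrM distrC.
      rewrite [X in _ * X]ger0_norm; last by rewrite divr_ge0 ?ltW.
      by rewrite mulrA ler_pdivrMr// mulrC ler_pM2l.
    have -> : b - (a + (b - a) * (u / (u + v))) = (b - a) * (v / (u + v)).
      by field; rewrite gt_eqF.
    rewrite normrM distrC [X in _ * X]ger0_norm; last by rewrite divr_ge0 ?ltW.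
    by rewrite mulrA ler_pdivrMr// mulrC ler_pM2l.
  - move=> i; have [_ xS] := xE _ (DI i); apply: (le_trans _ (xS _ _)).
      exact: powR_dyadic_ge.
    exact: leq_trans mN.
have h0 m : 0 <= (2 ^- m) `^ s by exact: powR_ge0.
have kmax (i : 'I_n) : P i -> (k i <= \max_(i < n) k i)%N.
  by move=> _; exact: (@leq_bigmax _ (fun i : 'I_n => k i)).
have := @sum_fiber_le _ _ P (fun i : 'I_n => k i) _ _ (fun m => (2 ^- m) `^ s) kmax DE h0.
set Km := \max_(i < n) k i => /(ler_wpM2l (powR_ge0 2 s)) /le_trans; apply.
rewrite (eq_bigr (fun m => if (M <= m)%N then cnt m * (2 ^- m) `^ s else 0)); last first.
  by move=> m _; case: ifP; rewrite // mul0r.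
rewrite -big_mkcond/=.
rewrite (_ : \sum_(0 <= m < Km.+1 | _) _ =
  \sum_(M <= m < Km.+1) cnt m * (2 ^- m) `^ s); last by rewrite [RHS](big_nat_widenl M 0).
apply: (@le_trans _ _ (2 `^ s * (\sum_(M <= m < Km.+1) A * (C * r ^+ m)))).
  apply: ler_wpM2l; first exact: powR_ge0.
  by apply: ler_sum => m _; rewrite /cnt large_sums_scale; exact: ler_wpM2l.
rewrite -!mulr_sumr.
apply: (@le_trans _ _ (2 `^ s * (A * (C * (e * (1 - r) / (2 `^ s * (A * C) + 1) / (1 - r)))))).
  apply: ler_wpM2l; first exact: powR_ge0.
  apply: ler_wpM2l => //; apply: ler_wpM2l; first exact: ltW.
  apply: (le_trans (sum_geometric_le _ _ r01)); apply: ler_wpM2r.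
    by rewrite invr_ge0 subr_ge0 ltW.
  by apply: M2P; exact: leq_maxr.
set S := 2 `^ s in B0 *.
rewrite (_ : S * _ = e * (S * (A * C) / (S * (A * C) + 1))); last first.
  by field; rewrite !gt_eqF//; lra.
by rewrite ger_pMr// ler_pdivrMr ?mul1r ?lerDl//; lra.
Qed.

(** The rank from which the sums stay large depends on the point. The sets [F j], where it is
    uniform, cover the whole set, and each is null already for the premeasure. *)
Lemma packing_calE_plus s beta g : 0 <= s -> 1 - 2 * beta < s ->
  packing_measure s (calE_DS_plus beta g) = 0%E.
Proof.
move=> s0 bs; pose c := (beta + (1 - s) / 2) / 2.
have cs : 1 - 2 * c < s by rewrite /c; lra.
pose F (j : nat) := [set t : R | `|t| <= j%:R /\ forall N, (j <= N)%N ->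
    ln N%:R `^ c <= normc (dirichlet_sum g t N)].
apply/eqP; rewrite eq_le; apply/andP; split; last first.
  apply: le_ereal_inf_tmp => _ [G _ <-].
  by apply: nneseries_ge0 => i _ _; exact: packing_premeasure_ge0.
apply: ereal_inf_lbound; exists F; last first.
  by apply: eseries0 => j _ _; exact: packing_premeasure_large_sums0.
move=> t tE; have : (c%:E < beta_DS_plus g t)%E.
  by apply: lt_le_trans tE; rewrite lte_fin /c; lra.
move=> /beta_DS_plus_eventually[n nP].
exists (maxn n (Num.bound `|t|)) => //; split.
  apply: (@le_trans _ _ (Num.bound `|t|)%:R); first exact/ltW/archi_boundP.
  by rewrite ler_nat leq_maxr.
by move=> N; rewrite geq_max => /andP[nN _]; exact: nP.
Qed.

End UpperBounds.

(** * A lacunary product *)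

Section Blocks.
Context {R : realType}.

(** The constant 5 keeps all weights at most 1/32, which absorbs the error terms of the inductions
    below. *)
Definition half_len (i : nat) : nat := (i ^ 2 + 5)%N.

(** The [i]-th factor has [2 ^ (2 * half_len i)] terms; because [2 * pi < 8], three more vanishing
    digits keep the arguments of all its powers in [[0, 1]] on a zero block. *)
Definition block_len (i : nat) : nat := (2 * half_len i + 3)%N.

Definition block_start (n : nat) : nat := (\sum_(i < n) block_len i)%N.

Lemma block_startS n : block_start n.+1 = (block_start n + block_len n)%N.
Proof. by rewrite /block_start big_ord_recr. Qed.

Lemma leq_block_start m n : (m <= n)%N -> (block_start m <= block_start n)%N.
Proof.
elim: n => [|n IHn]; first by rewrite leqn0 => /eqP ->.
rewrite leq_eqVlt => /orP[/eqP->//|]; rewrite ltnS => /IHn /leq_trans; apply.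
by rewrite block_startS leq_addr.
Qed.

Lemma leq_id_sqr n : (n <= n ^ 2)%N.
Proof. by case: n => // n; rewrite -mulnn leq_pmulr. Qed.

Lemma cube_le_block_start n : (n ^ 3 <= 3 * block_start n)%N.
Proof.
elim: n => [//|n IHn]; rewrite block_startS /block_len /half_len.
by move: IHn; rewrite !expnS !expn0; nia.
Qed.

Lemma leq_id_block_start n : (n <= block_start n)%N.
Proof.
elim: n => [//|n IHn]; rewrite block_startS /block_len; lia.
Qed.

(** The inverse square root of [block_count i], lowered by [2 ^- i] so that the squared weights
    times the counts are summable. *)
Definition block_weight (i : nat) : R := 2 ^- (half_len i + i).

Definition block_count (i : nat) : nat := (2 ^ (2 * half_len i))%N.

Definition block_coef (i v : nat) : R :=
  if v == 0%N then 1 else if (v < block_count i)%N then block_weight i else 0.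

(* Coefficient of [w ^+ u] in
   [\prod_(i < n) (1 + block_weight i * \sum_(1 <= v < block_count i) w ^+ (v * 2 ^ block_start i))]. *)
Fixpoint product_coef (n u : nat) : R :=
  if n is n'.+1 then
    product_coef n' (u %% 2 ^ block_start n') * block_coef n' (u %/ 2 ^ block_start n')
  else 1.

(** Coefficient of the infinite product: later factors only add frequencies at or above
    [2 ^ block_start u > u]. *)
Definition freq_coef (u : nat) : R := product_coef u u.

Lemma block_weight_gt0 i : 0 < block_weight i.
Proof. by rewrite invr_gt0 exprn_gt0. Qed.

Lemma block_weight_le i : block_weight i <= 2 ^- 5 * 2 ^- i.
Proof.
rewrite -invfM -exprD lef_pV2 ?posrE ?exprn_gt0// ler_eXn2l; last by lra.
by rewrite /half_len leq_add2r leq_addl.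
Qed.

Lemma block_weight_le1 i : block_weight i <= 1 / 32.
Proof.
apply: (le_trans (block_weight_le i)); rewrite -[leRHS]mulr1.
have : 2 ^- i <= 1 :> R by rewrite invf_le1 ?exprn_gt0// exprn_ege1//; lra.
have -> : 2 ^- 5 = 1 / 32 :> R by rewrite -[32%:R]/((2 ^ 5)%N%:R) natrX mul1r.
by move=> ?; rewrite ler_pM2l//; lra.
Qed.

Lemma block_coef_itv i v : 0 <= block_coef i v <= 1.
Proof.
rewrite /block_coef; case: ifP => _; first by rewrite ler01 lexx.
case: ifP => _; last by rewrite lexx ler01.
by have := block_weight_gt0 i; have := block_weight_le1 i; move=> h1 h2; apply/andP; split; lra.
Qed.

Lemma product_coef_itv n u : 0 <= product_coef n u <= 1.
Proof.
elim: n u => [|n IHn] u /=; first by rewrite ler01 lexx.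
have /andP[a0 a1] := IHn (u %% 2 ^ block_start n)%N.
have /andP[b0 b1] := block_coef_itv n (u %/ 2 ^ block_start n)%N.
by rewrite mulr_ge0// mulr_ile1.
Qed.

Lemma product_coef_stable n m u : (n <= m)%N -> (u < 2 ^ block_start n)%N ->
  product_coef m u = product_coef n u.
Proof.
elim: m => [|m IHm]; first by rewrite leqn0 => /eqP ->.
rewrite leq_eqVlt ltnS => /orP[/eqP->//|nm un] /=.
have um : (u < 2 ^ block_start m)%N.
  by apply: (leq_trans un); rewrite leq_exp2l// leq_block_start.
by rewrite modn_small// divn_small// IHm// /block_coef eqxx mulr1.
Qed.

Lemma freq_coefE n u : (u < 2 ^ block_start n)%N -> freq_coef u = product_coef n u.
Proof.
move=> un; rewrite /freq_coef.
have uu : (u < 2 ^ block_start u)%N.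
  by apply: (leq_trans (ltn_expl u (isT : (1 < 2)%N))); rewrite leq_exp2l// leq_id_block_start.
have [nu|nu] := leqP n u; first exact: product_coef_stable.
by rewrite (product_coef_stable (ltnW nu) uu).
Qed.

Lemma sum_blocks (V : nmodType) (M v w : nat) (G : nat -> V) :
  \sum_(0 <= u < v * M + w) G u =
  \sum_(0 <= j < v) \sum_(0 <= x < M) G (j * M + x)%N + \sum_(0 <= x < w) G (v * M + x)%N.
Proof.
elim: v w => [|v IHv] w; first by rewrite [X in X + _]big_geq// add0r.
rewrite mulSn -addnA addnCA IHv [in RHS]big_nat_recr//= -addrA; congr (_ + _).
rewrite (@big_cat_nat _ _ _ M)//= ?leq_addr//; congr (_ + _).
rewrite -{1}[M]add0n big_addn addnC addnK; apply: eq_bigr => x _.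
by congr (G _); lia.
Qed.

Lemma product_coef_block n j x : (x < 2 ^ block_start n)%N ->
  product_coef n.+1 (j * 2 ^ block_start n + x) = product_coef n x * block_coef n j.
Proof.
move=> xn /=; rewrite modnMDl modn_small// divnMDl ?expn_gt0//.
by rewrite divn_small// addn0.
Qed.

Lemma sum_sqr_block_coef n :
  \sum_(0 <= v < 2 ^ block_len n) block_coef n v ^+ 2 <= 1 + (2 ^- n) ^+ 2.
Proof.
rewrite big_ltn ?expn_gt0// {1}/block_coef eqxx expr1n lerD2l.
apply: (@le_trans _ _ (\sum_(0 <= v < block_count n) block_weight n ^+ 2)).
  have Vl : (block_count n <= 2 ^ block_len n)%N.
    by rewrite leq_exp2l// /block_len leq_addr.
  rewrite [leRHS](big_nat_widen _ _ _ _ _ Vl) [leRHS]big_mkcond/=.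
  rewrite [leRHS]big_ltn ?expn_gt0//.
  apply: ler_wpDl; first exact: sqr_ge0.
  apply: ler_sum_nat => v /andP[v0 _]; rewrite /block_coef gtn_eqF//.
  by case: ifP => // _; rewrite expr0n.
rewrite sumr_const_nat subn0 -[leLHS]mulr_natr /block_count natrX /block_weight.
rewrite exprD mulnC exprM invfM exprMn mulrAC -exprMn mulVf ?expf_neq0//.
by rewrite expr1n mul1r.
Qed.

Lemma pow2V_itv n : 0 < (2 ^- n : R) <= 1.
Proof.
by rewrite invr_gt0 exprn_gt0//= invf_le1 ?exprn_gt0// exprn_ege1//; lra.
Qed.

(** Exponents split uniquely along the blocks, so the sum of squares is multiplicative. The bound is
    shaped so that multiplication by [1 + 4 ^- n] leads from [n] to [n.+1]. *)
Lemma sum_sqr_product_coef n :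
  \sum_(0 <= u < 2 ^ block_start n) product_coef n u ^+ 2 <= 4 - 3 * 2 ^- n.
Proof.
elim: n => [|n IHn].
  by rewrite /block_start big_ord0 expn0 big_nat1 /= expr1n expr0 invr1; lra.
set M := (2 ^ block_start n)%N.
rewrite (_ : (2 ^ block_start n.+1)%N = (2 ^ block_len n * M + 0)%N); last first.
  by rewrite block_startS expnD mulnC addn0.
rewrite sum_blocks [X in _ + X]big_geq// addr0.
rewrite (eq_bigr (fun j => block_coef n j ^+ 2 *
    \sum_(0 <= x < M) product_coef n x ^+ 2)); last first.
  move=> j _; rewrite mulr_sumr; apply: eq_big_nat => x /andP[_ xM].
  by rewrite product_coef_block// exprMn mulrC.
rewrite -mulr_suml; have h := sum_sqr_block_coef n.
have /andP[p0 p1] := pow2V_itv n.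
have -> : 2 ^- n.+1 = 2 ^- n / 2 :> R by rewrite exprS invfM mulrC.
apply: (@le_trans _ _ ((1 + (2 ^- n) ^+ 2) * (4 - 3 * 2 ^- n))).
  by apply: ler_pM => //; apply: sumr_ge0 => *; exact: sqr_ge0.
move: p0 p1; set p := 2 ^- n; move=> p0 p1.
have : 0 <= p * (p - 2 / 3) ^+ 2 by rewrite mulr_ge0 ?sqr_ge0// ltW.
by nra.
Qed.

Lemma sum_sqr_freq_coef n : \sum_(0 <= u < n) freq_coef u ^+ 2 <= 4.
Proof.
have nn : (n <= 2 ^ block_start n)%N.
  by rewrite ltnW// (leq_trans (ltn_expl n (isT : (1 < 2)%N)))// leq_exp2l// leq_id_block_start.
apply: (@le_trans _ _ (\sum_(0 <= u < 2 ^ block_start n) product_coef n u ^+ 2)).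
  rewrite (@big_cat_nat _ _ _ n 0 (2 ^ block_start n))//= -[leLHS]addr0.
  apply: lerD; last by apply: sumr_ge0 => *; exact: sqr_ge0.
  apply: ler_sum_nat => u /andP[_ un]; rewrite (@freq_coefE n)//.
  exact: leq_trans nn.
apply: (le_trans (sum_sqr_product_coef n)).
by have /andP[p0 p1] := pow2V_itv n; lra.
Qed.

End Blocks.

(** * Size of the product and of its partial sums at one point *)

Section LacunaryProduct.
Context {R : realType}.
Variables (w : R[i]) (zero : nat -> bool).
Hypothesis w1 : normc w = 1.

Let z i := w ^+ (2 ^ block_start i).

Hypothesis zeroP : forall i v, zero i -> (v < block_count i)%N ->
  1 / 2 <= complex.Re (z i ^+ v).
Hypothesis freeP : forall i, ~~ zero i -> 1 <= normc (1 - z i).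

Let P n M := \sum_(0 <= u < M) (product_coef n u)%:C * w ^+ u : R[i].
Let F n := normc (P n (2 ^ block_start n)).
Let A n v := \sum_(0 <= j < v) (block_coef n j)%:C * z n ^+ j : R[i].
Let kap n : R := block_weight n.

Let normc_pow x : normc (w ^+ x) = 1.
Proof. by elim: x => [|x IHx]; rewrite ?expr0 ?normc1// exprS normcM w1 IHx mulr1. Qed.

(** The exponents split into [v] full copies of the first [n] factors and an incomplete one. The
    latter carries a single coefficient of the new factor, small as soon as [v > 0]; this is what
    keeps partial sums comparable to full ones. *)
Let partial_sum n v x : (x <= 2 ^ block_start n)%N ->
  P n.+1 (v * 2 ^ block_start n + x) =
  A n v * P n (2 ^ block_start n) + (block_coef n v)%:C * z n ^+ v * P n x.
Proof.
move=> xn; rewrite /P sum_blocks; congr (_ + _).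
  rewrite /A mulr_suml; apply: eq_bigr => j _; rewrite mulr_sumr.
  apply: eq_big_nat => y /andP[_ yn]; rewrite product_coef_block//.
  by rewrite /z rmorphM/= -exprM mulnC exprD; ring.
rewrite mulr_sumr; apply: eq_big_nat => y /andP[_ yx].
rewrite product_coef_block//; last exact: leq_trans xn.
by rewrite /z rmorphM/= -exprM mulnC exprD; ring.
Qed.

Let normcz n v : normc (z n ^+ v) = 1.
Proof. by rewrite /z -exprM normc_pow. Qed.

Let A_big n v : (0 < v)%N ->
  A n v = 1 + (kap n)%:C * \sum_(1 <= j < minn v (block_count n)) z n ^+ j.
Proof.
move=> v0; rewrite /A big_ltn// {1}/block_coef eqxx expr0 mulr1; congr (_ + _).
rewrite mulr_sumr [RHS](big_nat_widen _ _ _ _ _ (geq_minl v _)) [RHS]big_mkcond/=.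
apply: eq_big_nat => j /andP[j0 jv]; rewrite /block_coef gtn_eqF// leq_min jv/=.
by case: ifP; rewrite ?mul0r.
Qed.

Let A_le n v : normc (A n v) <= 1 + kap n * (block_count n).-1%:R.
Proof.
have k0 : 0 < kap n := block_weight_gt0 n.
case: v => [|v].
  by rewrite /A big_geq// normc0 addr_ge0// mulr_ge0// ltW.
rewrite A_big//; apply: (le_trans (le_normcD _ _)); rewrite normc1 lerD2l.
rewrite normcM normcR gtr0_norm//; apply: ler_wpM2l; first exact: ltW.
apply: (le_trans (normc_sum _ _ _)); under eq_bigr do rewrite normcz.
rewrite sumr_const_nat ler_nat subn1; have : (0 < block_count n)%N by rewrite expn_gt0.
by move=> ?; rewrite -ltnS !prednK ?leq_min//; rewrite ?ltnS ?geq_minr.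
Qed.

Let A_zero_ge n v : zero n -> (0 < v)%N ->
  1 + kap n * (minn v (block_count n)).-1%:R / 2 <= complex.Re (A n v).
Proof.
move=> Zn v0; have k0 : 0 < kap n := block_weight_gt0 n.
have Re_sum (I : Type) (r : seq I) (Q : pred I) (G : I -> R[i]) :
    complex.Re (\sum_(i <- r | Q i) G i) = \sum_(i <- r | Q i) complex.Re (G i).
  by elim/big_rec2: _ => // i x y _ <-; case: (G i) => ? ?; case: y.
rewrite A_big//; set S := \sum_(1 <= j < _) _.
have -> : complex.Re (1 + (kap n)%:C * S) = 1 + kap n * complex.Re S.
  by case: S => x y /=; ring.
rewrite lerD2l -mulrA; apply: ler_wpM2l; first exact: ltW.
rewrite /S Re_sum; apply: (@le_trans _ _
    (\sum_(1 <= j < minn v (block_count n)) (1 / 2 : R))).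
  by rewrite sumr_const_nat subn1 -[leRHS]mulr_natl mul1r.
apply: ler_sum_nat => j /andP[_]; rewrite leq_min => /andP[_ jV].
exact: zeroP.
Qed.

(** A geometric sum whose unimodular ratio is at distance at least 1 from 1 is bounded by 2,
    whatever its length. *)
Let A_free n v : ~~ zero n -> (0 < v)%N -> normc (A n v - 1) <= 2 * kap n.
Proof.
move=> Zn v0; have k0 : 0 < kap n := block_weight_gt0 n.
rewrite A_big// addrAC subrr add0r normcM normcR gtr0_norm// mulrC.
apply: ler_wpM2r; first exact: ltW.
set m := minn _ _; set S := \sum_(1 <= j < m) _.
have [m1|m1] := leqP m 1; first by rewrite /S big_geq// normc0.
have e : (1 - z n) * S = z n - z n ^+ m.
  rewrite /S mulr_sumr (eq_bigr (fun j => - (z n ^+ j.+1 - z n ^+ j))); last first.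
    by move=> j _; rewrite mulrBl mul1r -exprS opprB.
  by rewrite sumrN telescope_sumr ?(ltnW m1)// opprB.
apply: (@le_trans _ _ (normc ((1 - z n) * S))).
  by rewrite normcM ler_peMl ?normc_ge0// freeP.
rewrite e; apply: (le_trans (le_normcD _ _)).
by rewrite normcN normcz -[z n]expr1 normcz; lra.
Qed.

(** Base 2 logarithm of the product of [block_weight i * block_count i / 2] over the zero blocks. *)
Definition zero_gain (n : nat) : nat :=
  (\sum_(i < n | zero i) (half_len i - i - 1))%N.

Lemma zero_gainS n :
  zero_gain n.+1 = (zero_gain n + if zero n then half_len n - n - 1 else 0)%N.
Proof. by rewrite /zero_gain big_mkcond big_ord_recr/= -big_mkcond. Qed.

Let step n : 2 ^- n.+1 = 2 ^- n / 2 :> R.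
Proof. by rewrite exprS invfM mulrC. Qed.

Let kap_le n : kap n <= 2 ^- n / 32.
Proof.
apply: (le_trans (block_weight_le n)); rewrite mulrC.
by rewrite (_ : 2 ^- 5 = 32^-1 :> R)// -[32%:R]/((2 ^ 5)%N%:R) natrX.
Qed.

Let splitM n M : (M <= 2 ^ block_start n.+1)%N ->
  exists v x, [/\ M = (v * 2 ^ block_start n + x)%N, (x <= 2 ^ block_start n)%N &
    (v == 0%N) = (M < 2 ^ block_start n)%N].
Proof.
move=> _; exists (M %/ 2 ^ block_start n)%N, (M %% 2 ^ block_start n)%N; split.
- exact: divn_eq.
- by rewrite ltnW// ltn_mod expn_gt0.
- by rewrite -leqn0 -ltnS ltn_divLR ?expn_gt0// mul1n.
Qed.

Let FS n : F n.+1 = normc (A n (2 ^ block_len n)) * F n.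
Proof.
rewrite /F (_ : (2 ^ block_start n.+1)%N = (2 ^ block_len n * 2 ^ block_start n + 0)%N).
  by rewrite partial_sum// [P n 0]big_geq// mulr0 addr0 normcM.
by rewrite block_startS expnD mulnC addn0.
Qed.

Let coef_le n v x : (0 < v)%N ->
  normc ((block_coef n v)%:C * z n ^+ v * P n x) <= kap n * normc (P n x).
Proof.
move=> v0; rewrite 2!normcM normcz mulr1; apply: ler_wpM2r; first exact: normc_ge0.
rewrite normcR /block_coef gtn_eqF//; case: ifP => _.
  by rewrite ger0_norm// ltW// block_weight_gt0.
by rewrite normr0 ltW// block_weight_gt0.
Qed.

Let F_ge0 n : 0 <= F n. Proof. exact: normc_ge0. Qed.

Let F_zero n : zero n -> (1 + kap n * (block_count n).-1%:R / 2) * F n <= F n.+1.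
Proof.
move=> Zn; rewrite FS; apply: ler_wpM2r; first exact: F_ge0.
apply: le_trans (ler_Re_normc _); have := @A_zero_ge n (2 ^ block_len n) Zn.
rewrite expn_gt0 (minn_idPr _)//; first exact.
by rewrite leq_exp2l// /block_len leq_addr.
Qed.

Let F_free n : ~~ zero n -> (1 - 2 * kap n) * F n <= F n.+1.
Proof.
move=> Zn; rewrite FS; apply: ler_wpM2r; first exact: F_ge0.
have := @A_free n (2 ^ block_len n) Zn; rewrite expn_gt0 => /(_ isT).
rewrite normcB => h; have := lerB_normcD (1 : R[i]) (- A n (2 ^ block_len n)).
by rewrite normc1 normcN; lra.
Qed.

(** A free factor may shrink [F] by [1 - 2 * kap n]; the growth [2 * 2 ^- n] of the constant pays
    for this when [v = 0]. For [v > 0] the previous constant only enters multiplied by [kap n], and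
    the constant 4 is enough. *)
Let partial_le n M : (M <= 2 ^ block_start n)%N ->
  normc (P n M) <= (8 - 4 * 2 ^- n) * F n.
Proof.
elim: n M => [|n IHn] M.
  rewrite /block_start big_ord0 expn0 => M1.
  have F0 : F 0 = 1.
    by rewrite /F /P /block_start big_ord0 expn0 big_nat1 expr0 mulr1 normcR normr1.
  rewrite F0 expr0 invr1; case: M M1 => [|[|//]] _.
    by rewrite /P big_geq// normc0; lra.
  by rewrite /P big_nat1 expr0 mulr1 normcR normr1; lra.
move=> Mn; have [v [x [-> xn v0]]] := splitM Mn.
have /andP[p0 p1] := @pow2V_itv R n; have kp := kap_le n.
have k0 : 0 < kap n := block_weight_gt0 n.
have Fn := F_ge0 n; rewrite step.
move: p0 p1 kp; have := IHn x xn; set p := 2 ^- n => xp p0 p1 kp.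
have [{v0} v0|{v0} v0] := posnP v.
  rewrite v0 partial_sum// /A big_geq// mul0r add0r /block_coef eqxx expr0 !mul1r.
  apply: (le_trans xp); have [Zn|Zn] := boolP (zero n).
    have /le_trans : F n <= F n.+1.
      apply: le_trans (F_zero Zn); rewrite ler_peMl// lerDl divr_ge0// mulr_ge0//.
      exact: ltW.
    by move=> h; apply: ler_pM => //; [lra|lra|exact: h].
  apply: (@le_trans _ _ ((8 - 4 * (p / 2)) * ((1 - 2 * kap n) * F n))); last first.
    by apply: ler_wpM2l; [lra|exact: F_free].
  rewrite [leRHS]mulrA; apply: ler_wpM2r => //; nra.
rewrite partial_sum//; apply: (le_trans (le_normcD _ _)); rewrite normcM -/(F n).
apply: (@le_trans _ _ (normc (A n v) * F n + kap n * (8 * F n))).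
  apply: lerD => //; apply: (le_trans (coef_le _ _ v0)); apply: ler_wpM2l; first exact: ltW.
  by apply: (le_trans xp); apply: ler_wpM2r => //; lra.
rewrite mulrA -mulrDl; have [Zn|Zn] := boolP (zero n).
  apply: (@le_trans _ _ (4 * ((1 + kap n * (block_count n).-1%:R / 2) * F n))).
    rewrite mulrA; apply: ler_wpM2r => //; have := A_le n v.
    have : 0 <= kap n * (block_count n).-1%:R by rewrite mulr_ge0// ltW.
    by lra.
  apply: ler_pM => //; last exact: F_zero.
    by rewrite mulr_ge0// addr_ge0// divr_ge0// mulr_ge0// ltW.
  by lra.
apply: (@le_trans _ _ (4 * ((1 - 2 * kap n) * F n))).
  rewrite mulrA; apply: ler_wpM2r => //.
  have := A_free Zn v0; have := le_normcD (A n v - 1) 1; rewrite subrK normc1.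
  by lra.
apply: ler_pM => //; last exact: F_free.
  by rewrite mulr_ge0//; lra.
by lra.
Qed.

(** The decreasing prefactor absorbs the losses [1 - 2 * kap n] at the free blocks. *)
Let F_ge n : (1 + 2 ^- n) / 2 * 2 ^+ zero_gain n <= F n.
Proof.
elim: n => [|n IHn].
  rewrite /zero_gain big_ord0 expr0 invr1 mulr1.
  by rewrite /F /P /block_start big_ord0 expn0 big_nat1 expr0 mulr1 normcR normr1; lra.
have /andP[p0 p1] := @pow2V_itv R n; have kp := kap_le n.
have k0 : 0 < kap n := block_weight_gt0 n.
rewrite step zero_gainS.
have W0 : 0 < 2 ^+ zero_gain n :> R by rewrite exprn_gt0.
case: ifPn => Zn; last first.
  rewrite addn0; apply: le_trans (F_free Zn).
  apply: (@le_trans _ _ ((1 - 2 * kap n) * ((1 + 2 ^- n) / 2 * 2 ^+ zero_gain n))).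
    rewrite mulrA; apply: ler_wpM2r; first exact: ltW.
    move: p0 p1 kp; set p := 2 ^- n => p0 p1 kp; nra.
  by apply: ler_wpM2l => //; lra.
apply: le_trans (F_zero Zn); rewrite exprD.
have -> : (1 + 2 ^- n / 2) / 2 * (2 ^+ zero_gain n * 2 ^+ (half_len n - n - 1)) =
    2 ^+ (half_len n - n - 1) * ((1 + 2 ^- n / 2) / 2 * 2 ^+ zero_gain n) :> R by ring.
apply: ler_pM.
- by rewrite exprn_ge0.
- by rewrite mulr_ge0 ?exprn_ge0//; lra.
- have -> : 2 ^+ (half_len n - n - 1) = kap n * (block_count n)%:R / 2 :> R.
    rewrite /kap /block_weight /block_count natrX.
    set c := (half_len n - n - 1)%N.
    have -> : half_len n = (c + n + 1)%N by rewrite /c /half_len; nia.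
    apply: (@mulfI _ (2 ^+ (c + n + 1 + n) * 2)); first by rewrite mulf_neq0// expf_neq0.
    rewrite [RHS](_ : _ = 2 ^+ (2 * (c + n + 1))).
      by rewrite -exprSr -exprD; congr (_ ^+ _); lia.
    by field; rewrite expf_neq0.
  have : (0 < block_count n)%N by rewrite expn_gt0.
  move=> /prednK {1}<-; rewrite -natr1; have := block_weight_le1 n; rewrite -/(kap n).
  by move: ((block_count n).-1%:R : R) => y ?; lra.
- apply: le_trans IHn; apply: ler_wpM2r; first exact: ltW.
  by lra.
Qed.

(** At least one full copy of the first [n] factors is present, and the incomplete copy is at most
    [F n / 4], too small to cancel it. The gain of block [n] is left out, since [M] may stop near
    its beginning. *)
Lemma lacunary_partial_ge n M :
  (2 ^ block_start n <= M <= 2 ^ block_start n.+1)%N ->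
  2 ^+ zero_gain n / 4 <= normc (\sum_(0 <= u < M) (freq_coef u)%:C * w ^+ u).
Proof.
move=> /andP[nM Mn].
have -> : \sum_(0 <= u < M) (freq_coef u)%:C * w ^+ u = P n.+1 M.
  apply: eq_big_nat => u /andP[_ uM]; rewrite (@freq_coefE _ n.+1)//.
  exact: leq_trans Mn.
have [v [x [Mv xn v0]]] := splitM Mn; move: v0; rewrite ltnNge nM => /negbT.
rewrite -lt0n => v0; rewrite Mv partial_sum//.
have /andP[p0 p1] := @pow2V_itv R n; have kp := kap_le n.
have k0 : 0 < kap n := block_weight_gt0 n; have k1 := block_weight_le1 n.
apply: le_trans (lerB_normcD _ _); rewrite normcM -/(F n).
have h1 : normc ((block_coef n v)%:C * z n ^+ v * P n x) <= kap n * (8 * F n).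
  apply: (le_trans (coef_le _ _ v0)); apply: ler_wpM2l; first exact: ltW.
  by apply: (le_trans (partial_le xn)); apply: ler_wpM2r => //; lra.
have h2 : 1 - 2 * kap n <= normc (A n v).
  have [Zn|Zn] := boolP (zero n).
    apply: le_trans (ler_Re_normc _); apply: le_trans (A_zero_ge Zn v0).
    have : 0 <= kap n * (minn v (block_count n)).-1%:R / 2.
      by rewrite divr_ge0// mulr_ge0// ltW.
    by lra.
  have := A_free Zn v0; rewrite normcB => h.
  by have := lerB_normcD (1 : R[i]) (- A n v); rewrite normc1 normcN; lra.
have h3 : (1 - 2 * kap n) * F n <= normc (A n v) * F n by exact: ler_wpM2r.
have h4 : 2 ^+ zero_gain n / 2 <= F n.
  apply: le_trans (F_ge n); rewrite mulrC; apply: ler_wpM2r; first exact: exprn_ge0.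
  by lra.
have h5 : kap n * F n <= 1 / 32 * F n by apply: ler_wpM2r => //; exact: block_weight_le1.
have := F_ge0 n; lra.
Qed.

End LacunaryProduct.

(** * Cantor sets *)

Section CantorMap.
Context {R : realType}.
Variable om : R.
Hypothesis om01 : 0 <= om < 1.

Local Notation a n := ((block_start n)%:R : R).
Local Notation l n := ((block_len n)%:R : R).

(* Total length of the zero blocks among the first [n] ones, chosen greedily so
   that their proportion tends to [om] while their number tends to infinity. *)
Fixpoint zero_len (n : nat) : nat :=
  if n is n'.+1 then
    (zero_len n' + if ((zero_len n')%:R < om * a n' + l n' + n'%:R)%R then block_len n' else 0)%N
  else 0%N.

Definition zero_block n : bool := (zero_len n)%:R < om * a n + l n + n%:R.

Lemma zero_lenS n :
  zero_len n.+1 = (zero_len n + if zero_block n then block_len n else 0)%N.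
Proof. by []. Qed.

Let aS n : a n.+1 = a n + l n.
Proof. by rewrite block_startS natrD. Qed.

Let lE n : l n = 2 * n%:R ^+ 2 + 13.
Proof. by rewrite /block_len /half_len !(natrD, natrM, natrX); ring. Qed.

Let om0 : 0 <= om. Proof. by case/andP: om01. Qed.
Let om1 : om < 1. Proof. by case/andP: om01. Qed.

(** The term in [n] stems from the extra [n] in the greedy threshold. It matters for [om = 0], where
    the product must still dominate [log log N]. *)
Lemma zero_len_ge n : om * a n + (1 - om) * n%:R <= (zero_len n)%:R.
Proof.
elim: n => [|n IHn]; first by rewrite /block_start big_ord0 !mulr0 addr0.
rewrite zero_lenS aS -[n.+1%:R]natr1; have n0 : 0 <= n%:R :> R by [].
have l1 : 1 <= l n by rewrite lE; have := sqr_ge0 (n%:R : R); lra.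
have h0 := om0; have h1 := om1.
have p1 : 0 <= (1 - om) * (l n - 1) by rewrite mulr_ge0//; lra.
case: ifPn => [_|]; first by rewrite natrD; lra.
rewrite /zero_block -leNgt addn0 => h.
by have := mulr_ge0 h0 n0; nra.
Qed.

Lemma zero_len_le n : (zero_len n)%:R <= om * a n + 2 * l n + n%:R.
Proof.
elim: n => [|n IHn].
  by rewrite /block_start big_ord0 mulr0 addr0 add0r mulr_ge0.
rewrite zero_lenS aS -[n.+1%:R]natr1; have n0 : 0 <= n%:R :> R by [].
have h0 := om0; have h1 := om1.
have l0 : 0 <= l n by [].
have ll : l n <= l n.+1 by rewrite !lE -natr1; nra.
have := mulr_ge0 h0 l0; case: ifPn => [|_]; last by rewrite addn0; lra.
by rewrite /zero_block natrD; lra.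
Qed.

(** A zero block falls short of half its length by a linear amount, as [block_len i - 2 * (half_len
    i - i - 1) = 2 * i + 5]; the sum is quadratic. *)
Lemma zero_gain_ge_len n :
  (zero_len n)%:R <= 2 * (zero_gain zero_block n)%:R + n%:R ^+ 2 + 4 * n%:R :> R.
Proof.
rewrite -natrX -!natrM -!natrD ler_nat.
elim: n => [//|n IHn]; rewrite zero_lenS zero_gainS /block_len /half_len.
case: ifP => _; move: IHn; rewrite ?expnS ?expn0; nia.
Qed.

(** A purely multiplicative form, which survives for [om = 0]: there the lower bound for the zero
    length is only [n], and a quadratic deficit would swamp it. *)
Lemma zero_gain_ge_len8 n : (zero_len n <= 8 * zero_gain zero_block n)%N.
Proof.
elim: n => [//|n IHn]; rewrite zero_lenS zero_gainS /block_len /half_len.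
case: ifP => _; move: IHn; rewrite ?expnS ?expn0; nia.
Qed.

Lemma cube_le_a n : n%:R ^+ 3 / 3 <= a n.
Proof.
rewrite ler_pdivrMr// -natrX mulrC -natrM ler_nat; exact: cube_le_block_start.
Qed.

Lemma sqr_le_block_start (c eta : R) : 0 <= c -> 0 < eta ->
  exists2 K : R, 0 <= K & forall n, c * n%:R ^+ 2 <= eta * a n + K.
Proof.
move=> c0 eta0; exists (c * (3 * c / eta) ^+ 2).
  by rewrite mulr_ge0// sqr_ge0.
move=> n; have n0 : 0 <= n%:R :> R by [].
have a3 := cube_le_a n.
have [nc|cn] := leP (n%:R) (3 * c / eta).
  apply: ler_wpDl; first by rewrite mulr_ge0// ltW.
  by apply: ler_wpM2l => //; rewrite lerXn2r ?nnegrE// (le_trans n0 nc).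
apply: ler_wpDr; first by rewrite mulr_ge0// sqr_ge0.
move: cn; rewrite ltr_pdivrMr// -subr_gt0 => cn.
apply: (@le_trans _ _ (eta * (n%:R ^+ 3 / 3))); last by rewrite ler_pM2l.
rewrite [n%:R ^+ 3]exprS.
have := sqr_ge0 (n%:R : R); move: (n%:R ^+ 2 : R) => q q0.
by have := mulr_ge0 q0 (ltW cn); lra.
Qed.

(** The two leading digits of a free block are reserved: they are 01, which keeps the tail between
    1/4 and 1/2. *)
Definition free_bits n : nat := (if zero_block n then 0 else block_len n - 2)%N.

Definition bit_start n : nat := (\sum_(i < n) free_bits i)%N.

Lemma bit_startS n : bit_start n.+1 = (bit_start n + free_bits n)%N.
Proof. by rewrite /bit_start big_ord_recr. Qed.

Lemma bit_start_ge n : (1 - om) * a n - 2 * l n - 3 * n%:R <= (bit_start n)%:R.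
Proof.
have : (block_start n <= bit_start n + zero_len n + 2 * n)%N.
  elim: n => [|n IHn]; first by rewrite /block_start big_ord0.
  rewrite block_startS bit_startS zero_lenS /free_bits; case: ifP => _; lia.
rewrite -(@ler_nat R) 2!natrD natrM; have := zero_len_le n; lra.
Qed.

Lemma bit_start_ge_block s : s < 1 - om ->
  exists K : R, forall n, s * a n.+1 - K <= (bit_start n)%:R.
Proof.
move=> som; wlog s0 : s som / 0 <= s.
  move=> H; have [|s0] := leP 0 s; first exact: H.
  have [||K KP] := H 0 => //; first by have := om1; lra.
  exists K => n; apply: le_trans (KP n); rewrite lerD2r mul0r.
  by rewrite mulr_le0_ge0// ltW.
have [||K K0 KP] := @sqr_le_block_start 9 (1 - om - s) => //; first by lra.
exists (K + 39) => n; have := bit_start_ge n; have := KP n; rewrite aS lE.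
have n0 : 0 <= n%:R :> R by [].
have n1 : n%:R <= n%:R ^+ 2 :> R by rewrite -natrX ler_nat leq_id_sqr.
have a0 : 0 <= a n by [].
have s1 : s <= 1 by have := om0; lra.
have : s * (2 * n%:R ^+ 2 + 13) <= 2 * n%:R ^+ 2 + 13.
  by rewrite ler_piMl// addr_ge0// mulr_ge0// sqr_ge0.
by lra.
Qed.

Lemma bit_start_large (B : R) : exists n, B < (bit_start n)%:R.
Proof.
have h1 := om1; pose s := (1 - om) / 2.
have [|K KP] := @bit_start_ge_block s; first by rewrite /s; lra.
have s0 : 0 < s by rewrite /s; lra.
have BK : 0 <= (`|B| + `|K|) / s by rewrite divr_ge0 ?addr_ge0// ltW.
exists (Num.bound ((`|B| + `|K|) / s)); set n := Num.bound _.
apply: lt_le_trans (KP n); have := archi_boundP BK; rewrite -/n ltr_pdivrMr// => nn.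
have na : n%:R <= a n.+1 by rewrite ler_nat (leq_trans (leqnSn n))// leq_id_block_start.
have : s * n%:R <= s * a n.+1 by rewrite ler_pM2l.
have := ler_norm B; have := ler_norm K; lra.
Qed.

Lemma exists_free_block : exists i, ~~ zero_block i.
Proof.
have [n] := bit_start_large 0; rewrite ltr0n /bit_start => n0.
apply: contrapT => H; move: n0; rewrite big1// => i _.
rewrite /free_bits ifT//; apply: contrapT => Zi; apply: H; exists i; exact/negP.
Qed.

(** * Digits of a parameter and its Cantor point *)

Section Digits.
Variable x : R.

(** Halving [x] treats the endpoint [x = 1] like the others: the integer part of [x / 2] is always
    0. *)
Definition bit_prefix n : nat := Num.truncn (2 ^+ bit_start n * (x / 2)).

Definition digit n : nat :=
  if zero_block n then 0%N
  else (2 ^ (block_len n - 2) + (bit_prefix n.+1 - 2 ^ free_bits n * bit_prefix n))%N.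

Fixpoint block_prefix n : nat :=
  if n is n'.+1 then (block_prefix n' * 2 ^ block_len n' + digit n')%N else 0%N.

Definition cantor_point : R :=
  sup [set (block_prefix n)%:R / 2 ^+ block_start n | n in [set: nat]].

Hypothesis x01 : 0 <= x <= 1.

Lemma bit_prefix_itv n :
  (bit_prefix n)%:R <= 2 ^+ bit_start n * (x / 2) < (bit_prefix n).+1%:R.
Proof.
apply: truncn_itv; case/andP: x01 => x0 _.
by rewrite mulr_ge0 ?exprn_ge0// divr_ge0.
Qed.

Lemma bit_prefixS n : (2 ^ free_bits n * bit_prefix n <= bit_prefix n.+1
  < 2 ^ free_bits n * (bit_prefix n).+1)%N.
Proof.
have /andP[h1 h2] := bit_prefix_itv n; have /andP[h3 h4] := bit_prefix_itv n.+1.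
have p0 : 0 < 2 ^+ free_bits n :> R by rewrite exprn_gt0.
move: h3 h4; rewrite bit_startS exprD mulrAC mulrC => h3 h4.
apply/andP; split.
  rewrite -ltnS -(@ltr_nat R); apply: le_lt_trans h4.
  by rewrite natrM natrX ler_pM2l.
rewrite -(@ltr_nat R); apply: (le_lt_trans h3).
by rewrite natrM natrX ltr_pM2l.
Qed.

Lemma digit_zero n : zero_block n -> digit n = 0%N.
Proof. by rewrite /digit => ->. Qed.

Lemma digit_free n : ~~ zero_block n ->
  (2 ^ (block_len n - 2) <= digit n < 2 ^ (block_len n - 1))%N.
Proof.
rewrite /digit => /[dup] Zn /negbTE ->; rewrite leq_addr/=.
have -> : (block_len n - 1 = (block_len n - 2).+1)%N by rewrite /block_len; lia.
have := bit_prefixS n; rewrite /free_bits (negbTE Zn) expnS.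
set p := (2 ^ _)%N; nia.
Qed.

Lemma digit_lt n : (digit n < 2 ^ (block_len n - 1))%N.
Proof.
have [Zn|Zn] := boolP (zero_block n); first by rewrite digit_zero// expn_gt0.
by have /andP[] := digit_free Zn.
Qed.

Lemma digit_lt_len n : (digit n < 2 ^ block_len n)%N.
Proof. by apply: (leq_trans (digit_lt n)); rewrite leq_exp2l// leq_subr. Qed.

Let q n : R := (block_prefix n)%:R / 2 ^+ block_start n.

Let pow_gt0 n : 0 < 2 ^+ n :> R. Proof. by rewrite exprn_gt0. Qed.

Let qS n : q n <= q n.+1 /\ q n.+1 + 2 ^- block_start n.+1 <= q n + 2 ^- block_start n.
Proof.
rewrite /q /= block_startS exprD natrD natrM natrX.
have := digit_lt_len n; rewrite -(@ler_nat R) -natr1 natrX.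
have := pow_gt0 (block_start n); have := pow_gt0 (block_len n).
set A := 2 ^+ block_start n; set L := 2 ^+ block_len n; set D := (digit n)%:R => L0 A0.
have D0 : 0 <= D by [].
set T := _%:R => DL.
have -> : (T * L + D) / (A * L) = T / A + D / (A * L) by field; rewrite !gt_eqF.
split; first by rewrite lerDl divr_ge0// mulr_ge0// ltW.
rewrite -addrA lerD2l -[X in _ + X]mul1r -mulrDl ler_pdivrMr ?mulr_gt0//.
by rewrite mulKf ?gt_eqF.
Qed.

Let q_mono m n : (m <= n)%N ->
  q m <= q n /\ q n + 2 ^- block_start n <= q m + 2 ^- block_start m.
Proof.
elim: n => [|n IHn]; first by rewrite leqn0 => /eqP ->.
rewrite leq_eqVlt ltnS => /orP[/eqP->//|/IHn[h1 h2]].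
by have [h3 h4] := qS n; split; [exact: le_trans h3|exact: le_trans h2].
Qed.

Lemma cantor_point_itv n :
  (block_prefix n)%:R <= 2 ^+ block_start n * cantor_point <= (block_prefix n)%:R + 1.
Proof.
have qub m k : q m <= q k + 2 ^- block_start k.
  have [km|/ltnW mk] := leqP k m.
    have [_] := q_mono km; apply: le_trans.
    by rewrite lerDl invr_ge0 exprn_ge0.
  have [h _] := q_mono mk; apply: (le_trans h).
  by rewrite lerDl invr_ge0 exprn_ge0.
have hs : has_sup [set q n | n in [set: nat]].
  split; first by exists (q 0); exists 0%N.
  by exists (q 0 + 2 ^- block_start 0) => _ [m _ <-].
have A0 := pow_gt0 (block_start n).
apply/andP; split.
  rewrite -ler_pdivrMl// mulrC.
  by apply: ub_le_sup; [exact: hs.2|exists n].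
rewrite -ler_pdivlMl// mulrDr mulr1 mulrC.
by apply: ge_sup; [exact: hs.1|move=> _ [m _ <-]; exact: qub].
Qed.

Definition cantor_tail n : R := 2 ^+ block_start n * cantor_point - (block_prefix n)%:R.

Lemma cantor_tailS n : 2 ^+ block_len n * cantor_tail n = (digit n)%:R + cantor_tail n.+1.
Proof.
rewrite /cantor_tail /= block_startS exprD natrD natrM natrX; ring.
Qed.

Lemma cantor_tail_itv n : 0 <= cantor_tail n <= 1.
Proof.
by have /andP[h1 h2] := cantor_point_itv n; rewrite /cantor_tail; apply/andP; split; lra.
Qed.

(** Every block starts with the digit 0. The resulting gaps separate points with different prefixes,
    and on a free block they help to make the cosine of the angle nonpositive. *)
Lemma cantor_tail_le n : cantor_tail n <= 1 / 2.
Proof.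
have := cantor_tailS n; have /andP[_ h1] := cantor_tail_itv n.+1.
have := digit_lt n; rewrite -(@ler_nat R) -natr1 natrX => h2 h3.
have := pow_gt0 (block_len n); have : 2 ^+ block_len n = 2 * 2 ^+ (block_len n - 1) :> R.
  by rewrite -exprS; congr (_ ^+ _); rewrite /block_len; lia.
by move=> e1 e2; rewrite -(ler_pM2l e2) h3 e1; lra.
Qed.

Lemma cantor_tail_zero n : zero_block n -> cantor_tail n <= 2 ^- block_len n.
Proof.
move=> Zn; rewrite -(ler_pM2l (pow_gt0 (block_len n))) cantor_tailS digit_zero// add0r.
by rewrite divff ?gt_eqF//; have /andP[] := cantor_tail_itv n.+1.
Qed.

Lemma cantor_tail_free n : ~~ zero_block n -> 1 / 4 <= cantor_tail n.
Proof.
move=> Zn; rewrite -(ler_pM2l (pow_gt0 (block_len n))) cantor_tailS.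
have /andP[h _] := digit_free Zn; have /andP[h0 _] := cantor_tail_itv n.+1.
move: h; rewrite -(@ler_nat R) natrX.
have -> : 2 ^+ block_len n = 4 * 2 ^+ (block_len n - 2) :> R.
  have -> : 4 = 2 ^+ 2 :> R by rewrite expr2; lra.
  by rewrite -exprD; congr (_ ^+ _); rewrite /block_len; lia.
lra.
Qed.

Definition cantor_angle : R := pi *+ 2 * cantor_point.

Lemma cis_cantor n v : cis cantor_angle ^+ (2 ^ block_start n) ^+ v =
  cis (v%:R * (pi *+ 2 * cantor_tail n)).
Proof.
rewrite cisMn -cisMn; congr (_ ^+ _).
have -> : (2 ^ block_start n)%:R * cantor_angle =
    (block_prefix n)%:R * (pi *+ 2) + pi *+ 2 * cantor_tail n.
  by rewrite /cantor_angle /cantor_tail natrX; ring.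
by rewrite cisD cis2pi mul1r.
Qed.

Let pi_lt4 : pi < 4 :> R.
Proof. by have := @pihalf_lt2 R; lra. Qed.

Lemma cantor_zeroP i v : zero_block i -> (v < block_count i)%N ->
  1 / 2 <= complex.Re (cis cantor_angle ^+ (2 ^ block_start i) ^+ v).
Proof.
move=> Zi vV; rewrite cis_cantor /=.
set y := v%:R * _; suff : 0 <= y <= 1.
  move=> /andP[y0 y1]; apply: le_trans (cos_ge y); rewrite expr2.
  have : y * y <= 1 by rewrite mulr_ile1.
  by lra.
have t1 := cantor_tail_zero Zi; have /andP[t0 _] := cantor_tail_itv i.
have p0 := @pi_ge0 R; have p4 := pi_lt4.
have y0 : 0 <= y by rewrite mulr_ge0// mulr_ge0// mulrn_wge0.
rewrite y0 /y /=.
have v1 : v%:R <= 2 ^+ (2 * half_len i) :> R by rewrite -natrX ler_nat ltnW.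
apply: (@le_trans _ _ (2 ^+ (2 * half_len i) * (8 * 2 ^- block_len i))).
  apply: ler_pM => //; first by rewrite mulr_ge0// mulrn_wge0.
  by apply: ler_pM => //; [rewrite mulrn_wge0|rewrite mulr2n; lra].
rewrite /block_len exprD; have -> : 2 ^+ 3 = 8 :> R by rewrite !exprS expr0; lra.
have P0 := pow_gt0 (2 * half_len i).
by rewrite (_ : _ * _ = 1)//; field; rewrite gt_eqF.
Qed.

Lemma cantor_freeP i : ~~ zero_block i ->
  1 <= normc (1 - cis cantor_angle ^+ (2 ^ block_start i)).
Proof.
move=> Zi; have := cis_cantor i 1; rewrite expr1 mul1r => ->.
apply: le_trans (ler_Re_normc _) => /=.
have t1 := cantor_tail_free Zi; have t2 := cantor_tail_le i.
set y := pi *+ 2 * _; suff : cos y <= 0 by lra.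
have p0 := @pi_gt0 R.
have -> : y = (y - pi / 2) + pi / 2 by rewrite subrK.
rewrite cosDpihalf oppr_le0; apply: sin_ge0_pi.
have h1 : pi * (1 / 4) <= pi * cantor_tail i by rewrite ler_pM2l.
have h2 : pi * cantor_tail i <= pi * (1 / 2) by rewrite ler_pM2l.
by rewrite /y mulr2n mulrDl; apply/andP; split; lra.
Qed.

End Digits.

Lemma eq_block_prefix x y n : 0 <= x <= 1 -> 0 <= y <= 1 ->
  block_prefix x n = block_prefix y n -> bit_prefix x n = bit_prefix y n.
Proof.
move=> x01 y01; have lt1 (z : R) : 0 <= z <= 1 -> bit_prefix z 0 = 0%N.
  move=> z01; have /andP[h _] := bit_prefix_itv z01 0; case/andP: z01 => z0 z1.
  rewrite /bit_start big_ord0 expr0 mul1r in h.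
  apply/eqP; rewrite -leqn0 -ltnS -(@ltr_nat R); apply: (le_lt_trans h); lra.
elim: n => [|n IHn] /=; first by rewrite !lt1.
move=> e; have xl := digit_lt_len x01 n; have yl := digit_lt_len y01 n.
have eT : block_prefix x n = block_prefix y n.
  have := congr1 (fun u => u %/ 2 ^ block_len n)%N e.
  by rewrite !divnMDl ?expn_gt0// !divn_small// !addn0.
have eD : digit x n = digit y n.
  have := congr1 (fun u => u %% 2 ^ block_len n)%N e.
  by rewrite !modnMDl !modn_small.
have eN := IHn eT; have /andP[hx1 hx2] := bit_prefixS x01 n.
have /andP[hy1 hy2] := bit_prefixS y01 n; move: eD; rewrite /digit.
case: ifP => Zn; last by rewrite -eN in hy1 hy2 *; lia.
move: hx1 hx2 hy1 hy2; rewrite /free_bits Zn expn0 !mul1n eN; lia.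
Qed.

(** All tails lie in [[0, 1/2]], so points closer than half a cell share their block prefix, with no
    carry between digits; the prefix determines the bits of [x / 2] read so far. *)
Lemma cantor_point_separated x y n : 0 <= x <= 1 -> 0 <= y <= 1 ->
  `|cantor_point x - cantor_point y| < 2 ^- block_start n / 2 ->
  `|x - y| <= 2 * 2 ^- bit_start n.
Proof.
move=> x01 y01 xy; have A0 : 0 < 2 ^+ block_start n :> R by rewrite exprn_gt0.
have B0 : 0 < 2 ^+ bit_start n :> R by rewrite exprn_gt0.
have eT : block_prefix x n = block_prefix y n.
  have := cantor_tail_le x01 n; have := cantor_tail_le y01 n.
  have /andP[x0 _] := cantor_tail_itv x01 n; have /andP[y0 _] := cantor_tail_itv y01 n.
  move: x0 y0; rewrite /cantor_tail => x0 y0 y1 x1.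
  have : `|2 ^+ block_start n * cantor_point x - 2 ^+ block_start n * cantor_point y| < 1 / 2.
    by rewrite -mulrBr normrM gtr0_norm// -ltr_pdivlMl// mul1r.
  rewrite ltr_norml => /andP[d1 d2].
  apply/eqP; rewrite eqn_leq -ltnS -[X in _ && X]ltnS -!(@ltr_nat R) -!natr1.
  by apply/andP; split; lra.
have eN := eq_block_prefix x01 y01 eT.
have /andP[hx1 hx2] := bit_prefix_itv x01 n; have /andP[hy1 hy2] := bit_prefix_itv y01 n.
have : `|2 ^+ bit_start n * (x / 2) - 2 ^+ bit_start n * (y / 2)| <= 1.
  by move: hx1 hx2 hy1 hy2; rewrite eN -[_.+1%:R]natr1 ler_norml => *; apply/andP; split; lra.
rewrite -mulrBr -mulrBl normrM gtr0_norm// normrM (gtr0_norm (x := 2^-1))//.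
by rewrite -ler_pdivlMl// mulr1 ler_pdivrMr// mulrC.
Qed.

(** The parameters are compared at the start of block [n], their images at its end. This shift is
    free: the bits read before block [n] have density [1 - om] even relative to
    [block_start n.+1]. *)
Lemma cantor_point_holder s : 0 <= s < 1 - om ->
  exists2 C : R, 0 <= C & forall x y, 0 <= x <= 1 -> 0 <= y <= 1 ->
    `|x - y| <= C * `|cantor_point x - cantor_point y| `^ s.
Proof.
move=> /andP[s0 som]; have [K KP] := bit_start_ge_block som.
exists (2 `^ (`|K| + s + 1)); first exact: powR_ge0.
move=> x y x01 y01; set d := `|cantor_point x - cantor_point y|.
have h1 := om0.
have xy1 : `|x - y| <= 1.
  by case/andP: x01 => ? ?; case/andP: y01 => ? ?; rewrite ler_norml; apply/andP; split; lra.
have [d0|d0] := eqVneq d 0.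
  have -> : x = y.
    apply/eqP; rewrite -subr_eq0 -normr_le0 leNgt; apply/negP => xy0.
    have [n nP] := bit_start_large (2 / `|x - y|).
    have := @cantor_point_separated x y n x01 y01; rewrite -/d d0.
    rewrite divr_gt0 ?invr_gt0 ?exprn_gt0// => /(_ isT).
    apply/negP; rewrite -ltNge mulrC ltr_pdivrMl ?exprn_gt0// mulrC -ltr_pdivrMl// mulrC.
    apply: (lt_le_trans nP); rewrite -natrX ler_nat; exact/ltnW/ltn_expl.
  by rewrite subrr normr0 mulr_ge0// powR_ge0.
have {d0}d0 : 0 < d by rewrite lt_neqAle eq_sym d0 normr_ge0.
have [d1|d1] := leP (1 / 2) d.
  apply: (le_trans xy1); apply: (@le_trans _ _ (2 `^ (`|K| + s + 1) * (1 / 2) `^ s)).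
    rewrite mul1r -(powR_inv1 (a := 2))// -powRrM mulN1r -powRD; last by rewrite pnatr_eq0 implybT.
    rewrite -[leLHS](powRr0 (2 : R)); apply: ler_powR; first by lra.
    by have := normr_ge0 K; lra.
  apply: ler_wpM2l; first exact: powR_ge0.
  by apply: ge0_ler_powR => //; rewrite nnegrE ?ltW.
have [n nP] : exists n, 2 ^- block_start n.+1 / 2 <= d < 2 ^- block_start n / 2.
  have ex : exists n, 2 ^- block_start n / 2 <= d.
    exists (Num.bound d^-1); have dV : 0 <= d^-1 by rewrite invr_ge0 ltW.
    rewrite ler_pdivrMr// -[leRHS]invrK lef_pV2 ?posrE ?invr_gt0 ?mulr_gt0 ?exprn_gt0//.
    rewrite invfM; apply: (@le_trans _ _ d^-1); first by rewrite ler_piMr// invf_le1//; lra.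
    apply: (le_trans (ltW (archi_boundP dV))); rewrite -natrX ler_nat.
    by rewrite ltnW// (leq_trans (ltn_expl _ (isT : (1 < 2)%N)))// leq_exp2l// leq_id_block_start.
  case: (ex_minnP ex) => -[|m] mP mmin.
    by move: mP; rewrite /block_start big_ord0 expr0 invr1 leNgt d1.
  exists m; rewrite mP/= ltNge; apply/negP => /mmin; by rewrite ltnn.
have /andP[n1 n2] := nP.
apply: (le_trans (cantor_point_separated x01 y01 n2)).
apply: (@le_trans _ _ (2 `^ (`|K| + s + 1) * (2 ^- block_start n.+1 / 2) `^ s)); last first.
  apply: ler_wpM2l; first exact: powR_ge0.
  by apply: ge0_ler_powR => //; rewrite nnegrE ?ltW// divr_gt0// invr_gt0 exprn_gt0.
have -> : 2 ^- block_start n.+1 / 2 = 2 `^ (- (a n.+1 + 1)) :> R.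
  by rewrite powRN powRD ?pnatr_eq0 ?implybT// powRr1// powR_mulrn// invfM.
rewrite -powRrM -powRD; last by rewrite pnatr_eq0 implybT.
have -> : 2 * 2 ^- bit_start n = 2 `^ (1 - (bit_start n)%:R) :> R.
  by rewrite powRB ?pnatr_eq0 ?implybT// powRr1// powR_mulrn.
apply: ler_powR; first by lra.
have := KP n; have := ler_norm K; lra.
Qed.

End CantorMap.

(** * The saturating series *)

Section SaturatingSeries.
Context {R : realType}.

Lemma sum_dyadic_blocks (V : nmodType) (G : nat -> V) (m : nat) :
  \sum_(1 <= k < 2 ^ m) G k =
  \sum_(0 <= u < m) \sum_(2 ^ u <= k < 2 ^ u.+1) G k.
Proof.
elim: m => [|m IHm]; first by rewrite expn0 !big_geq.
rewrite [RHS]big_nat_recr//= -IHm -big_cat_nat//= ?expn_gt0//.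
by rewrite leq_exp2l.
Qed.

Lemma trunc_log_block u k : (2 ^ u <= k < 2 ^ u.+1)%N -> trunc_log 2 k = u.
Proof. by move=> /andP[h1 h2]; apply: trunc_log_eq => //; rewrite h1. Qed.

Lemma sum_inv_block_le (u n : nat) : (n <= 2 ^ u.+1)%N ->
  \sum_(2 ^ u <= k < n) k%:R^-1 <= 1 :> R.
Proof.
move=> nu; apply: (@le_trans _ _ (\sum_(2 ^ u <= k < n) (2 ^+ u)^-1)).
  apply: ler_sum_nat => k /andP[uk _]; rewrite lef_pV2 ?posrE ?exprn_gt0//.
    by rewrite -natrX ler_nat.
  by rewrite ltr0n (leq_trans _ uk)// expn_gt0.
rewrite sumr_const_nat -[leLHS]mulr_natl ler_pdivrMr ?exprn_gt0// mul1r -natrX ler_nat.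
by move: nu; rewrite expnS; lia.
Qed.

(** A dyadic block contributes at most [freq_coef u ^ 2] to the squared norm, because [1 / k] sums
    to at most 1 over it. *)
Definition sat_coef (k : nat) : R[i] :=
  if k == 0%N then 0 else (freq_coef (trunc_log 2 k) * k%:R `^ (- 2^-1))%:C.

Lemma powR_half_sqr (k : nat) : (0 < k)%N ->
  k%:R `^ (- 2^-1) * k%:R `^ (- 2^-1) = k%:R^-1 :> R.
Proof.
move=> k0; rewrite -powRD; last by rewrite pnatr_eq0 gtn_eqF ?implybT.
by rewrite (_ : - 2^-1 + - 2^-1 = -1) ?powR_inv1//; lra.
Qed.

Lemma sat_coef_hardy2 : sat_coef \in @hardy2_pred R.
Proof.
apply/andP; split; first by rewrite /sat_coef eqxx.
apply: (@le_lt_trans _ _ 4%:E); last exact: ltry.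
apply: lime_le; first by apply: is_cvg_nneseries => k _ _; rewrite lee_fin sqr_ge0.
apply: nearW => n; rewrite sumEFin lee_fin.
apply: (@le_trans _ _ (\sum_(1 <= k < 2 ^ n) normc (sat_coef k) ^+ 2)).
  have [n1|n1] := leqP n 1; first by rewrite big_geq// sumr_ge0// => *; exact: sqr_ge0.
  rewrite [leRHS](@big_cat_nat _ _ _ n)//=; last 2 first.
  - exact: ltnW.
  - exact/ltnW/ltn_expl.
  by rewrite lerDl sumr_ge0// => *; exact: sqr_ge0.
rewrite sum_dyadic_blocks; apply: le_trans (sum_sqr_freq_coef n).
apply: ler_sum_nat => u _.
rewrite (eq_big_nat _ _ (F2 := fun k => freq_coef u ^+ 2 * k%:R^-1)); last first.
  move=> k ku; have k0 : (0 < k)%N.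
    by case/andP: ku => uk _; rewrite (leq_trans _ uk)// expn_gt0.
  rewrite /sat_coef gtn_eqF// (trunc_log_block ku) normcR real_normK ?num_real//.
  by rewrite exprMn [X in _ * X]expr2 powR_half_sqr.
rewrite -mulr_sumr ler_piMr ?sqr_ge0//; exact: sum_inv_block_le.
Qed.

Definition sat_series : hardy2 R := Hardy2 sat_coef_hardy2.

Lemma sat_series_term t k : (0 < k)%N ->
  sat_series k * dirichlet_monomial t k =
  (freq_coef (trunc_log 2 k))%:C * ((k%:R^-1)%:C * cis (t * ln k%:R)).
Proof.
move=> k0; rewrite /= /sat_coef gtn_eqF// /dirichlet_monomial -/(cis _).
by rewrite -(powR_half_sqr k0) !rmorphM/=; ring.
Qed.

Lemma dirichlet_sum_sat t N : (0 < N)%N ->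
  dirichlet_sum sat_series t N =
  \sum_(0 <= u < trunc_log 2 N) (freq_coef u)%:C * inv_sum t (2 ^ u) (2 ^ u.+1) +
  (freq_coef (trunc_log 2 N))%:C * inv_sum t (2 ^ trunc_log 2 N) N.+1.
Proof.
move=> N0; set M := trunc_log 2 N.
have /andP[MN NM] : (2 ^ M <= N < 2 ^ M.+1)%N by exact: trunc_log_bounds.
rewrite /dirichlet_sum (@big_cat_nat _ _ _ (2 ^ M))//=; last 2 first.
- by rewrite expn_gt0.
- exact: leqW.
rewrite sum_dyadic_blocks; congr (_ + _).
  apply: eq_bigr => u _; rewrite /inv_sum mulr_sumr; apply: eq_big_nat => k ku.
  have k0 : (0 < k)%N.
    by case/andP: ku => uk _; rewrite (leq_trans _ uk)// expn_gt0.
  by rewrite sat_series_term// (trunc_log_block ku).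
rewrite /inv_sum mulr_sumr; apply: eq_big_nat => k /andP[Mk kN].
have k0 : (0 < k)%N by rewrite (leq_trans _ Mk)// expn_gt0.
rewrite sat_series_term// (@trunc_log_block M)// Mk/=.
exact: leq_trans kN NM.
Qed.

(** Multiplication by [it] turns the kernel over a full dyadic block into [(w - 1) * w ^ u] up to a
    multiple of [2 ^- u]. The errors sum to [4 * (|t| + 2 * t ^ 2)] and the incomplete last block
    costs [|t|], whence 5 and 8. *)
Lemma sat_sum_ge t N : (0 < N)%N ->
  normc (cis (t * ln 2) - 1) *
    normc (\sum_(0 <= u < trunc_log 2 N) (freq_coef u)%:C * cis (t * ln 2) ^+ u)
    - (5 * `|t| + 8 * t ^+ 2) <= `|t| * normc (dirichlet_sum sat_series t N).
Proof.
move=> N0; rewrite dirichlet_sum_sat//; set M := trunc_log 2 N; set w := cis (t * ln 2).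
have /andP[MN NM] : (2 ^ M <= N < 2 ^ M.+1)%N by exact: trunc_log_bounds.
set B := \sum_(0 <= u < M) (freq_coef u)%:C * inv_sum _ _ _.
set L := (freq_coef M)%:C * _.
have wE u : cis (t * ln (2 ^ u)%N%:R) = w ^+ u.
  rewrite -cisMn natrX lnXn// -[ln 2 *+ u]mulr_natl; congr cis; ring.
have nti : `|t| = normc ('i * t%:C) :> R.
  by rewrite normcM normcR /= expr0n expr1n add0r sqrtr1 mul1r.
have hB : normc ('i * t%:C * B - (w - 1) * \sum_(0 <= u < M) (freq_coef u)%:C * w ^+ u) <=
    (`|t| + 2 * t ^+ 2) * 4.
  rewrite /B !mulr_sumr -sumrB; apply: (le_trans (normc_sum _ _ _)).
  apply: (@le_trans _ _ (\sum_(0 <= u < M) (`|t| + 2 * t ^+ 2) * (2 * 2^-1 ^+ u))).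
    apply: ler_sum_nat => u _.
    have -> : 'i * t%:C * ((freq_coef u)%:C * inv_sum t (2 ^ u) (2 ^ u.+1)) -
        (w - 1) * ((freq_coef u)%:C * w ^+ u) =
        (freq_coef u)%:C * ('i * t%:C * inv_sum t (2 ^ u) (2 ^ u.+1) -
        (cis (t * ln (2 ^ u.+1)%N%:R) - cis (t * ln (2 ^ u)%N%:R))).
      by rewrite !wE exprS; ring.
    have /andP[f0 f1] := @product_coef_itv R u u.
    rewrite normcM normcR ger0_norm//; apply: (@le_trans _ _ (1 * normc
      ('i * t%:C * inv_sum t (2 ^ u) (2 ^ u.+1) -
        (cis (t * ln (2 ^ u.+1)%N%:R) - cis (t * ln (2 ^ u)%N%:R))))).
      by apply: ler_wpM2r; first exact: normc_ge0.
    rewrite mul1r exprVn -natrX; apply: inv_sum_approx; first by rewrite expn_gt0.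
    by rewrite leq_exp2l.
  rewrite -!mulr_sumr; apply: ler_wpM2l.
    by rewrite addr_ge0// mulr_ge0// sqr_ge0.
  have r01 : 0 < (2^-1 : R) < 1 by apply/andP; split; lra.
  have := @sum_geometric_le R 2^-1 0 M r01; rewrite expr0.
  have -> : 1 / (1 - 2^-1) = 2 :> R by field.
  by lra.
have hL : normc L <= 1.
  have /andP[f0 f1] := @product_coef_itv R M M.
  rewrite /L normcM normcR ger0_norm// mulr_ile1 ?normc_ge0//.
  apply: (le_trans (normc_sum _ _ _)); apply: le_trans (sum_inv_block_le NM).
  by apply: ler_sum => k _; rewrite normcM normc_cis mulr1 normcR ger0_norm.
rewrite nti -normcM -normcM mulrDr; set X := (w - 1) * _ in hB *.
set Y := 'i * t%:C * B in hB *.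
have h1 := lerB_normcD (X + (Y - X)) ('i * t%:C * L).
have h2 := lerB_normcD X (Y - X).
have h3 : normc ('i * t%:C * L) <= `|t|.
  by rewrite normcM -nti ler_piMr.
rewrite (_ : X + (Y - X) = Y) in h1 h2; last by ring.
rewrite -nti; lra.
Qed.

Lemma block_start_le n : (block_start n <= 13 * n ^ 3)%N.
Proof.
elim: n => [|n IHn]; first by rewrite /block_start big_ord0.
rewrite block_startS /block_len /half_len; move: IHn; rewrite !expnS !expn0; nia.
Qed.

Lemma gain_beats_block_start (y : nat -> nat) (K : R) :
  (forall n, (n <= 8 * y n)%N) ->
  exists n0 : nat, forall n, (n0 <= n)%N -> K * (block_start n.+1)%:R <= 2 ^+ y n.
Proof.
(* Half of the rate 1/8: [block_start n.+1] is bounded by a multiple of [n.+1 ^ 4], the square of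
   what [sqr_geometric] controls. *)
move=> ny; set q : R := 2 `^ (- (16^-1)).
have q01 : 0 < q < 1.
  rewrite powR_gt0//= /q /powR gt_eqF// expR_lt1 nmulr_rlt0 ?oppr_lt0//.
  by rewrite ln_gt0//; lra.
have [C [r [C0 r01 Cr]]] := sqr_geometric q01.
have K0 : 0 < (13 * (`|K| + 1) * C ^+ 2)^-1.
  by rewrite invr_gt0 !mulr_gt0 ?exprn_gt0// ltr_wpDl.
have [n0 n0P] := geometric_small r01 K0.
exists n0 => n nn.
have qn : q ^+ n * q ^+ n * 2 ^+ y n >= 1.
  have -> : q ^+ n * q ^+ n = 2 `^ (- (n%:R / 8)).
    rewrite -!powR_mulrn ?powR_ge0// -!powRrM -powRD; last by rewrite pnatr_eq0 implybT.
    by congr powR; field.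
  rewrite -powR_mulrn// -powRD; last by rewrite pnatr_eq0 implybT.
  rewrite -[leLHS](powRr0 (2 : R)); apply: ler_powR; first by lra.
  by have := ny n; rewrite -(@ler_nat R) natrM; lra.
have an : (block_start n.+1)%:R <= 13 * (n.+1%:R ^+ 2 * n.+1%:R ^+ 2) :> R.
  rewrite -exprD -natrX -natrM ler_nat; apply: (leq_trans (block_start_le _)).
  by rewrite leq_mul2l/= leq_pexp2l.
have /andP[q0 q1] := q01; have /andP[r0 r1] := r01.
have qn0 : 0 < q ^+ n by rewrite exprn_gt0.
have rn0 : 0 < r ^+ n by rewrite exprn_gt0.
have rn1 : r ^+ n <= 1 by rewrite exprn_ile1 ?ltW.
have h := Cr n; have hh := n0P _ nn.
set Q := q ^+ n in qn qn0 h; set Y := 2 ^+ y n in qn *; set s := n.+1%:R ^+ 2 in an h.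
have Y0 : 0 < Y by rewrite exprn_gt0.
have s0 : 0 <= s by rewrite sqr_ge0.
have ss : s * s * (Q * Q) <= (C * r ^+ n) * (C * r ^+ n).
  have -> : s * s * (Q * Q) = (s * Q) * (s * Q) by ring.
  by apply: ler_pM => //; rewrite mulr_ge0// ltW.
apply: (@le_trans _ _ ((`|K| + 1) * (13 * (s * s)))).
  by apply: (@le_trans _ _ (`|K| * (13 * (s * s)))); [
    apply: (@le_trans _ _ (`|K| * (block_start n.+1)%:R)); [
      by apply: ler_wpM2r => //; exact: ler_norm
    | by apply: ler_wpM2l ]
  | by apply: ler_wpM2r; [rewrite !mulr_ge0|rewrite lerDl]].
apply: (@le_trans _ _ ((`|K| + 1) * (13 * (s * s)) * (Q * Q * Y))).
  by rewrite ler_peMr// !mulr_ge0// addr_ge0.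
have -> : (`|K| + 1) * (13 * (s * s)) * (Q * Q * Y) =
    Y * ((13 * (`|K| + 1)) * (s * s * (Q * Q))) by ring.
rewrite -[leRHS]mulr1; apply: ler_wpM2l; first exact: ltW.
apply: (@le_trans _ _ (13 * (`|K| + 1) * (C ^+ 2 * r ^+ n))).
  apply: ler_wpM2l; first by rewrite mulr_ge0// addr_ge0.
  apply: (le_trans ss); rewrite mulrACA -expr2; apply: ler_wpM2l.
    by rewrite sqr_ge0.
  by rewrite ler_piMr// ltW.
have D0 : 0 < 13 * (`|K| + 1) * C ^+ 2.
  by rewrite !mulr_gt0 ?exprn_gt0// ltr_wpDl.
by rewrite mulrA -ler_pdivlMl// mulr1.
Qed.

End SaturatingSeries.

(** * Lower bounds for the dimensions *)

Section CantorGrowth.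
Context {R : realType}.
Implicit Types (g : hardy2 R) (t c s : R).
Variable beta : R.
Hypothesis beta01 : 0 <= beta < 1 / 2.

Let om01 : 0 <= 2 * beta < 1.
Proof. by case/andP: beta01 => h1 h2; apply/andP; split; lra. Qed.

Let zg n := zero_gain (zero_block (2 * beta)) n.

Definition cantor_time (x : R) : R := cantor_angle (2 * beta) x / ln 2.

Let ln2_gt0 : 0 < ln 2 :> R. Proof. by rewrite ln_gt0//; lra. Qed.

Let zg_ge8 n : (n <= 8 * zg n)%N.
Proof.
have /andP[b0 b1] := beta01.
apply: leq_trans _ (zero_gain_ge_len8 om01 n).
rewrite -(@ler_nat R); apply: le_trans (zero_len_ge om01 n).
have : n%:R <= (block_start n)%:R :> R by rewrite ler_nat leq_id_block_start.
move: (n%:R : R) ((block_start n)%:R : R) => u y uy.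
have : 0 <= 2 * beta * (y - u) by rewrite mulr_ge0//; lra.
by lra.
Qed.

(** Zero blocks have density [2 * beta] and half of their length is gained, hence the exponent
    [beta]. The deficits and the passage to [n.+1] are [O(n ^ 2)], absorbed by [beta - c]. For
    [c = beta = 0] there is no such room, and the gain of at least [n / 8] is used instead. *)
Lemma zero_gain_beats_power (c K : R) : 0 <= c -> c < beta \/ c = 0 ->
  exists n0 : nat, forall n, (n0 <= n)%N ->
    K * 2 `^ (c * (block_start n.+1)%:R) <= 2 ^+ zg n.
Proof.
have /andP[b0 b1] := beta01; move=> c0 cb; have [cb'|bc] := ltP c beta; last first.
  have {cb bc}-> : c = 0 by case: cb => // cb; move: bc; rewrite leNgt cb.
  have [n0 n0P] := gain_beats_block_start `|K| zg_ge8.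
  exists n0 => n nn; rewrite mul0r powRr0 mulr1; apply: le_trans (n0P n nn).
  apply: (le_trans (ler_norm K)); rewrite ler_peMr// ler1n.
  by apply: leq_trans (leq_id_block_start n.+1).
have [K1 K10 K1P] := @sqr_le_block_start R 7 (beta - c) ltac:(lra) ltac:(lra).
have [k kP] : exists k : nat, K <= 2 ^+ k.
  exists (Num.bound `|K|); apply: (le_trans (ler_norm K)).
  apply: (le_trans (ltW (archi_boundP (normr_ge0 K)))).
  by rewrite -natrX ler_nat ltnW// ltn_expl.
pose B := (K1 + 13 + 2 * k%:R) / (beta - c).
have B0 : 0 <= B.
  apply: divr_ge0; last by rewrite subr_ge0 ltW.
  have : 0 <= k%:R :> R by [].
  by lra.
exists (Num.bound B) => n nn.
have Bn : B <= n%:R.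
  by apply: (le_trans (ltW (archi_boundP B0))); rewrite ler_nat.
apply: (@le_trans _ _ (2 ^+ k * 2 `^ (c * (block_start n.+1)%:R))).
  by apply: ler_wpM2r => //; exact: powR_ge0.
rewrite -!powR_mulrn// -powRD; last by rewrite pnatr_eq0 implybT.
apply: ler_powR; first by lra.
have h1 := zero_len_ge om01 n; have h2 := zero_gain_ge_len om01 n; have h3 := K1P n.
rewrite -/(zg n) in h2.
have h4 : n%:R <= (block_start n)%:R :> R by rewrite ler_nat leq_id_block_start.
have h5 : (K1 + 13 + 2 * k%:R) <= n%:R * (beta - c) by rewrite -ler_pdivrMr ?subr_gt0.
rewrite block_startS natrD /block_len /half_len !(natrD, natrM, natrX).
have n0 : 0 <= n%:R :> R by [].
have n1 : n%:R <= n%:R ^+ 2 :> R by rewrite -natrX ler_nat leq_id_sqr.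
move: h1 h2 h3 h4 h5 n0 n1.
move: (n%:R : R) ((block_start n)%:R : R) ((zg n)%:R : R) (k%:R : R) => x y z w.
move=> h1 h2 h3 h4 h5 n0 n1.
have h6 : (beta - c) * x <= (beta - c) * y by rewrite ler_pM2l ?subr_gt0.
have h7 : 0 <= (1 - 2 * beta) * x by rewrite mulr_ge0//; lra.
have h8 : c * x ^+ 2 <= x ^+ 2 / 2 by have := sqr_ge0 x; nra.
nra.
Qed.

Section AtPoint.
Variable x : R.
Hypothesis x01 : 0 <= x <= 1.

Let t := cantor_time x.
Let w : R[i] := cis (cantor_angle (2 * beta) x).

Let tln2 : t * ln 2 = cantor_angle (2 * beta) x.
Proof. by rewrite /t /cantor_time divfK// gt_eqF. Qed.

(** A single free block suffices, as its power of [w] is at distance at least 1 from 1. *)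
Let w_neq1 : w != 1.
Proof.
have [i Zi] := exists_free_block om01.
have := cantor_freeP om01 x01 Zi; rewrite -/w; apply: contraTneq => ->.
by rewrite expr1n subrr normc0 -ltNge ltr01.
Qed.

Let t_neq0 : t != 0.
Proof.
apply: contra_neq w_neq1 => t0.
by rewrite /w -tln2 t0 mul0r cis0.
Qed.

Let sum_ge : exists2 k : R, 0 < k & exists C : R, 0 <= C /\ forall n N, (0 < N)%N ->
  (2 ^ block_start n <= trunc_log 2 N <= 2 ^ block_start n.+1)%N ->
  k * 2 ^+ zg n - C <= normc (dirichlet_sum sat_series t N).
Proof.
have t0 : 0 < `|t| by rewrite normr_gt0.
have w10 : 0 < normc (w - 1).
  rewrite lt_neqAle normc_ge0 andbT eq_sym; apply: contra w_neq1 => /eqP/eq0_normc/eqP.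
  by rewrite subr_eq0.
exists (normc (w - 1) / 4 / `|t|); first by rewrite !divr_gt0.
exists ((5 * `|t| + 8 * t ^+ 2) / `|t|); split.
  by rewrite divr_ge0// addr_ge0// mulr_ge0// sqr_ge0.
move=> n N N0 nN.
have h1 := sat_sum_ge t N0; rewrite tln2 -/w in h1.
have h2 := @lacunary_partial_ge R w (zero_block (2 * beta)) (normc_cis _)
  (fun i v Zi => cantor_zeroP om01 x01 Zi) (fun i => @cantor_freeP R _ om01 x x01 i) n _ nN.
rewrite -/(zg n) in h2.
rewrite -(ler_pM2l t0) mulrBr.
have -> : `|t| * (normc (w - 1) / 4 / `|t| * 2 ^+ zg n) =
    normc (w - 1) * (2 ^+ zg n / 4) by field; rewrite gt_eqF.
have -> : `|t| * ((5 * `|t| + 8 * t ^+ 2) / `|t|) = 5 * `|t| + 8 * t ^+ 2.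
  by field; rewrite gt_eqF.
apply: le_trans h1; rewrite lerD2r; apply: ler_wpM2l => //; exact: normc_ge0.
Qed.

(** The summand [ln (ln N) / 2] is the margin left for the comparison with a generic function. *)
Lemma sat_growth c : c < beta -> exists N0 : nat, forall N, (N0 <= N)%N ->
  ln (ln N%:R) / 2 + ln N%:R `^ c <= normc (dirichlet_sum sat_series t N).
Proof.
move=> cb; have /andP[b0 b1] := beta01.
have [k k0 [C [C0 kC]]] := sum_ge.
(* Negative [c], the only possible ones when [beta = 0], are replaced by 0. *)
pose c' := Num.max c 0.
have c'0 : 0 <= c' by rewrite le_max lexx orbT.
have c'b : c' < beta \/ c' = 0.
  by rewrite /c' maxEle; case: ifP => _; [right|left].
have [n1 n1P] := zero_gain_beats_power ((2 + C) / k) c'0 c'b.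
have [n2 n2P] := gain_beats_block_start ((2 + C) / k) zg_ge8.
have [N3 N3P] := @ln_nat_large R 1.
pose m := maxn n1 n2.
exists (maxn N3 (2 ^ 2 ^ block_start m)) => N.
rewrite geq_max => /andP[N3N mN].
have N0 : (0 < N)%N by apply: leq_trans mN; rewrite expn_gt0.
set M := trunc_log 2 N.
have mM : (2 ^ block_start m <= M)%N by rewrite -(@trunc_expnK 2 (2 ^ block_start m))// leq_trunc_log.
have [n /andP[nM Mn] mn] : exists2 n, (2 ^ block_start n <= M < 2 ^ block_start n.+1)%N & (m <= n)%N.
  have ex : exists n, (M < 2 ^ block_start n)%N.
    exists M; apply: (leq_trans (ltn_expl M (isT : (1 < 2)%N))).
    by rewrite leq_exp2l// leq_id_block_start.
  case: (ex_minnP ex) => -[|n] nP nmin.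
    move: nP; rewrite /block_start big_ord0 expn0 ltnS leqn0 => /eqP M0.
    by move: mM; rewrite M0 leqn0 expn_eq0.
  exists n.
    by rewrite nP andbT leqNgt; apply/negP => /nmin; rewrite ltnn.
  rewrite leqNgt; apply/negP => nm.
  have : (2 ^ block_start n.+1 <= M)%N.
    by apply: leq_trans mM; rewrite leq_exp2l// leq_block_start.
  by rewrite leqNgt nP.
have lnN1 : 1 < ln N%:R :> R by exact: N3P.
set a : R := (block_start n.+1)%:R.
have lnN : ln N%:R <= 2 ^+ block_start n.+1 :> R.
  have /andP[_ NM] : (2 ^ M <= N < 2 ^ M.+1)%N by exact: trunc_log_bounds.
  apply: (@le_trans _ _ (ln ((2 ^ M.+1)%N%:R))).
    by rewrite ler_ln ?posrE ?ltr0n ?expn_gt0// ler_nat ltnW.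
  rewrite natrX lnXn// -[leLHS]mulr_natr; apply: (@le_trans _ _ (1 * M.+1%:R)).
    apply: ler_wpM2r => //; have := @le_ln1Dx R 1 ltac:(lra).
    by have -> : 1 + 1 = 2 :> R by [].
  by rewrite mul1r -natrX ler_nat.
have lnlnN : ln (ln N%:R) <= a.
  apply: (@le_trans _ _ (ln (2 ^+ block_start n.+1))).
    by rewrite ler_ln ?posrE ?exprn_gt0//; lra.
  rewrite lnXn// -[leLHS]mulr_natr -/a ler_piMl//.
  have := @le_ln1Dx R 1 ltac:(lra).
  by have -> : 1 + 1 = 2 :> R by [].
have lnNc : ln N%:R `^ c <= 2 `^ (c' * a).
  apply: (@le_trans _ _ (ln N%:R `^ c')).
    by apply: ler_powR; [exact: ltW|rewrite le_max lexx].
  rewrite mulrC powRrM; apply: ge0_ler_powR => //; rewrite ?nnegrE ?powR_ge0//.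
    by lra.
  by rewrite /a powR_mulrn.
have a1 : 1 <= a by rewrite ler1n (leq_trans _ (leq_id_block_start n.+1)).
have p1 : 1 <= 2 `^ (c' * a).
  rewrite -[leLHS](powRr0 (2 : R)); apply: ler_powR; first by lra.
  by rewrite mulr_ge0.
have g1 := n1P _ (leq_trans (leq_maxl _ _) mn); rewrite -/a in g1.
have g2 := n2P _ (leq_trans (leq_maxr _ _) mn); rewrite -/a in g2.
have S := kC n N N0; rewrite nM (ltnW Mn) in S; have {}S := S isT.
apply: le_trans S.
have kk z : (2 + C) / k * z <= 2 ^+ zg n -> (2 + C) * z <= k * 2 ^+ zg n.
  by rewrite mulrAC ler_pdivrMr// mulrC [_ * k]mulrC.
(* Half the sum of these estimates dominates [a / 2 + 2 ^ (c' * a) + C], since [a] and the power are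
   at least 1. *)
have f1 := kk _ g1; have f2 := kk _ g2.
have e1 : 0 <= C * (2 `^ (c' * a) - 1) by rewrite mulr_ge0// subr_ge0.
have e2 : 0 <= C * (a - 1) by rewrite mulr_ge0// subr_ge0.
by lra.
Qed.

End AtPoint.

Lemma cantor_time_holder s : 0 <= s < 1 - 2 * beta ->
  exists2 C : R, 0 <= C & forall x y, 0 <= x <= 1 -> 0 <= y <= 1 ->
    `|x - y| <= C * `|cantor_time x - cantor_time y| `^ s.
Proof.
move=> s01; have [C C0 CP] := cantor_point_holder om01 s01.
have [p p0 pE] : exists2 p : R, 0 < p & p = pi *+ 2 / ln 2.
  by exists (pi *+ 2 / ln 2) => //; rewrite divr_gt0// pmulrn_lgt0// pi_gt0.
exists (C / p `^ s); first by rewrite divr_ge0// powR_ge0.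
move=> x y x01 y01; apply: (le_trans (CP _ _ x01 y01)).
have -> : cantor_time x - cantor_time y =
    p * (cantor_point (2 * beta) x - cantor_point (2 * beta) y).
  by rewrite pE /cantor_time /cantor_angle; ring.
rewrite normrM (gtr0_norm p0) powRM ?(ltW p0)// mulrA divfK//.
by rewrite gt_eqF// powR_gt0.
Qed.

(* Sets of smaller dimension pull back to Lebesgue-null sets of [0, 1], so the
   points with a larger exponent can be thrown away. *)
Lemma hausdorff_measure_cantor g E s : 0 <= s < 1 - 2 * beta ->
  (forall x, 0 <= x <= 1 -> (beta_DS_minus g (cantor_time x) <= beta%:E)%E ->
    E (cantor_time x)) ->
  hausdorff_measure s E <> 0%E.
Proof.
move=> s01 gE E0; have /andP[b0 b1] := beta01.
pose I01 : set R := `[0, 1]%classic.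
have null r A : 0 <= r < 1 - 2 * beta -> hausdorff_measure r A = 0%E ->
    hausdorff_measure 1 (I01 `&` cantor_time @^-1` A) = 0%E.
  move=> r01 A0; have [C C0 CP] := cantor_time_holder r01.
  apply: (hausdorff_measure_holder _ C0 _ A0); first by case/andP: r01.
  by move=> x y; rewrite /I01/= !in_itv/=; exact: CP.
apply: (@hausdorff_measure_itv01 R).
apply: (@hausdorff_measure0S _ _ _ ((I01 `&` cantor_time @^-1` E) `|`
  \bigcup_n (I01 `&` cantor_time @^-1` calE_DS_minus (beta + n.+1%:R^-1) g))).
  move=> x x01; have x01' : 0 <= x <= 1 by move: x01; rewrite /= in_itv.
  have [le|gt] := leP (beta_DS_minus g (cantor_time x)) beta%:E.
    by left; split => //; exact: gE.
  right; have [n nP] : exists n : nat,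
      ((beta + n.+1%:R^-1)%:E <= beta_DS_minus g (cantor_time x))%E.
    move: gt; case: (beta_DS_minus g _) => [r| |] //.
      rewrite lte_fin => br; have br' : 0 < r - beta by rewrite subr_gt0.
      exists (Num.bound (r - beta)^-1); rewrite lee_fin -lerBrDl.
      rewrite -[leRHS]invrK lef_pV2 ?posrE ?invr_gt0//.
      apply: (le_trans (ltW (archi_boundP _))); first by rewrite invr_ge0 ltW.
      by rewrite ler_nat.
    by move=> _; exists 0%N; rewrite leey.
  by exists n.
apply: hausdorff_measure0U; first exact: null E0.
apply: hausdorff_measure0_bigcup => n.
have n0 : 0 < n.+1%:R^-1 :> R by rewrite invr_gt0.
pose d : R := n.+1%:R^-1; rewrite -/d in n0 *.
(* This exponent lies strictly between [1 - 2 * (beta + d)], where the upper bound applies, and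
   [1 - 2 * beta], where the pull-back does. *)
apply: (@null (Num.max 0 (1 - 2 * beta - d))).
  by rewrite le_max lexx/= gt_max; apply/andP; split; lra.
apply: hausdorff_calE_minus; first by rewrite le_max lexx.
by rewrite lt_max; apply/orP; right; lra.
Qed.

End CantorGrowth.

(** * Generic functions *)

Section Baire.
Context {R : realType}.
Implicit Types (g h : hardy2 R) (t c s : R).

Lemma normc_dirichlet_monomial t k : (0 < k)%N ->
  normc (dirichlet_monomial t k) <= 1.
Proof.
move=> k0; rewrite normcM normcR -/(cis _) normc_cis mulr1 ger0_norm ?powR_ge0//.
rewrite powRN invf_le1 ?powR_gt0 ?ltr0n//.
by rewrite -[leLHS](powRr0 (k%:R : R)); apply: ler_powR; rewrite ?ler1n.
Qed.

(** An [l1] distance, because it bounds the difference of the partial sums uniformly in [t]. *)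
Definition coef_dist n g h : R := \sum_(1 <= k < n.+1) normc (g k - h k).

Lemma dirichlet_sum_dist g h t n :
  normc (dirichlet_sum g t n - dirichlet_sum h t n) <= coef_dist n g h.
Proof.
rewrite /dirichlet_sum -sumrB; apply: (le_trans (normc_sum _ _ _)).
apply: ler_sum_nat => k /andP[k0 _]; rewrite -mulrBl normcM.
by apply: ler_piMr; [exact: normc_ge0|exact: normc_dirichlet_monomial].
Qed.

Lemma normc_coef_le g k : normc (g k) <= h2_norm g.
Proof.
case: k => [|k].
  have -> : g 0%N = 0 by case: g => b /= /andP[/eqP].
  by rewrite normc0 sqrtr_ge0.
rewrite -ler_sqr ?nnegrE ?normc_ge0 ?sqrtr_ge0//.
apply: le_trans (sum_sqr_le_h2_norm g k.+2); rewrite big_nat_recr//= lerDr.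
by apply: sumr_ge0 => *; exact: sqr_ge0.
Qed.

Lemma coef_dist_lip n g g' h : coef_dist n g h <= coef_dist n g' h + n%:R * h2_norm (g - g').
Proof.
apply: (@le_trans _ _ (\sum_(1 <= k < n.+1) (normc (g' k - h k) + h2_norm (g - g')))).
  apply: ler_sum => k _; apply: (le_trans (normc_distD _ (g' k) _)).
  by rewrite addrC lerD2l; exact: (normc_coef_le (g - g')).
by rewrite big_split/= sumr_const_nat subn1/= mulr_natl.
Qed.

Definition close_often (h : hardy2 R) (q : nat) : set (hardy2 R) :=
  [set g | exists2 n, (q <= n)%N & coef_dist n g h < ln (ln n%:R) / 2].

Lemma close_often_open h q : open (close_often h q).
Proof.
rewrite openE => g [n qn gn]; apply/nbhs_ballP.
pose e := (ln (ln n%:R) / 2 - coef_dist n g h) / (n%:R + 1) : R.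
have n1 : 0 < n%:R + 1 :> R by rewrite ltr_wpDl.
have e0 : 0 < e by rewrite divr_gt0// subr_gt0.
exists e%:C => /=; first by rewrite ltcR.
move=> g'; rewrite -ball_normE /= hardy2_normE ltcR => gg'.
exists n => //; apply: (le_lt_trans (coef_dist_lip n g' g h)).
rewrite -ltrBrDl; apply: (@le_lt_trans _ _ (n%:R * e)).
  apply: ler_wpM2l => //; apply: ltW.
  have -> : h2_norm (g' - g) = h2_norm (g - g'); last by [].
  by apply: complexI; rewrite -!hardy2_normE distrC.
by rewrite /e mulrA ltr_pdivrMr// mulrC ltr_pM2l ?subr_gt0// ltrDl.
Qed.

Lemma tail_hardy2 g (K : nat) :
  (fun k => if (k < K)%N then 0 else g k) \in @hardy2_pred R.
Proof.
apply/andP; split.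
  by apply/eqP; case: ifP => // _; case: g => b /= /andP[/eqP].
have : (h2_sqnorm g < +oo)%E by case: g => b /= /andP[].
apply: le_lt_trans; apply: lee_nneseries => [k _ _|k _]; rewrite lee_fin ?sqr_ge0//.
by case: ifP => // _; rewrite normc0 expr0n sqr_ge0.
Qed.

Definition hardy2_tail g K : hardy2 R := Hardy2 (tail_hardy2 g K).

Lemma h2_norm_tail_small g (e : R) : 0 < e -> exists K, h2_norm (hardy2_tail g K) <= e.
Proof.
move=> e0; have goo : (h2_sqnorm g < +oo)%E by case: g => b /= /andP[].
have g0 : (0 <= h2_sqnorm g)%E by apply: nneseries_ge0 => k _ _; rewrite lee_fin sqr_ge0.
have gfin : h2_sqnorm g \is a fin_num by rewrite ge0_fin_numE.
have gE : h2_norm g ^+ 2 = fine (h2_sqnorm g) by rewrite sqr_sqrtr ?fine_ge0.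
have [K KP] : exists K, h2_norm g ^+ 2 - e ^+ 2 <= \sum_(1 <= k < K) normc (g k) ^+ 2.
  apply: contrapT => H.
  have : (h2_sqnorm g <= (h2_norm g ^+ 2 - e ^+ 2)%:E)%E.
    apply: lime_le; first by apply: is_cvg_nneseries => k _ _; rewrite lee_fin sqr_ge0.
    apply: nearW => n; rewrite sumEFin lee_fin leNgt; apply/negP => h.
    by apply: H; exists n; exact: ltW.
  rewrite -[h2_sqnorm g]fineK// -gE lee_fin => h.
  have : 0 < e ^+ 2 by rewrite exprn_gt0.
  by lra.
exists K; rewrite /h2_norm -(ger0_norm (ltW e0)) -sqrtr_sqr ler_sqrt ?sqr_ge0//.
have : (h2_sqnorm (hardy2_tail g K) <= (e ^+ 2)%:E)%E.
  apply: lime_le; first by apply: is_cvg_nneseries => k _ _; rewrite lee_fin sqr_ge0.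
  apply: nearW => n; rewrite sumEFin lee_fin /=.
  have [nK|Kn] := leqP n K.
    rewrite big1_seq ?sqr_ge0// => k /andP[_]; rewrite mem_index_iota => /andP[_ kn].
    by rewrite (leq_trans kn nK) normc0 expr0n.
  have [K1|K1] := leqP K 1.
    rewrite (@big_geq _ _ _ 1 K)// in KP.
    apply: (@le_trans _ _ (\sum_(1 <= k < n) normc (g k) ^+ 2)).
      apply: ler_sum_nat => k _; case: ifP => // _; by rewrite normc0 expr0n sqr_ge0.
    by apply: (le_trans (sum_sqr_le_h2_norm g n)); lra.
  rewrite (@big_cat_nat _ _ _ K 1 n)//=; try exact: ltnW.
  rewrite [X in X + _ <= _](_ : _ = 0); last first.
    by rewrite big_nat big1// => k /andP[_ ->]; rewrite normc0 expr0n.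
  rewrite add0r (eq_big_nat _ _ (F2 := fun k => normc (g k) ^+ 2)); last first.
    by move=> k /andP[Kk _]; rewrite ltnNge Kk.
  have := sum_sqr_le_h2_norm g n.
  rewrite (@big_cat_nat _ _ _ K 1 n)//=; try exact: ltnW.
  by lra.
have t0 : (0 <= h2_sqnorm (hardy2_tail g K))%E.
  by apply: nneseries_ge0 => k _ _; rewrite lee_fin sqr_ge0.
move=> h; rewrite -lee_fin fineK// ge0_fin_numE//.
by apply: (le_lt_trans h); rewrite ltry.
Qed.

(** Replacing the coefficients of [g] beyond a large [K] by those of [h] moves [g] little in norm
    and keeps [coef_dist] to [h] bounded in [n], whereas [ln (ln n)] is unbounded. *)
Lemma close_often_dense h q : dense (close_often h q).
Proof.
move=> O [g Og]; rewrite openE => /(_ _ Og) /nbhs_ballP[e /= e0 eO].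
(* The norm takes values in [R[i]], where a positive element is real. *)
have [e1 e1E] : exists e1 : R, e = e1%:C.
  by exists (complex.Re e); move: e0; case: (e) => u v; rewrite ltcE/= => /andP[/eqP -> _].
have e10 : 0 < e1 by rewrite -ltcR -e1E.
have e2 : 0 < e1 / 2 by rewrite divr_gt0.
have [K KP] := h2_norm_tail_small (h - g) e2.
pose g' := g + hardy2_tail (h - g) K.
have g'E k : g' k = if (k < K)%N then g k else h k.
  rewrite [LHS](_ : _ = g k + if (k < K)%N then 0 else (h k - g k))//.
  by case: ifP => _; rewrite ?addr0// addrC subrK.
exists g'; split.
  apply: eO; rewrite -ball_normE /= e1E hardy2_normE.
  have -> : g - g' = - hardy2_tail (h - g) K by rewrite /g' opprD addrA subrr add0r.
  rewrite -hardy2_normE normrN hardy2_normE ltcR; apply: (le_lt_trans KP); lra.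
pose B := \sum_(1 <= k < K) normc (g k - h k).
have [n0 n0P] := ln_nat_large (expR (2 * B)).
exists (maxn q n0); first exact: leq_maxl.
set n := maxn q n0; have nP := n0P n (leq_maxr _ _).
have nB : 2 * B < ln (ln n%:R).
  rewrite -ltr_expR lnK// posrE; apply: lt_trans nP; exact: expR_gt0.
apply: (@le_lt_trans _ _ B); last by lra.
apply: (@le_trans _ _ (\sum_(1 <= k < n.+1) if (k < K)%N then normc (g k - h k) else 0)).
  apply: ler_sum => k _; rewrite g'E; case: ifP => // _.
  by rewrite subrr normc0.
rewrite -big_mkcond/= /B; have [nK|Kn] := leqP n.+1 K.
  rewrite [leRHS](@big_cat_nat _ _ _ n.+1)//= big_mkcond/=.
  apply: ler_wpDr; first by apply: sumr_ge0 => *; exact: normc_ge0.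
  by apply: ler_sum => k _; case: ifP => // _; exact: normc_ge0.
by rewrite [leRHS](big_nat_widen _ _ _ _ _ (ltnW Kn)).
Qed.

Lemma packing_measure0S s (E A : set R) : E `<=` A ->
  packing_measure s A = 0%E -> packing_measure s E = 0%E.
Proof.
move=> EA A0; apply/eqP; rewrite eq_le; apply/andP; split.
  rewrite -A0; apply: ereal_inf_le_tmp => _ [F AF <-].
  by exists F => //; exact: subset_trans AF.
apply: le_ereal_inf_tmp => _ [G _ <-].
by apply: nneseries_ge0 => i _ _; exact: packing_premeasure_ge0.
Qed.

Lemma ereal_le_approx (beta : R) (y : \bar R) :
  (forall c, c < beta -> (c%:E <= y)%E) -> (beta%:E <= y)%E.
Proof.
move=> H; apply/lee_subgt0Pr => e e0; rewrite -EFinB; apply: H.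
by rewrite ltrBlDr ltrDl.
Qed.

Lemma beta_DS_minus_close g (beta x : R) : 0 <= beta < 1 / 2 -> 0 <= x <= 1 ->
  (forall q, close_often sat_series q g) ->
  (beta%:E <= beta_DS_minus g (cantor_time beta x))%E.
Proof.
move=> b01 x01 gq; apply: ereal_le_approx => c cb.
have [N0 N0P] := sat_growth b01 x01 cb; have [N1 N1P] := @ln_nat_large R 1.
apply: le_limn_esup => q; have [n qn gn] := gq (maxn q (maxn N0 N1)).
move: qn; rewrite !geq_max => /andP[qn /andP[N0n N1n]]; exists n => //.
apply: le_growth_exponent; first exact: N1P.
have h1 := N0P _ N0n; have h2 := dirichlet_sum_dist g sat_series (cantor_time beta x) n.
have := normc_distD (dirichlet_sum sat_series (cantor_time beta x) n)
  (dirichlet_sum g (cantor_time beta x) n) 0.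
by rewrite !subr0 normcB; lra.
Qed.

Lemma beta_DS_plus_sat (beta x : R) : 0 <= beta < 1 / 2 -> 0 <= x <= 1 ->
  (beta%:E <= beta_DS_plus (@sat_series R) (cantor_time beta x))%E.
Proof.
move=> b01 x01; apply: ereal_le_approx => c cb.
have [N0 N0P] := sat_growth b01 x01 cb; have [N1 N1P] := @ln_nat_large R 1.
apply: (@le_limn_einf _ _ _ (maxn N0 N1)) => n.
rewrite geq_max => /andP[N0n N1n]; apply: le_growth_exponent; first exact: N1P.
apply: le_trans (N0P _ N0n); rewrite lerDr divr_ge0// ln_ge0// ltW//.
exact: N1P.
Qed.

End Baire.

Theorem theorem5p1 (R : realType) :
  [/\ (* (i) *)
      forall (g : hardy2 R) (beta : R), 0 <= beta <= 1 / 2 ->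
        (hausdorff_dim (calE_DS_minus beta g) <= (1 - 2 * beta)%:E)%E /\
        (packing_dim (calE_DS_plus beta g) <= (1 - 2 * beta)%:E)%E,
      (* (ii) *)
      residual [set g : hardy2 R | forall beta : R, 0 <= beta <= 1 / 2 ->
        hausdorff_dim (E_DS_minus beta g) = (1 - 2 * beta)%:E] &
      (* (iii) *)
      exists g : hardy2 R, forall beta : R, 0 <= beta <= 1 / 2 ->
        hausdorff_dim (E_DS beta g) = (1 - 2 * beta)%:E /\
        packing_dim (E_DS beta g) = (1 - 2 * beta)%:E].
Proof.
split.
- move=> g beta /andP[b0 b1]; have bb : 0 <= 1 - 2 * beta by lra.
  split.
    apply: hausdorff_dim_le => // s sb.
    by apply: hausdorff_calE_minus => //; lra.
  apply: packing_dim_le => // s sb.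
  by apply: packing_calE_plus => //; lra.
- exists (\bigcap_q close_often sat_series q).
    exists (close_often sat_series) => // q; split.
      exact: close_often_open.
    exact: close_often_dense.
  move=> g gq beta /andP[b0 b1]; have bb : 0 <= 1 - 2 * beta by lra.
  apply/eqP; rewrite eq_le; apply/andP; split.
    apply: hausdorff_dim_le => // s sb.
    apply: (@hausdorff_measure0S _ _ _ (calE_DS_minus beta g)).
      by move=> t; rewrite /E_DS_minus /calE_DS_minus/= => ->.
    by apply: hausdorff_calE_minus => //; lra.
  (* The Cantor sets need [beta < 1 / 2]; at the endpoint the claim is only that a dimension is
     nonnegative. *)
  have [->|bn] := eqVneq beta (1 / 2).
    have -> : 1 - 2 * (1 / 2) = 0 :> R by lra.
    exact: hausdorff_dim_ge0.
  have b01 : 0 <= beta < 1 / 2 by rewrite b0 lt_neqAle bn.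
  apply: hausdorff_dim_ge => s s01.
  apply: (hausdorff_measure_cantor b01 s01 (g := g)) => x x01 le.
  rewrite /E_DS_minus/=; apply/eqP; rewrite eq_le le/=.
  by apply: beta_DS_minus_close => // q; exact: gq.
- exists sat_series => beta /andP[b0 b1]; have bb : 0 <= 1 - 2 * beta by lra.
  (* Vacuous at [beta = 1 / 2], so the endpoint needs no separate case here. *)
  have h_ge (s : R) : 0 <= s < 1 - 2 * beta ->
      hausdorff_measure s (E_DS beta sat_series) <> 0%E.
    move=> s01; have b01 : 0 <= beta < 1 / 2.
      by case/andP: s01 => h1 h2; rewrite b0/=; lra.
    apply: (hausdorff_measure_cantor b01 s01 (g := sat_series)) => x x01 le.
    have ge := beta_DS_plus_sat b01 x01.
    have pm : (beta_DS_plus sat_series (cantor_time beta x) <=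
        beta_DS_minus sat_series (cantor_time beta x))%E := limn_einf_sup _.
    split; apply/eqP; rewrite eq_le.
      by rewrite le (le_trans ge pm).
    by rewrite ge (le_trans pm le).
  split; apply/eqP; rewrite eq_le; apply/andP; split.
  + apply: hausdorff_dim_le => // s sb.
    apply: (@hausdorff_measure0S _ _ _ (calE_DS_minus beta sat_series)).
      by move=> t [h _]; rewrite /calE_DS_minus/= h.
    by apply: hausdorff_calE_minus => //; lra.
  + exact: hausdorff_dim_ge.
  + apply: packing_dim_le => // s sb.
    apply: (@packing_measure0S _ _ _ (calE_DS_plus beta sat_series)).
      by move=> t [_ h]; rewrite /calE_DS_plus/= h.
    by apply: packing_calE_plus => //; lra.
  + exact: packing_dim_ge.
Qed.
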